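(* Fix $\beta>0$ and constants $L_0>0$, $c_1,c_2\in(0,1)$, $c_3>0$. Let $\Theta_\beta$ be the collection of all $(\boldsymbol g,\Pi)$, where $\boldsymbol g=(g_1,\dots,g_K)'$ is a vector of probability densities on $\mathbb{R}$ and $\Pi=[\pi_1,\dots,\pi_n]'\in\mathbb{R}^{n\times K}$ has rows in the standard probability simplex of $\mathbb{R}^K$, such that: (1) each $g_k$ has a derivative of order $\lfloor\beta\rfloor$ and $\bigl(\int|g_k^{(\lfloor\beta\rfloor)}(x+t)-g_k^{(\lfloor\beta\rfloor)}(x)|^2dx\bigr)^{1/2}\le L_0|t|^{\beta-\lfloor\beta\rfloor}$ for all $t\in\mathbb{R}$; (2) for each $k$, the set $\{x: g_k(x)>0,\ g_\ell(x)=0\ \forall\ell\ne k\}$ has Lebesgue measure at least $c_3$; (3) with $\bar g=\frac1K\sum_kg_k$, $\Sigma_{\boldsymbol g}=\frac1K\int\boldsymbol g(x)\boldsymbol g(x)'dx$, $\Sigma_\Pi=(K/n)\Pi'\Pi$ and $\eta=\Pi'\mathbf{1}_n$: $c_1\le\lambda_{\min}(\Sigma_{\boldsymbol g})\le\lambda_{\max}(\Sigma_{\boldsymbol g})\le c_1^{-1}$, $\max_x\bar g(x)\le c_1^{-1}$, $c_2<\lambda_{\min}(\Sigma_\Pi)\le\lambda_{\max}(\Sigma_\Pi)\le c_2^{-1}$, and all entries of $\eta$ lie in $[c_2K^{-1}n,\,c_2^{-1}K^{-1}n]$. Under the model in which the samples $X_{ij}$ are independent with $X_{i1},\dots,X_{iN_i}\overset{iid}{\sim}f_i(x)=\sum_{k=1}^K\pi_i(k)g_k(x)$,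 $1\le i\le n$, where $N_i\asymp N$, there exists a constant $C_0'>0$ such that $$\inf_{\widehat{\boldsymbol g}}\ \sup_{(\boldsymbol g,\Pi)\in\Theta_\beta}\mathbb{E}\Bigl[\int\|\widehat{\boldsymbol g}(x)-\boldsymbol g(x)\|^2dx\Bigr]\ge C_0'K\Bigl(\frac{K}{Nn}\Bigr)^{\frac{2\beta}{2\beta+1}},$$ where the infimum is over all estimators $\widehat{\boldsymbol g}$ based on $\{X_{ij}\}$, and the error is measured up to a permutation of the $K$ components of $\widehat{\boldsymbol g}$.
   Context: Asymptotic conventions: $n,N,N_i,K$ may vary along a sequence with $Nn\to\infty$ ($K$ may grow); $\asymp$ refers to this sequence, uniformly in $i$; ''constant'' means not varying along the sequence. $\lfloor\beta\rfloor$ is the largest integer strictly smaller than $\beta$. $A'$ denotes the transpose and $\mathbf{1}_n$ the all-ones vector. The constants $L_0,c_1,c_2,c_3$ defining the class are fixed.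
   Formalization: Adds the assumption that for some constant c_1' > c_1, not varying along the sequence, the class Θ_β with c_1' in place of c_1 is nonempty for every index; without it Θ_β may be empty or contain only translates of one density, and the bound fails. *)

(* Defs.v *)
From HB Require Import structures.
From mathcomp Require Import all_boot all_order all_algebra all_fingroup.
From mathcomp Require Import all_classical all_reals all_analysis.

Set Implicit Arguments.
Unset Strict Implicit.
Unset Printing Implicit Defensive.

Import Order.TTheory GRing.Theory Num.Theory.
Import numFieldNormedType.Exports.

Local Open Scope classical_set_scope.
Local Open Scope ring_scope.

(* Largest integer strictly smaller than b, as a natural number; only meant
   for b > 0, where it is nonnegative.  In particular strict_floor 1 = 0. *)
Definition strict_floor (R : realType) (b : R) : nat := `|Num.ceil b - 1|%N.

Lemma strict_floor_itv (R : realType) (b : R) : 0 < b ->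
  (strict_floor b)%:R < b <= (strict_floor b).+1%:R.
Proof.
move=> b0; have c1 : (0 <= Num.ceil b - 1)%R.
  by rewrite subr_ge0 -gtz0_ge1 ceil_gt0.
have /andP[lb ub] := ceil_itv b.
have e : (strict_floor b)%:R = (Num.ceil b - 1)%:~R :> R.
  by rewrite /strict_floor -[in RHS](gez0_abs c1).
by rewrite -natr1 e lb /= intrB subrK.
Qed.

Section linear_algebra.
Variables (R : realType) (n : nat).

(* Only used on symmetric matrices of positive size, whose real eigenvalues
   form a nonempty finite set, so that the extrema are attained. *)
Definition lambda_min (A : 'M[R]_n) : R := inf [set a | eigenvalue A a].

Definition lambda_max (A : 'M[R]_n) : R := sup [set a | eigenvalue A a].

End linear_algebra.

Section parameter_space.
Variable R : realType.
Local Notation mu := (@lebesgue_measure R).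

Definition is_density (f : R -> R) : Prop :=
  [/\ measurable_fun [set: R] f, forall x, 0 <= f x &
      (\int[mu]_x (f x)%:E = 1)%E].

Definition nikolski (beta L0 : R) (f : R -> R) : Prop :=
  let m := strict_floor beta in
  (forall j x, (j < m)%N -> derivable (derive1n j f) x 1) /\
  forall t,
    (Lnorm mu 2%:E (fun x => (derive1n m f (x + t) - derive1n m f x)%:E)
     <= (L0 * `|t| `^ (beta - m%:R))%:E)%E.

Variables K n : nat.

Definition anchor_set (g : 'I_K -> R -> R) (k : 'I_K) : set R :=
  [set x | 0 < g k x /\ forall l, l != k -> g l x = 0].

Definition gbar (g : 'I_K -> R -> R) (x : R) : R :=
  K%:R^-1 * \sum_(k < K) g k x.

Definition Sigma_g (g : 'I_K -> R -> R) : 'M[R]_K :=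
  \matrix_(k, l) (K%:R^-1 * \int[mu]_x (g k x * g l x)).

Definition Sigma_Pi (Pi : 'M[R]_(n, K)) : 'M[R]_K :=
  (K%:R / n%:R) *: (Pi^T *m Pi).

Definition eta_Pi (Pi : 'M[R]_(n, K)) : 'cV[R]_K := Pi^T *m const_mx 1.

Definition simplex_rows (Pi : 'M[R]_(n, K)) : Prop :=
  (forall i k, 0 <= Pi i k) /\ forall i, \sum_(k < K) Pi i k = 1.

Definition params : Type := (('I_K -> R -> R) * 'M[R]_(n, K))%type.

Definition Theta (beta L0 c1 c2 c3 : R) : set params :=
  [set th | let: (g, Pi) := th in
    [/\ (forall k, is_density (g k)) /\ simplex_rows Pi,
        forall k, nikolski beta L0 (g k),
        forall k, (c3%:E <= mu (anchor_set g k))%E,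
        [/\ c1 <= lambda_min (Sigma_g g), lambda_max (Sigma_g g) <= c1^-1 &
            forall x, gbar g x <= c1^-1] &
        [/\ c2 < lambda_min (Sigma_Pi Pi), lambda_max (Sigma_Pi Pi) <= c2^-1 &
            forall k, c2 * K%:R^-1 * n%:R <= eta_Pi Pi k 0
                      <= c2^-1 * K%:R^-1 * n%:R]]].

Definition mixture (th : params) (i : 'I_n) (x : R) : R :=
  \sum_(k < K) th.2 i k * th.1 k x.

End parameter_space.

Arguments Theta {R} K n beta L0 c1 c2 c3 _.

(* Index set of the observations: pairs (i, j) with j < Ni i. *)
Definition obs (n : nat) (Ni : 'I_n -> nat) := {i : 'I_n & 'I_(Ni i)}.

Section sampling.
Context d (Om : measurableType d) (R : realType).
Local Notation mu := (@lebesgue_measure R).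

Definition mutually_independent (I : finType) (P : probability Om R)
    (X : I -> Om -> R) : Prop :=
  forall (J : {set I}) (A : I -> set R), (forall i, measurable (A i)) ->
    P (\bigcap_(i in [set` J]) (X i @^-1` A i))
    = (\prod_(i in J) P (X i @^-1` A i))%E.

Definition has_density (P : probability Om R) (X : Om -> R) (f : R -> R) : Prop :=
  forall A : set R, measurable A ->
    P (X @^-1` A) = (\int[mu]_(x in A) (f x)%:E)%E.

Variables (K n : nat) (Ni : 'I_n -> nat).

Definition sampling_model (P : probability Om R) (X : obs Ni -> Om -> R)
    (th : params R K n) : Prop :=
  [/\ forall o, measurable_fun [set: Om] (X o),
      mutually_independent P X &
      forall o, has_density P (X o) (mixture th (tag o))].

(* The observations listed as one tuple, so that the sample space carries the
   product sigma-algebra of tuples. *)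
Local Notation data := (#|{: obs Ni}|.-tuple R).

Definition data_of (X : obs Ni -> Om -> R) (w : Om) : data :=
  [tuple X (enum_val q) w | q < #|{: obs Ni}|].

(* Joint measurability in the data and in x makes the integrated loss a
   measurable function of the data. *)
Definition estimator : set (data -> 'I_K -> R -> R) :=
  [set ghat | forall k, measurable_fun [set: data * R]
                          (fun p => ghat p.1 k p.2)].

(* Squared L2 error, minimized over relabellings of the estimated components. *)
Definition loss (h g : 'I_K -> R -> R) : \bar R :=
  (\big[Order.min/+oo]_(s : 'S_K)
     \int[mu]_x (\sum_(k < K) (h (s k) x - g k x) ^+ 2)%:E)%E.

Definition risk (P : probability Om R) (X : obs Ni -> Om -> R)
    (ghat : data -> 'I_K -> R -> R) (g : 'I_K -> R -> R) :
    \bar R :=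
  (\int[P]_w loss (ghat (data_of X w)) g)%E.

Definition minimax_risk (P : params R K n -> probability Om R)
    (X : obs Ni -> Om -> R) (Th : set (params R K n)) : \bar R :=
  ereal_inf [set ereal_sup [set risk (P th) X ghat th.1 | th in Th]
            | ghat in estimator].

End sampling.

(* Main.v *)
(* Assouad's lemma on perturbations of one pair (g, Pi) of the class with constant
   c1' > c1, keeping Pi fixed.  After a dilation all the constraints on g hold with
   room to spare; each g_k then becomes (1 - eps) g_k + eps q, where q is a density on
   [0, delta] carrying J bumps of height J^-beta that are switched by J bits; eps
   is small but constant, so the constraints still hold.  Two components of g are
   far apart in L2, hence a relabelling never helps to match two perturbations,
   and the loss is bounded below by the Hamming distance of the K J bits, each
   worth a multiple of J^(-2 beta - 1).  Flipping one bit of the component k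
   changes the chi-square divergence of the whole sample by a multiple of
   sum_i N_i Pi(i, k) J^(-2 beta - 1), of order (N n / K) J^(-2 beta - 1), which
   is small for J of order (N n / K)^(1 / (2 beta + 1)). *)

(* The laws [P th] live on an arbitrary sample space and are known only through independence and the
   one-dimensional densities, so a likelihood ratio is available only for events determined by the
   data; it is obtained by extending the product formula from rectangles. Neighbouring vertices are
   compared through the second moment of this ratio, which factorizes over the observations.

   All constants must be free of [K], which may grow. A combination of the [K] perturbations costs a
   factor [K] by Cauchy-Schwarz, but the Gram constraints of the class carry the same factor, so a
   single [eps] serves every [K].

   Dilation improves smoothness and the anchor sets but shrinks the smallest eigenvalue of
   [Sigma_g]; the gap between [c1] and [c1'] pays for this. The support of [q] is no longer than the
   gain in anchor measure, which keeps the anchor condition. Rounding [J] costs only a constant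
   because [N n / K] is bounded below: [Sigma_Pi] is nonsingular, so [K <= n], and every [N_i] is at
   least 1. *)
Require Import Defs.
From HB Require Import structures.
From mathcomp Require Import all_boot all_order all_algebra all_fingroup.
From mathcomp Require Import all_classical all_reals all_analysis.
From mathcomp Require Import measurable_realfun ring lra.

Set Implicit Arguments.
Unset Strict Implicit.
Unset Printing Implicit Defensive.

Import Order.TTheory GRing.Theory Num.Theory.
Import numFieldNormedType.Exports.

Local Open Scope classical_set_scope.
Local Open Scope ring_scope.

(** * Integration against densities and independence *)

Section real_integrands.
Context d (T : measurableType d) (R : realType).
Variable mu : {measure set T -> \bar R}.
Variables (f g : T -> R).
Hypotheses (mf : measurable_fun [set: T] f) (mg : measurable_fun [set: T] g).
Hypotheses (f0 : forall x, 0 <= f x) (g0 : forall x, 0 <= g x).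

Lemma ge0_integralZ_EFin (c : R) : 0 <= c ->
  (\int[mu]_x (c * f x)%:E = c%:E * \int[mu]_x (f x)%:E)%E.
Proof.
move=> c0; under eq_integral do rewrite EFinM.
by rewrite ge0_integralZl//; [exact/measurable_EFinP|move=> x _; rewrite lee_fin].
Qed.

Lemma ge0_integralD_EFin :
  (\int[mu]_x (f x + g x)%:E = \int[mu]_x (f x)%:E + \int[mu]_x (g x)%:E)%E.
Proof.
under eq_integral do rewrite EFinD.
by rewrite ge0_integralD//; do ?[exact/measurable_EFinP]; move=> x _; rewrite lee_fin.
Qed.

Lemma ge0_le_integral_EFin : (forall x, f x <= g x) ->
  (\int[mu]_x (f x)%:E <= \int[mu]_x (g x)%:E)%E.
Proof.
move=> fg; apply: ge0_le_integral => //; do ?[exact/measurable_EFinP].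
  by move=> x _; rewrite lee_fin.
by move=> x _; rewrite lee_fin.
Qed.

End real_integrands.

Section weighted_integral.
Context d d' (S : measurableType d) (T : measurableType d') (R : realType).
Variables (mu : {measure set S -> \bar R}) (nu : {measure set T -> \bar R}).
Variables (phi : S -> T) (q : S -> R) (c : R).
Hypotheses (mphi : measurable_fun [set: S] phi)
  (mq : measurable_fun [set: S] q) (q0 : forall x, 0 <= q x) (c0 : 0 <= c).
Hypothesis nuE : forall A, measurable A ->
  (c%:E * nu A = \int[mu]_(x in phi @^-1` A) (q x)%:E)%E.

Import HBNNSimple.

Let weighted_indic A : measurable A ->
  (c%:E * \int[nu]_x (\1_A x)%:E = \int[mu]_x (\1_A (phi x) * q x)%:E)%E.
Proof.
move=> mA; rewrite integral_indic// setIT nuE//.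
rewrite integral_mkcond; apply: eq_integral => x _.
rewrite patchE indicE; case: ifPn => [xA|xA].
  by rewrite inE in xA; rewrite mem_set// mul1r.
by rewrite notin_setE in xA; rewrite memNset// mul0r.
Qed.

Let weighted_nnsfun (h : {nnsfun T >-> R}) :
  (c%:E * \int[nu]_x (h x)%:E = \int[mu]_x (h (phi x) * q x)%:E)%E.
Proof.
have mih r : measurable_fun [set: T] (fun x => r * \1_(h @^-1` [set r]) x).
  exact: measurable_funM.
have -> : (fun x => (h (phi x) * q x)%:E) =
    (fun x => (\sum_(r \in range h) ((r * \1_(h @^-1` [set r]) (phi x)) * q x)%:E)%E).
  apply/funext => x; rewrite fimfunE fsumEFin// fsbig_finite//= mulr_suml.
  by rewrite fsbig_finite.
rewrite ge0_integral_fsum//; last 2 first.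
  - move=> r; apply/measurable_EFinP; apply: measurable_funM => //.
    exact: measurableT_comp (mih r) mphi.
  - by move=> r x _; rewrite lee_fin mulr_ge0// -lee_fin EFinM nnfun_muleindic_ge0.
under [X in (_ * X)%E]eq_integral do rewrite fimfunE -fsumEFin//.
rewrite [X in (_ * X)%E]ge0_integral_fsum//; last 2 first.
  - by move=> r; apply/measurable_EFinP.
  - by move=> n x _; rewrite EFinM nnfun_muleindic_ge0.
rewrite ge0_mule_fsumr; last first.
  by move=> r; apply: integral_ge0 => x _; rewrite EFinM nnfun_muleindic_ge0.
apply: eq_fsbigr => r _.
(* A scalar leaves the integral only when it is nonnegative. The level set of a negative value is
   empty because [h >= 0], so both sides vanish. *)
have [r0|r0] := ltP r 0.
  have h0 : h @^-1` [set r] = set0.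
    rewrite -subset0 => x /= hx.
    have : 0 <= h x by [].
    by rewrite hx leNgt r0.
  rewrite h0 [X in (_ * X)%E]integral0_eq; last by move=> x _; rewrite indic0 mulr0.
  by rewrite mule0 integral0_eq// => x _; rewrite indic0 mulr0 mul0r.
under eq_integral do rewrite EFinM.
rewrite ge0_integralZl//; last by apply/measurable_EFinP.
rewrite muleCA weighted_indic//.
under [RHS]eq_integral do rewrite -mulrA EFinM.
rewrite ge0_integralZl//.
- apply/measurable_EFinP; apply: measurable_funM => //.
  exact: measurableT_comp mphi.
- by move=> x _; rewrite lee_fin mulr_ge0.
Qed.

(** [nuE] is the case of indicators; simple functions and monotone convergence do the rest. With
    [phi] the identity this integrates against a density, with [phi] a dilation it is a change of
    variables, and with [q] the product of the other factors it splits off one independent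
    factor. *)
Lemma ge0_integral_weighted (f : T -> R) :
  measurable_fun [set: T] f -> (forall x, 0 <= f x) ->
  (c%:E * \int[nu]_x (f x)%:E = \int[mu]_x (f (phi x) * q x)%:E)%E.
Proof.
move=> mf f0.
have mfE : measurable_fun [set: T] (EFin \o f) by exact/measurable_EFinP.
pose f_ := nnsfun_approx measurableT mfE.
have cf x : (fun n => (f_ n x)%:E) @ \oo --> (f x)%:E.
  by apply: (cvg_nnsfun_approx measurableT mfE) => // y _; rewrite lee_fin.
have ndf x a b : (a <= b)%N -> f_ a x <= f_ b x.
  by move=> ab; exact/lefP/nd_nnsfun_approx.
transitivity (limn (fun n => (c%:E * \int[nu]_x (f_ n x)%:E)%E)).
  rewrite limeMl//.
    congr (_ * _)%E; rewrite -monotone_convergence//=.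
    - by apply: eq_integral => x _; apply/esym/cvg_lim.
    - by move=> n; exact/measurable_EFinP.
    - by move=> n x _; rewrite lee_fin.
    - by move=> x _ a b ab; rewrite lee_fin ndf.
  apply/ereal_nondecreasing_is_cvgn => a b ab; apply: ge0_le_integral => //.
  - by move=> x _; rewrite lee_fin.
  - exact/measurable_EFinP.
  - exact/measurable_EFinP.
  - by move=> x _; rewrite lee_fin ndf.
under eq_fun do rewrite weighted_nnsfun.
rewrite -monotone_convergence//=.
- apply: eq_integral => x _; apply/cvg_lim => //.
  rewrite EFinM; under eq_fun do rewrite EFinM.
  by apply: cvgeZr => //; exact: cf.
- move=> n; apply/measurable_EFinP; apply: measurable_funM => //.
  exact: measurableT_comp.
- by move=> n x _; rewrite lee_fin mulr_ge0.
- by move=> x _ a b ab; rewrite lee_fin ler_wpM2r// ndf.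
Qed.

End weighted_integral.

Section independent_products.
Context d (Om : measurableType d) (R : realType) (I : finType).
Variables (P : probability Om R) (X : I -> Om -> R).
Hypotheses (mX : forall i, measurable_fun [set: Om] (X i))
  (indX : mutually_independent P X).

Let integral_preimage_indic i (A : set R) : measurable (X i @^-1` A) ->
  (\int[P]_w (\1_A (X i w))%:E = P (X i @^-1` A))%E.
Proof. by move=> mA; rewrite -[in RHS](setIT (_ @^-1` _)) -integral_indic. Qed.

Let indep_indic (A : I -> set R) : (forall i, measurable (A i)) ->
  (\int[P]_w (\prod_i \1_(A i) (X i w))%:E = \prod_i P (X i @^-1` A i))%E.
Proof.
move=> mA; have := indX [set: I]%SET mA.
rewrite (_ : \bigcap_(i in _) _ = \bigcap_(i in [set: I]) X i @^-1` A i); last first.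
  by congr bigcap; apply/seteqP; split => i //= _; rewrite finset.in_setT.
under eq_bigl do rewrite finset.in_setT.
move=> <-; rewrite -[in RHS](setIT (\bigcap_(i in _) _)) -integral_indic//; last first.
  apply: fin_bigcap_measurable; first exact: finite_finset.
  by move=> i _; rewrite -[X in measurable X]setTI; exact: mX.
apply: eq_integral => w _; congr EFin.
have [/set_mem wA|wA] := boolP (w \in \bigcap_(i in [set: I]) X i @^-1` A i).
  rewrite indicE mem_set// big1// => i _.
  by rewrite indicE mem_set//; exact: wA.
rewrite [RHS]indicE (negbTE wA).
have : exists i, ~ A i (X i w).
  apply: contrapT => /forallNP h; move/negP: wA; apply; apply/mem_set => i _.
  exact: contrapT (h i).
by move=> [i nA]; rewrite (bigD1 i)//= indicE memNset// mul0r.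
Qed.

(* Induction on the set of indices whose factor is not an indicator. *)
Let expectation_prod_seq (l : seq I) (F : I -> R -> R) (e : I -> R) :
  (forall i, measurable_fun [set: R] (F i)) -> (forall i x, 0 <= F i x) ->
  (forall i, \int[P]_w (F i (X i w))%:E = (e i)%:E)%E ->
  (forall i, i \notin l -> exists2 A, measurable A & F i = \1_A) ->
  (\int[P]_w (\prod_i F i (X i w))%:E = (\prod_i e i)%:E)%E.
Proof.
elim: l F e => [|o l IH] F e mF F0 Fe Find.
  have /choice[A hA] : forall i, exists A, measurable A /\ F i = \1_A.
    by move=> i; have [A mA FA] := Find i isT; exists A.
  transitivity (\int[P]_w (\prod_i \1_(A i) (X i w))%:E)%E.
    apply: eq_integral => w _; congr EFin.
    by apply: eq_bigr => i _; rewrite (hA i).2.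
  rewrite indep_indic; last by move=> i; have [] := hA i.
  rewrite -prodEFin; apply: eq_bigr => i _.
  rewrite -Fe (hA i).2; apply/esym; apply: integral_preimage_indic.
  by rewrite -[X in measurable X]setTI; apply: mX => //; exact: (hA i).1.
pose Xo : {mfun Om >-> R} := HB.pack (X o) (isMeasurableFun.Build _ _ _ _ _ (mX o)).
have e0 i : 0 <= e i by rewrite -lee_fin -Fe integral_ge0// => w _; rewrite lee_fin.
pose c := \prod_(i | i != o) e i.
pose q w := \prod_(i | i != o) F i (X i w).
have mFX i : measurable_fun [set: Om] (fun w => F i (X i w)).
  exact: measurableT_comp.
have mq : measurable_fun [set: Om] q.
  rewrite /q; under eq_fun do rewrite -big_filter.
  exact: measurable_prod.
have q0 w : 0 <= q w by apply: prodr_ge0.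
have c0 : 0 <= c by apply: prodr_ge0.
transitivity (\int[P]_w (F o (Xo w) * q w)%:E)%E.
  by apply: eq_integral => w _; rewrite (bigD1 o).
rewrite -(@ge0_integral_weighted _ _ _ _ _ _ (distribution P Xo) Xo q c)//.
  rewrite ge0_integral_distribution//; last 2 first.
    exact/measurable_EFinP.
    by move=> y; rewrite lee_fin.
  by rewrite [X in (_ * X)%E](Fe o) muleC (bigD1 o)//= EFinM.
move=> A mA.
(* Replacing the factor of [o] by the indicator of [A] leaves one non-indicator factor fewer. The
   induction hypothesis for [F'] is then exactly the identity on sets that [ge0_integral_weighted]
   requires. *)
pose F' i := if i == o then \1_A else F i.
pose e' i := if i == o then fine (P (X o @^-1` A)) else e i.
have mXA : measurable (X o @^-1` A).
  by rewrite -[X in measurable X]setTI; exact: mX.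
have e'E : \prod_i e' i = c * fine (P (X o @^-1` A)).
  rewrite (bigD1 o)//= {1}/e' eqxx mulrC; congr (_ * _).
  by apply: eq_bigr => i io; rewrite /e' (negbTE io).
have := IH F' e'; rewrite e'E EFinM fineK ?fin_num_measure// => <-.
- rewrite integral_mkcond; apply: eq_integral => w _.
  rewrite (bigD1 o)//= /F' eqxx (eq_bigr (fun i => F i (X i w))); last first.
    by move=> i io; rewrite (negbTE io).
  rewrite -/(q w) patchE indicE.
  case: ifPn => [xA|xA].
    by rewrite inE in xA; rewrite mem_set// mul1r.
  by rewrite notin_setE in xA; rewrite memNset// mul0r.
- by move=> i; rewrite /F'; case: eqP.
- by move=> i x; rewrite /F'; case: eqP.
- move=> i; rewrite /F' /e'; case: eqP => [->|_]; last exact: Fe.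
  by rewrite fineK ?fin_num_measure//; apply: integral_preimage_indic.
- move=> i il; rewrite /F'; case: eqP => [_|/eqP io]; first by exists A.
  by apply: Find; rewrite inE negb_or io.
Qed.

Lemma expectation_prod (F : I -> R -> R) (e : I -> R) :
  (forall i, measurable_fun [set: R] (F i)) -> (forall i x, 0 <= F i x) ->
  (forall i, \int[P]_w (F i (X i w))%:E = (e i)%:E)%E ->
  (\int[P]_w (\prod_i F i (X i w))%:E = (\prod_i e i)%:E)%E.
Proof.
move=> mF F0 Fe; apply: (@expectation_prod_seq (enum I)) => // i.
by rewrite mem_enum.
Qed.

End independent_products.

Section pushforward_weighted.
Context d d' (S : measurableType d) (T : measurableType d') (R : realType).
Variables (mu : {measure set S -> \bar R}) (phi : S -> T) (q : S -> R).
Hypotheses (mphi : measurable_fun [set: S] phi)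
  (mq : measurable_fun [set: S] q) (q0 : forall x, 0 <= q x).

(** Makes uniqueness theorems for measures applicable: on rectangles for the likelihood ratio, on
    intervals for the scaling of Lebesgue measure. *)
Lemma weighted_measure : exists m : {measure set T -> \bar R},
  forall A, m A = (\int[mu]_(x in phi @^-1` A) (q x)%:E)%E.
Proof.
pose m (A : set T) := (\int[mu]_(x in phi @^-1` A) (q x)%:E)%E.
have m0 : m set0 = 0%E by rewrite /m preimage_set0 integral_set0.
have m_ge0 A : (0 <= m A)%E by apply: integral_ge0 => x _; rewrite lee_fin.
have m_sigma : semi_sigma_additive m.
  move=> F mF tF mUF; rewrite /m preimage_bigcup ge0_integral_bigcup//.
  - apply: is_cvg_nneseries => n _ _.
    by apply: integral_ge0 => x _; rewrite lee_fin.
  - by move=> n; rewrite -[X in measurable X]setTI; exact: mphi.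
  - apply/measurable_EFinP; exact: measurable_funTS.
  - by move=> x _; rewrite lee_fin.
  - apply/trivIsetP => /= i j _ _ ij; rewrite -preimage_setI.
    by move/trivIsetP : tF => /(_ _ _ _ _ ij) ->//; rewrite preimage_set0.
pose M : {measure set T -> \bar R} :=
  HB.pack m (isMeasure.Build _ _ _ m m0 m_ge0 m_sigma).
by exists M.
Qed.

End pushforward_weighted.

Section tuple_rectangles.
Context d (T : measurableType d) (R : realType) (m : nat).

Let rect : set (set (m.-tuple T)) :=
  [set A | exists2 F : 'I_m -> set T, (forall i, measurable (F i)) &
     A = \bigcap_(i in [set: 'I_m]) ((fun t => tnth t i) @^-1` F i)].

(** Rectangles are stable under intersection and generate the product sigma-algebra: a coordinate
    preimage is a rectangle all of whose other sides are full. *)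
Lemma measure_tuple_unique (m1 m2 : {measure set (m.-tuple T) -> \bar R}) :
  (m1 [set: _] < +oo)%E ->
  (forall F : 'I_m -> set T, (forall i, measurable (F i)) ->
    m1 (\bigcap_(i in [set: 'I_m]) ((fun t => tnth t i) @^-1` F i)) =
    m2 (\bigcap_(i in [set: 'I_m]) ((fun t => tnth t i) @^-1` F i))) ->
  forall A, measurable A -> m1 A = m2 A.
Proof.
move=> m1oo m12; apply: (measure_unique rect (fun=> setT)) => //.
- apply/seteqP; split.
    apply: smallest_sub; first exact: smallest_sigma_algebra.
    move=> A; rewrite -bigcup_seq => -[i _ [B mB <-]]; apply: sub_sigma_algebra.
    exists (fun j => if j == i then B else setT).
      by move=> j; case: eqP.
    apply/seteqP; split => [t [_ Bt] j _ /=|t /(_ i I) /=]; last by rewrite eqxx.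
    by case: eqP => [->|].
  apply: smallest_sub; first exact: sigma_algebra_measurable.
  move=> _ [F mF ->]; apply: fin_bigcap_measurable; first exact: finite_finset.
  move=> i _; rewrite -[X in measurable X]setTI.
  exact: (measurable_tnth i).
- move=> _ _ [F mF ->] [G mG ->]; exists (fun i => F i `&` G i).
    by move=> i; exact: measurableI.
  by rewrite -bigcapI; apply: eq_bigcapr.
- by move=> _; exists (fun=> setT) => //; apply/seteqP; split.
- by apply/seteqP; split => // t _; exists 0%N.
- by move=> _ [F mF ->]; exact: m12.
Qed.

End tuple_rectangles.

(** * Likelihood ratio test and the lemma of Assouad *)

Section likelihood_ratio_test.
Context d (Om : measurableType d) (R : realType) (I : finType).
Local Notation mu := (@lebesgue_measure R).
Variables (P Q : probability Om R) (X : I -> Om -> R).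
Variables (p q r : I -> R -> R) (e : I -> R).
Hypotheses (mX : forall i, measurable_fun [set: Om] (X i))
  (indP : mutually_independent P X) (indQ : mutually_independent Q X)
  (Pp : forall i, has_density P (X i) (p i))
  (Qq : forall i, has_density Q (X i) (q i)).
Hypotheses (mq : forall i, measurable_fun [set: R] (q i))
  (q0 : forall i x, 0 <= q i x)
  (mr : forall i, measurable_fun [set: R] (r i))
  (r0 : forall i x, 0 <= r i x)
  (rq : forall i x, r i x * q i x = p i x)
  (re : forall i, (\int[mu]_x (r i x ^+ 2 * q i x)%:E = (e i)%:E)%E)
  (e54 : \prod_i e i <= 5 / 4).

Let expectation_density i (f : R -> R) :
  measurable_fun [set: R] f -> (forall x, 0 <= f x) ->
  (\int[Q]_w (f (X i w))%:E = \int[mu]_x (f x * q i x)%:E)%E.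
Proof.
move=> mf f0.
pose Xi : {mfun Om >-> R} := HB.pack (X i) (isMeasurableFun.Build _ _ _ _ _ (mX i)).
rewrite -(@ge0_integral_weighted _ _ _ _ _ mu (distribution Q Xi) id (q i) 1)//.
  rewrite mul1e ge0_integral_distribution//.
  exact/measurable_EFinP.
- exact: mq.
by move=> A mA; rewrite mul1e preimage_id -Qq.
Qed.

Let L w := \prod_i r i (X i w).

Let mL : measurable_fun [set: Om] L.
Proof. by apply: measurable_prod => i _; exact: measurableT_comp. Qed.

Let L0 w : 0 <= L w. Proof. exact: prodr_ge0. Qed.

Let measurable_preX i A : measurable A -> measurable (X i @^-1` A).
Proof. by move=> mA; rewrite -[X in measurable X]setTI; exact: mX. Qed.

Let integral_rq i (A : set R) : measurable A ->
  (\int[mu]_x (\1_A x * r i x * q i x)%:E = (fine (P (X i @^-1` A)))%:E)%E.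
Proof.
move=> mA; rewrite fineK; last by apply: fin_num_measure; exact: measurable_preX.
rewrite Pp// [RHS]integral_mkcond; apply: eq_integral => x _.
rewrite patchE indicE -mulrA rq.
by case: ifPn => xA; rewrite ?mul1r ?mul0r.
Qed.

Let Y w : #|I|.-tuple R := [tuple X (enum_val k) w | k < #|I|].

Let mY : measurable_fun [set: Om] Y.
Proof.
apply/measurable_fun_tnthP => i; rewrite (_ : _ \o _ = X (enum_val i))//.
by apply/funext => w /=; rewrite tnth_mktuple.
Qed.

Let rectangle_ratio (F : 'I_#|I| -> set R) : (forall i, measurable (F i)) ->
  let A := \bigcap_(i in [set: 'I_#|I|]) ((fun t : #|I|.-tuple R => tnth t i) @^-1` F i) in
  (P (Y @^-1` A) = \int[Q]_(w in Y @^-1` A) (L w)%:E)%E.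
Proof.
move=> mF A.
have YA : Y @^-1` A = \bigcap_(i in [set: I]) X i @^-1` F (enum_rank i).
  apply/seteqP; split=> w h i _ /=.
    by have := h (enum_rank i) Logic.I; rewrite /= tnth_mktuple enum_rankK.
  by rewrite tnth_mktuple -[in F i](enum_valK i); exact: h.
have -> : Y @^-1` A = \bigcap_(i in [set` [set: I]%SET]) X i @^-1` F (enum_rank i).
  by rewrite YA; congr bigcap; apply/seteqP; split => i //= _; rewrite finset.in_setT.
rewrite indP//; under eq_bigl do rewrite finset.in_setT.
transitivity (\prod_i fine (P (X i @^-1` F (enum_rank i))))%:E.
  rewrite -prodEFin; apply: eq_bigr => i _.
  by rewrite fineK// fin_num_measure//; exact: measurable_preX.
rewrite -(@expectation_prod _ _ _ _ Q X mX indQ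
  (fun i x => \1_(F (enum_rank i)) x * r i x)).
- rewrite [RHS]integral_mkcond; apply: eq_integral => w _.
  rewrite patchE big_split/= -/(L w).
  case: ifPn => [/set_mem h|h].
    rewrite big1 ?mul1r// => i _; rewrite indicE mem_set//.
    by apply: h => /=; rewrite finset.in_setT.
  have [i nA] : exists i, ~ F (enum_rank i) (X i w).
    apply: contrapT => /forallNP k; move/negP: h; apply; apply/mem_set => i _.
    exact: contrapT (k i).
  by rewrite (bigD1 i)//= indicE memNset// !mul0r.
- move=> i; apply: measurable_funM => //; exact: measurable_indic.
- by move=> i x; rewrite mulr_ge0.
- move=> i; rewrite (@expectation_density i (fun x => \1_(F (enum_rank i)) x * r i x)).
  + exact: integral_rq.
  + by apply: measurable_funM => //; exact: measurable_indic.
  + by move=> x; rewrite mulr_ge0.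
Qed.

(** Independence and the marginal densities give this on rectangles only. Both sides are measures in
    [B], so agreement on rectangles is enough. *)
Let likelihood_ratio (B : set (#|I|.-tuple R)) : measurable B ->
  (P (Y @^-1` B) = \int[Q]_(w in Y @^-1` B) (L w)%:E)%E.
Proof.
have [m mE] := weighted_measure Q mY mL L0.
pose Ym : {mfun Om >-> #|I|.-tuple R} :=
  HB.pack Y (isMeasurableFun.Build _ _ _ _ _ mY).
move=> mB; rewrite -mE -[LHS]/(distribution P Ym B).
apply: measure_tuple_unique => //; first by rewrite /= /distribution /pushforward preimage_setT probability_setT ltry.
by move=> F mF; rewrite mE; exact: rectangle_ratio.
Qed.

Let integral_L : (\int[Q]_w (L w)%:E = 1)%E.
Proof.
have := likelihood_ratio measurableT.
by rewrite preimage_setT probability_setT => <-.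
Qed.

Let integral_L2 : (\int[Q]_w (L w ^+ 2)%:E = (\prod_i e i)%:E)%E.
Proof.
rewrite -(@expectation_prod _ _ _ _ Q X mX indQ (fun i x => r i x ^+ 2)).
- by apply: eq_integral => w _; rewrite prodrXl.
- by move=> i; exact: measurable_funX.
- by move=> i x; rewrite exprn_ge0.
- move=> i; rewrite (@expectation_density i (fun x => r i x ^+ 2)) ?re//.
  + exact: measurable_funX.
  + by move=> x; rewrite exprn_ge0.
Qed.

(* On the event, [L <= 1 + (L - 1)^2 + 1/4]; the square is expanded and moved
   across so that only nonnegative functions are integrated. *)
Lemma likelihood_ratio_test (B : set (#|I|.-tuple R)) : measurable B ->
  (P (Y @^-1` B) <= Q (Y @^-1` B) + (1 / 2)%:E)%E.
Proof.
move=> mB; have mYB : measurable (Y @^-1` B).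
  by rewrite -[X in measurable X]setTI; exact: mY.
have mI : measurable_fun [set: Om] (\1_(Y @^-1` B) : Om -> R) by exact: measurable_indic.
have mL2 : measurable_fun [set: Om] (fun w => L w ^+ 2) by exact: measurable_funX.
have : (\int[Q]_w ((\1_(Y @^-1` B) w * L w)%:E + (2 * L w)%:E) <=
        \int[Q]_w ((\1_(Y @^-1` B) w)%:E + ((L w ^+ 2)%:E + (5/4)%:E)))%E.
  apply: ge0_le_integral => //.
  - by move=> w _; rewrite -EFinD lee_fin addr_ge0// mulr_ge0.
  - apply/measurable_EFinP; apply: measurable_funD; apply: measurable_funM => //.
  - apply/measurable_EFinP; apply: measurable_funD => //.
    exact: measurable_funD.
  (* The right side exceeds the left by [(L - 3/2)^2] on the event and by [(L - 1)^2 + 1/4] off it.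
     Integrated, this reads [P B + 2 <= Q B + 5/4 + 5/4]. *)
  - move=> w _; rewrite -!EFinD lee_fin indicE.
    have := L0 w; have := sqr_ge0 (L w - 1); have := sqr_ge0 (L w - 3/2).
    by case: (_ \in _) => /=; nra.
rewrite !ge0_integralD//; do ?[exact/measurable_EFinP];
  do ?[by move=> w _; rewrite lee_fin ?mulr_ge0// ?exprn_ge0];
  do ?[by apply/measurable_EFinP; apply: measurable_funM];
  do ?[by apply/measurable_EFinP; apply: measurable_funD].
  2: by move=> w _; rewrite -EFinD lee_fin addr_ge0 ?exprn_ge0.
rewrite integral_L2 integral_indic// setIT.
under [X in (_ + X)%E]eq_integral do rewrite EFinM.
rewrite ge0_integralZl//; do ?[exact/measurable_EFinP]; last first.
  by move=> w _; rewrite lee_fin.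
rewrite integral_L mule1 integral_cst// [X in (_ * X)%E](_ : _ = 1%E) ?mule1; last exact: probability_setT.
rewrite (_ : (\int[Q]_w (\1_(Y @^-1` B) w * L w)%:E)%E = P (Y @^-1` B)); last first.
  rewrite likelihood_ratio// [RHS]integral_mkcond; apply: eq_integral => w _.
  by rewrite patchE indicE; case: ifPn => xA; rewrite ?mul1r ?mul0r.
have QE := fineK (fin_num_measure Q _ mYB).
rewrite -(fineK (fin_num_measure P _ mYB)) -QE -[X in (_ <= X + _)%E -> _]QE.
rewrite -!EFinD !lee_fin; move: e54; lra.
Qed.

End likelihood_ratio_test.

(** Meant for the decoder below, which depends on the data only through the finitely many
    comparisons between losses. *)
Lemma measurable_bool_table d (T : measurableType d) (J : finType)
    (b : J -> T -> bool) (U : {ffun J -> bool} -> bool) :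
  (forall j, measurable [set t | b j t]) ->
  measurable [set t | U [ffun j => b j t]].
Proof.
move=> mb.
rewrite (_ : [set t | _] = \bigcup_(f in [set f | U f])
  \bigcap_(j in [set: J]) [set t | b j t = f j]).
  apply: fin_bigcup_measurable; first exact: finite_finset.
  move=> f _; apply: fin_bigcap_measurable; first exact: finite_finset.
  move=> j _; case: (f j); first exact: mb.
  rewrite (_ : [set t | _] = ~` [set t | b j t]); first exact: measurableC.
  by apply/seteqP; split => t /=; [move=> ->|move/negP/negbTE].
apply/seteqP; split => [t Ut|t [f Uf h]] /=.
  by exists [ffun j => b j t] => // j _ /=; rewrite ffunE.
rewrite (_ : [ffun j => b j t] = f)//.
by apply/ffunP => j; rewrite ffunE; exact: (h j Logic.I).
Qed.

Section assouad.
Context d d' (Om : measurableType d) (T : measurableType d') (R : realType).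
Variable I : finType.
Local Notation cube := {ffun I -> bool}.
Variables (P : cube -> probability Om R) (Y : Om -> T) (l : cube -> T -> \bar R).
Variable D : R.

Definition flip (i : I) (f : cube) : cube := [ffun j => (j == i) (+) f j].

Definition hamming (f f' : cube) : R := \sum_i (f i != f' i)%:R.

Hypotheses (mY : measurable_fun [set: Om] Y)
  (ml : forall f, measurable_fun [set: T] (l f))
  (l0 : forall f t, (0 <= l f t)%E) (D0 : 0 <= D).
Hypothesis separated : forall t f f',
  ((D * hamming f f')%:E <= l f t + l f' t)%E.
Hypothesis indistinguishable : forall f i (B : set T), measurable B ->
  (P (flip i f) (Y @^-1` B) <= P f (Y @^-1` B) + (1 / 2)%:E)%E.

Let flipK i : involutive (flip i).
Proof. by move=> f; apply/ffunP => j; rewrite !ffunE addbA addbb. Qed.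

(** A vertex of least loss. The default is never reached, since a finite cube has a minimizer. *)
Let decode (t : T) : cube :=
  odflt [ffun=> false] [pick f | [forall f', (l f t <= l f' t)%E]].

Let decode_le t f : (l (decode t) t <= l f t)%E.
Proof.
rewrite /decode; case: pickP => [g /forallP//|h] /=.
have [g _ gmin] := @Order.TotalTheory.arg_minP _ _ _ [ffun=> false] xpredT (l ^~ t) isT.
by have := h g; rewrite (introT forallP (gmin^~ isT)).
Qed.

Let decode_measurable i b : measurable [set t | decode t i != b].
Proof.
pose tbl (t : T) := [ffun p : cube * cube => (l p.1 t <= l p.2 t)%E].
pose U (s : {ffun cube * cube -> bool}) := (odflt [ffun=> false]
  [pick f | [forall f', s (f, f')]] : cube) i != b.
have dE t : decode t = odflt [ffun=> false] [pick f | [forall f', tbl t (f, f')]].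
  congr odflt; apply: eq_pick => f /=.
  by apply: eq_forallb => f'; rewrite ffunE.
rewrite (_ : [set t | _] = [set t | U (tbl t)]).
  apply: measurable_bool_table => -[f f'] /=.
  rewrite -[X in measurable X]setTI; exact: emeasurable_fun_le.
by apply/seteqP; split => t /=; rewrite /U dE.
Qed.

Let err f i := fine (P f (Y @^-1` [set t | decode t i != f i])).

Let measurable_preY B : measurable B -> measurable (Y @^-1` B).
Proof. by move=> mB; rewrite -[X in measurable X]setTI; exact: mY. Qed.

(** Decoding bit [i] wrongly under [f] and under [flip i f] are complementary events. The two laws
    differ by at most 1/2 on them, so the two errors add up to at least 1 - 1/2. *)
Let err_flip f i : 1 / 2 <= err f i + err (flip i f) i.
Proof.
pose B := [set t | decode t i != f i].
have mB : measurable B by exact: decode_measurable.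
have BC : [set t | decode t i != flip i f i] = ~` B.
  apply/seteqP; split => t /=; rewrite ffunE eqxx /B /= => h.
    by move=> h'; move: h h'; case: (decode t i); case: (f i).
  by move/negP: h; case: (decode t i); case: (f i).
have := indistinguishable f i mB.
rewrite /err BC -/B preimage_setC (probability_setC _ (measurable_preY mB)).
rewrite -(fineK (fin_num_measure (P f) _ (measurable_preY mB))).
rewrite -(fineK (fin_num_measure (P (flip i f)) _ (measurable_preY mB))).
by rewrite -EFinD -EFinB /= lee_fin; lra.
Qed.

(** The decoded vertex has loss at most that of [f], so [separated] bounds [D] times the number of
    wrong bits by [2 * l f]. *)
Let risk_err f : ((D / 2 * \sum_i err f i)%:E <= \int[P f]_w l f (Y w))%E.
Proof.
pose B i := Y @^-1` [set t | decode t i != f i].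
have mB i : measurable (B i) by exact/measurable_preY/decode_measurable.
have -> : (D / 2 * \sum_i err f i)%:E =
    (\int[P f]_w (\sum_i (D / 2 * \1_(B i) w)%:E))%E.
  rewrite ge0_integral_sum//=.
  - rewrite mulr_sumr -sumEFin; apply: eq_bigr => i _.
    under eq_integral do rewrite EFinM.
    rewrite ge0_integralZl//.
    + rewrite integral_indic// setIT EFinM; congr (_ * _)%E.
      by rewrite /err fineK//; apply: fin_num_measure; exact: mB.
    + exact/measurable_EFinP/measurable_indic.
    + by rewrite lee_fin; move: D0; lra.
  - by move=> i; apply/measurable_EFinP/measurable_funM => //; exact: measurable_indic.
  - by move=> i w _; rewrite lee_fin mulr_ge0//; move: D0; lra.
apply: ge0_le_integral => //.
- by move=> w _; apply: sume_ge0 => i _; rewrite lee_fin mulr_ge0//; move: D0; lra.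
- apply: emeasurable_sum => i; apply/measurable_EFinP/measurable_funM => //.
- by apply: measurableT_comp.
- move=> w _; have := separated (Y w) f (decode (Y w)).
  have := decode_le (Y w) f; have := l0 (decode (Y w)) (Y w).
  rewrite (_ : (\sum_i _)%E = (D / 2 * hamming f (decode (Y w)))%:E); last first.
    rewrite sumEFin mulr_sumr; congr EFin; apply: eq_bigr => i _; congr (_ * _).
    rewrite indicE (_ : (w \in B i) = (f i != decode (Y w) i))// eq_sym.
    by apply/idP/idP => [/set_mem//|h]; exact/mem_set.
  have := l0 f (Y w).
  case: (l f (Y w)) => [a| |]; [|by move=> *; rewrite leey|by []].
  case: (l (decode (Y w)) (Y w)) => [b| |]//.
  by rewrite -EFinD !lee_fin; lra.
Qed.

(** Averaging over the cube, the involution [flip i] pairs the vertices and [err_flip] gives mean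
    error at least 1/4 for each bit, so some vertex has at least [#|I| / 4] expected wrong bits. The
    factor 1/8 is this 1/4 times the 1/2 of [risk_err]. *)
Lemma assouad :
  exists f, ((D / 8 * #|I|%:R)%:E <= \int[P f]_w l f (Y w))%E.
Proof.
have [f hf] : exists f, #|I|%:R / 4 <= \sum_i err f i.
  apply: contrapT => /forallNP h.
  have lo : #|{: cube}|%:R * (#|I|%:R / 4) <= \sum_f \sum_i err f i.
    rewrite exchange_big/=.
    have E i : #|{: cube}|%:R / 4 <= \sum_f err f i.
      have : \sum_(f : cube) (1 / 2 : R) <= \sum_f (err f i + err (flip i f) i).
        by apply: ler_sum => f _; exact: err_flip.
      have E2 : \sum_f err f i = \sum_f err (flip i f) i.
        by rewrite [LHS](reindex_inj (inv_inj (flipK i))).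
      by rewrite sumr_const big_split/= -E2 -mulr_natl; lra.
    apply: le_trans (ler_sum _ (fun i _ => E i)).
    by rewrite sumr_const -[leRHS]mulr_natl; lra.
  have : \sum_f \sum_i err f i < \sum_(f : cube) (#|I|%:R / 4 : R).
    apply: ltr_sum.
      by apply/hasP; exists [ffun=> false] => //; rewrite mem_index_enum.
    by move=> f _; rewrite ltNge; apply/negP; exact: h.
  by move=> /(le_lt_trans lo); rewrite sumr_const ltNge -[leLHS]mulr_natl lexx.
exists f; apply: le_trans (risk_err f); rewrite lee_fin.
rewrite (_ : D / 8 * _ = D / 2 * (#|I|%:R / 4)); last by field.
by rewrite ler_wpM2l//; move: D0; lra.
Qed.

End assouad.

(** * Rayleigh quotients *)

Section rayleigh.
Variables (R : realType) (n : nat).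

Definition sqnorm (v : 'rV[R]_n) : R := \sum_i v 0 i ^+ 2.

Definition quadratic (A : 'M[R]_n) (v : 'rV[R]_n) : R :=
  \sum_i \sum_j v 0 i * v 0 j * A i j.

Lemma sqnorm_ge0 v : 0 <= sqnorm v.
Proof. by apply: sumr_ge0 => i _; exact: sqr_ge0. Qed.

Lemma sqnormE v : sqnorm v = (v *m v^T) 0 0.
Proof. by rewrite mxE; apply: eq_bigr => i _; rewrite mxE. Qed.

Lemma quadraticE A v : quadratic A v = (v *m A *m v^T) 0 0.
Proof.
rewrite mxE /quadratic exchange_big/=; apply: eq_bigr => j _.
by rewrite !mxE mulr_suml; apply: eq_bigr => i _; rewrite mulrAC.
Qed.

Lemma sqnorm_eq0 v : sqnorm v = 0 -> v = 0.
Proof.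
move=> v0; apply/rowP => i; rewrite mxE; apply/eqP; rewrite -sqrf_eq0.
by move/eqP: v0; rewrite psumr_eq0 => [/allP/(_ i)|j _]; rewrite ?sqr_ge0//;
  rewrite mem_index_enum => /(_ isT).
Qed.

Lemma sqnormZ a v : sqnorm (a *: v) = a ^+ 2 * sqnorm v.
Proof.
by rewrite /sqnorm mulr_sumr; apply: eq_bigr => i _; rewrite mxE exprMn.
Qed.

Lemma quadraticZ A a v : quadratic A (a *: v) = a ^+ 2 * quadratic A v.
Proof. by rewrite !quadraticE linearZ/= -scalemxAr -!scalemxAl !mxE mulrA. Qed.

Lemma quadraticN A v : quadratic (- A) v = - quadratic A v.
Proof.
rewrite /quadratic -sumrN; apply: eq_bigr => i _.
by rewrite -sumrN; apply: eq_bigr => j _; rewrite mxE mulrN.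
Qed.

Lemma eigenvalue_quadratic A a : eigenvalue A a ->
  exists2 v, v != 0 & quadratic A v = a * sqnorm v.
Proof.
move=> /eigenvalueP[v vA v0]; exists v => //.
by rewrite quadraticE vA -scalemxAl mxE -sqnormE.
Qed.

End rayleigh.

(** A minimizer [v] of the form on the compact unit sphere, with minimum [l], is an eigenvector:
    [M = A - l] is nonnegative and vanishes at [v], and were [w = v M] nonzero, a small step from
    [v] against [w] would make the form of [M] negative. *)
Lemma quadratic_min (R : realType) (n : nat) (A : 'M[R]_n) :
  (0 < n)%N -> A^T = A ->
  exists2 a, eigenvalue A a & forall v, a * sqnorm v <= quadratic A v.
Proof.
case: n A => // n A _ symA.
have csum (I : finType) (f : I -> 'rV[R]_n.+1 -> R) :
    (forall i, continuous (f i)) -> continuous (fun v => \sum_i f i v).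
  by move=> cf; apply: continuous_big => //; exact: add_continuous.
have ccoord i : continuous (fun v : 'rV[R]_n.+1 => v 0 i).
  exact: coord_continuous.
have csq : continuous (@sqnorm R n.+1).
  apply: csum => i v; exact: (cvgM (ccoord i v) (ccoord i v)).
have cq : continuous (@quadratic R n.+1 A).
  apply: (csum) => i; apply: (csum) => j v.
  exact: (cvgM (cvgM (ccoord i v) (ccoord j v)) (cvg_cst _)).
pose S : set 'rV[R]_n.+1 := [set v | sqnorm v = 1].
have S0 : S !=set0.
  exists (delta_mx 0 0); rewrite /S /= /sqnorm big_ord_recl big1 => [|i _];
    by rewrite !mxE/= ?expr0n ?expr1n ?addr0.
have cS : compact S.
  apply: bounded_closed_compact.
    exists 1; split; first exact: num_real.
    move=> x x1 v /= Sv; apply: le_trans (ltW x1).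
    rewrite [leLHS]/Num.norm /= mx_normrE; apply/bigmax_leP; split => //= -[i j] _ /=.
    rewrite (ord1 i) -(@ler_pXn2r _ 2)// ?nnegrE// expr1n real_normK ?num_real//.
    by rewrite -Sv /sqnorm (bigD1 j)//= lerDl; apply: sumr_ge0 => k _; exact: sqr_ge0.
  rewrite (_ : S = (@sqnorm R n.+1) @^-1` [set 1])//.
  by apply: closed_comp => [x _|]; [exact: csq | exact: closed_eq].
have [v Sv vmin] := EVT_min_rV S0 cS (continuous_subspaceT cq).
have sqv : sqnorm v = 1 by exact: set_mem Sv.
pose l := quadratic A v.
have lmin w : l * sqnorm w <= quadratic A w.
  have [/eqP w0|w0] := boolP (sqnorm w == 0).
    by rewrite (sqnorm_eq0 w0) quadraticE sqnormE !mul0mx mxE mulr0.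
  have wp : 0 < sqnorm w by rewrite lt0r w0 sqnorm_ge0.
  have s0 : Num.sqrt (sqnorm w) ^- 1 ^+ 2 = (sqnorm w)^-1.
    by rewrite exprVn expr1 sqr_sqrtr// ltW.
  have := vmin ((Num.sqrt (sqnorm w)) ^- 1 *: w).
  rewrite quadraticZ s0 mulrC ler_pdivlMr//; apply.
  by rewrite inE /S /= sqnormZ s0 mulVf.
exists l => //.
have [M ME] : exists M, M = A - l%:M by exists (A - l%:M).
have qM w : quadratic M w = quadratic A w - l * sqnorm w.
  rewrite ME !quadraticE sqnormE mulmxBr mulmxBl mul_mx_scalar -scalemxAl.
  by rewrite !mxE.
have symM : M^T = M by rewrite ME linearB/= symA tr_scalar_mx.
have qM0 w : 0 <= quadratic M w by rewrite qM subr_ge0.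
pose w := v *m M; pose b := sqnorm w; pose c := quadratic M w.
have qt t : quadratic M (v + t *: w) = 2 * t * b + t ^+ 2 * c.
  have Mv : quadratic M v = 0 by rewrite qM sqv mulr1 subrr.
  have trE : (v + t *: w)^T = v^T + t *: w^T by apply/matrixP => i j; rewrite !mxE.
  have D (B C : 'M[R]_1) : (B + C) 0 0 = B 0 0 + C 0 0 by rewrite mxE.
  have Z k (B : 'M[R]_1) : (k *: B) 0 0 = k * B 0 0 by rewrite mxE.
  have symB (x y : 'rV[R]_n.+1) : (x *m M *m y^T) 0 0 = (y *m M *m x^T) 0 0.
    have <- : (x *m M *m y^T)^T 0 0 = (x *m M *m y^T) 0 0 by rewrite mxE.
    by rewrite !trmx_mul trmxK symM mulmxA.
  have vwE : (v *m M *m w^T) 0 0 = b by rewrite /b sqnormE.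
  rewrite quadraticE trE !mulmxDl !mulmxDr -!scalemxAl -!scalemxAr scalerA.
  rewrite !D !Z (symB w) vwE -!quadraticE Mv -/c; ring.
have b0 : 0 <= b by exact: sqnorm_ge0.
have c0 : 0 <= c by exact: qM0.
have {}b0 : b = 0.
  apply/eqP; rewrite eq_le b0 andbT leNgt; apply/negP => bp.
  (* Any small negative multiple of [w] would do; with denominator [c + 1] no case [c = 0]
     arises. *)
  have := qM0 (v + (- b / (c + 1)) *: w); rewrite qt leNgt => /negP; apply.
  have c1 : 0 < c + 1 by lra.
  rewrite (_ : _ + _ = - (b ^+ 2 * (c + 2)) / (c + 1) ^+ 2); last first.
    by field; rewrite gt_eqF.
  rewrite mulNr oppr_lt0 divr_gt0// ?exprn_gt0// mulr_gt0 ?exprn_gt0//; lra.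
apply/eigenvalueP; exists v; last first.
  apply/eqP => v0; move: sqv; rewrite v0 sqnormE mul0mx mxE => /esym/eqP.
  by rewrite oner_eq0.
have := sqnorm_eq0 b0; rewrite /w ME mulmxBr mul_mx_scalar => /eqP.
by rewrite subr_eq0 => /eqP.
Qed.

Section extreme_eigenvalues.
Variables (R : realType) (n : nat) (A : 'M[R]_n).
Hypotheses (n0 : (0 < n)%N) (symA : A^T = A).

(** The least Rayleigh quotient is itself an eigenvalue and lies below all the others, so the
    infimum in [lambda_min] is attained. *)
Lemma lambda_min_geP c :
  c <= lambda_min A <-> forall v, c * sqnorm v <= quadratic A v.
Proof.
have [a ea amin] := quadratic_min n0 symA.
have lb : lbound [set a | eigenvalue A a] a.
  move=> b /= /eigenvalue_quadratic[v v0 qv].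
  have := amin v; rewrite qv ler_pM2r// lt0r sqnorm_ge0 andbT.
  by apply: contra v0 => /eqP/sqnorm_eq0 ->.
have -> : lambda_min A = a.
  apply/eqP; rewrite eq_le ge_inf//=; last by exists a.
  by rewrite lb_le_inf//; exists a.
split=> [ca v|h].
  by apply: le_trans (amin v); rewrite ler_wpM2r// sqnorm_ge0.
have [v v0 qv] := eigenvalue_quadratic ea.
have := h v; rewrite qv ler_pM2r// lt0r sqnorm_ge0 andbT.
by apply: contra v0 => /eqP/sqnorm_eq0 ->.
Qed.

Lemma lambda_max_leP c :
  lambda_max A <= c <-> forall v, quadratic A v <= c * sqnorm v.
Proof.
have [|a ea amin] := @quadratic_min R n (- A) n0; first by rewrite linearN/= symA.
have {}amin v : quadratic A v <= - a * sqnorm v.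
  by have := amin v; rewrite quadraticN mulNr lerNr.
have {}ea : eigenvalue A (- a).
  move/eigenvalueP : ea => [v vA v0]; apply/eigenvalueP; exists v => //.
  by rewrite scaleNr -vA mulmxN opprK.
have ub : ubound [set a | eigenvalue A a] (- a).
  move=> b /= /eigenvalue_quadratic[v v0 qv].
  have := amin v; rewrite qv ler_pM2r// lt0r sqnorm_ge0 andbT.
  by apply: contra v0 => /eqP/sqnorm_eq0 ->.
have -> : lambda_max A = - a.
  apply/eqP; rewrite eq_le ge_sup//=; last by exists (- a).
  by rewrite ub_le_sup//; exists (- a).
split=> [ca v|h].
  by apply: le_trans (amin v) _; rewrite ler_wpM2r// sqnorm_ge0.
have [v v0 qv] := eigenvalue_quadratic ea.
have := h v; rewrite qv ler_pM2r// lt0r sqnorm_ge0 andbT.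
by apply: contra v0 => /eqP/sqnorm_eq0 ->.
Qed.

End extreme_eigenvalues.

(** * Smooth perturbations with compact support *)

Section scaling.
Variable R : realType.
Local Notation mu := (@lebesgue_measure R).

Lemma lebesgue_measure_scale (a : R) (A : set R) : 0 < a -> measurable A ->
  mu A = (a%:E * mu ( *%R a @^-1` A))%E.
Proof.
move=> a0 mA; have ms : measurable_fun [set: R] ( *%R a) by exact: mulrl_measurable.
have [m mE] := @weighted_measure _ _ _ (measurableTypeR R) R mu ( *%R a) (fun=> a)
  ms (@measurable_cst _ _ R R setT a) (fun=> ltW a0).
have mE' B : measurable B -> m B = (a%:E * mu ( *%R a @^-1` B))%E.
  move=> mB; rewrite mE /= integral_cst//.
  by rewrite -[X in measurable X]setTI; exact: ms.
rewrite (@lebesgue_measure_unique R m) ?mE'// => _ [[x y] _ <-].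
rewrite mE'//=.
rewrite (_ : *%R a @^-1` _ = `]x / a, y / a]%classic); last first.
  apply/seteqP; split => z /=; rewrite !in_itv/=.
    by rewrite ltr_pdivrMr// ler_pdivlMr// mulrC.
  by rewrite ltr_pdivrMr// ler_pdivlMr// mulrC.
rewrite !lebesgue_measure_itv/= !lte_fin ltr_pM2r ?invr_gt0//.
case: ifPn => _; last by rewrite mule0.
by rewrite -EFinM -mulrBl mulrCA divff ?mulr1// gt_eqF.
Qed.

Lemma ge0_integral_scale (a : R) (f : R -> R) : 0 < a ->
  measurable_fun [set: R] f -> (forall x, 0 <= f x) ->
  (\int[mu]_x (f x)%:E = \int[mu]_x (f (a * x) * a)%:E)%E.
Proof.
move=> a0 mf f0; have ms : measurable_fun [set: R] ( *%R a) by exact: mulrl_measurable.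
rewrite -(@ge0_integral_weighted _ _ _ _ _ mu mu ( *%R a) (fun=> a) 1)//.
- by rewrite mul1e.
- by move=> _; exact: ltW.
move=> A mA; rewrite mul1e /= integral_cst//; first exact: lebesgue_measure_scale.
by rewrite -[X in measurable X]setTI; exact: ms.
Qed.

End scaling.

Lemma Lnorm2_leP (R : realType) (h : R -> R) (c : R) : 0 <= c ->
  (Lnorm (@lebesgue_measure R) 2%:E (fun x => (h x)%:E) <= c%:E)%E <->
  (\int[@lebesgue_measure R]_x (h x ^+ 2)%:E <= (c ^+ 2)%:E)%E.
Proof.
move=> c0; rewrite (_ : (\int[@lebesgue_measure R]_x (h x ^+ 2)%:E)%E =
  (Lnorm (@lebesgue_measure R) 2%:E (fun x => (h x)%:E) `^ 2)%E); last first.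
  rewrite powR_Lnorm ?pnatr_eq0//; apply: eq_integral => x _.
  by rewrite /= powR_mulrn// real_normK ?num_real.
have := Lnorm_ge0 (@lebesgue_measure R) 2%:E (fun x => (h x)%:E).
case: (Lnorm _ _ _) => [r| |]//=.
  rewrite !lee_fin => r0; rewrite powR_mulrn//.
  by split=> [rc|]; [rewrite lerXn2r// nnegrE | rewrite ler_pXn2r// nnegrE].
by move=> _; rewrite pnatr_eq0/=; split; rewrite leye_eq.
Qed.

Section derivative_towers.
Variable R : realType.

(** Allows iterated derivatives to be proposed in closed form and verified one order at a time. *)
Lemma derive1n_tower (F : nat -> R -> R) (m : nat) :
  (forall j (x : R), (j < m)%N -> is_derive x 1 (F j) (F j.+1 x)) ->
  (forall j, (j <= m)%N -> derive1n j (F 0%N) = F j) /\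
  (forall j x, (j < m)%N -> derivable (derive1n j (F 0%N)) x 1).
Proof.
move=> dF.
have FE j : (j <= m)%N -> derive1n j (F 0%N) = F j.
  elim: j => [|j IH] jm; first by rewrite derive1n0.
  rewrite derive1nS (IH (ltnW jm)); apply/funext => x.
  by rewrite derive1E; have dj := dF _ x jm; exact: derive_val.
split=> // j x jm; rewrite (FE _ (ltnW jm)).
by have dj := dF _ x jm; exact: ex_derive.
Qed.

(** Serves the squared positive part, whose kink at 0 rules out the product and chain rules. *)
Lemma is_derive_quadratic (F : R -> R) (x d C : R) :
  (forall h, `|F (x + h) - F x - d * h| <= C * h ^+ 2) -> is_derive x 1 F d.
Proof.
move=> Fq; suff h : (fun h => h^-1 *: (F (h *: (1 : R) + x) - F x)) @ 0^' --> d.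
  by apply: DeriveDef; [apply/cvg_ex; exists d|exact/cvg_lim].
apply/cvgrPdist_le => /= e e0.
have C0 : 0 <= C by have := le_trans (normr_ge0 _) (Fq 1); rewrite expr1n mulr1.
near=> t.
have t0 : t != 0 by near: t; exact: nbhs_dnbhs_neq.
have -> : d - t^-1 *: (F (t *: (1 : R) + x) - F x) =
    - (F (x + t) - F x - d * t) / t.
  by rewrite /GRing.scale /= mulr1 (addrC _ x); field.
rewrite normrM normrN normfV ler_pdivrMr ?normr_gt0//.
apply: le_trans (Fq t) _; rewrite -real_normK ?num_real// expr2 mulrA.
rewrite ler_wpM2r//; apply: (@le_trans _ _ (C * (e / (C + 1)))).
  by rewrite ler_wpM2l//; near: t; apply: dnbhs0_le; rewrite divr_gt0//; lra.
rewrite mulrA ler_pdivrMr; last by lra.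
by rewrite mulrC ler_pM2l//; lra.
Unshelve. all: by end_near. Qed.

End derivative_towers.

Section bump.
Variable R : realType.
Implicit Types (Q : {poly R}) (x t : R) (i : nat).

Lemma is_derive_pospart_exp i t :
  is_derive t 1 (fun t => Num.max t 0 ^+ i.+2) (i.+2%:R * Num.max t 0 ^+ i.+1).
Proof.
elim: i => [|i IH].
  apply: (@is_derive_quadratic _ _ _ _ 1) => h; rewrite expr1 ler_norml.
  have := sqr_ge0 h; have := sqr_ge0 (t + h).
  have [t0|t0] := leP t 0; have [s0|s0] := leP (t + h) 0; rewrite !expr2 => *; apply/andP; split; nra.
(* The extra factor is [t] rather than its positive part: the product is the same, and [t] is
   differentiable at the kink. *)
have -> : (fun t : R => Num.max t 0 ^+ i.+3) =
    (fun t => Num.max t 0 ^+ i.+2) * id.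
  apply/funext => s; rewrite exprSr -[RHS]/(Num.max s 0 ^+ i.+2 * s).
  by case: (leP s 0) => // _; rewrite expr0n !mul0r.
have := is_deriveM IH (is_derive_id t 1) => h; apply: is_derive_eq.
rewrite -[i.+3%:R]natr1 /GRing.scale/= mulr1.
have [t0|t0] := leP t 0; first by rewrite !expr0n/= !mulr0 addr0.
by rewrite !exprS; ring.
Qed.

(** With a polynomial factor in front, powers of the positive part of [x (1 - x)] form a class
    closed under differentiation: each derivative lowers the exponent by one and changes the
    polynomial by [bump_step]. Finite smoothness is all that is required. *)
Definition bump Q i x : R := Q.[x] * Num.max (x * (1 - x)) 0 ^+ i.

Definition bump_step i Q : {poly R} :=
  Q^`() * ('X * (1 - 'X)) + i%:R *: ((1 - 2%:R *: 'X) * Q).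

Lemma is_derive_bump Q i x :
  is_derive x 1 (bump Q i.+2) (bump (bump_step i.+2 Q) i.+1 x).
Proof.
have d1 := is_derive_poly Q x.
have d2 : is_derive x 1 (fun y => y * (1 - y)) (1 - 2 * x).
  have -> : (fun y : R => y * (1 - y)) = horner ('X * (1 - 'X)).
    by apply/funext => y; rewrite !hornerE.
  apply: is_derive_eq (is_derive_poly _ _) _.
  by rewrite !poly.derivE !hornerE; ring.
have d3 := @is_derive1_comp _ _ (fun y => y * (1 - y)) x _ _
  (is_derive_pospart_exp i (x * (1 - x))) d2.
have := is_deriveM d1 d3 => h; rewrite /bump; apply: is_derive_eq.
rewrite /GRing.scale /= /bump_step !hornerE /=.
have [y0|y0] := leP (x * (1 - x)) 0; first by rewrite !expr0n/= !(mulr0, mul0r, addr0).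
by rewrite [(_ * _) ^+ i.+2]exprS; ring.
Qed.

Lemma bump_out Q i x : ~~ (0 < x < 1) -> bump Q i.+1 x = 0.
Proof.
move=> x01; rewrite /bump max_r ?expr0n ?mulr0//.
by move: x01; rewrite negb_and -!leNgt => /orP[] h; nra.
Qed.

Lemma bump_bounded Q i : exists2 M, 0 <= M & forall x, `|bump Q i.+1 x| <= M.
Proof.
exists (\sum_(j < size Q) `|Q`_j|) => [|x]; first by apply: sumr_ge0.
have [x01|x01] := boolP (0 < x < 1); last first.
  by rewrite bump_out// normr0 sumr_ge0.
have /andP[x0 x1] := x01.
rewrite /bump normrM -[leRHS]mulr1; apply: ler_pM => //.
  rewrite horner_coef; apply: le_trans (ler_norm_sum _ _ _) _.
  apply: ler_sum => j _; rewrite normrM ler_piMr//.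
  by rewrite normrX exprn_ile1// ger0_norm ltW.
rewrite max_l; last by rewrite mulr_ge0//; lra.
have y0 : 0 <= x * (1 - x) by rewrite mulr_ge0//; lra.
by rewrite ger0_norm ?exprn_ge0// exprn_ile1//; nra.
Qed.

(* [F 0] is the density profile, [F 1] (an exact derivative, hence of zero
   integral) the perturbation profile. *)
Lemma bump_profiles (m : nat) : exists F : nat -> R -> R, exists M kappa : R,
  [/\ 0 < M /\ 0 < kappa,
      (forall j x, (j < m.+2)%N -> is_derive x 1 (F j) (F j.+1 x)),
      (forall j x, (j <= m.+2)%N -> `|F j x| <= M),
      (forall j x, (j <= m.+2)%N -> ~~ (0 < x < 1) -> F j x = 0) &
      [/\ forall x, 0 <= F 0%N x,
          forall x, 1 / 4 <= x <= 3 / 4 -> kappa <= F 0%N x &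
          forall x, 1 / 4 <= x <= 3 / 8 -> kappa <= F 1%N x]].
Proof.
(* Starting from exponent [m.+3] leaves exponent 1 at order [m.+2], so the last function still is
   bounded and vanishes outside the open unit interval. *)
pose Q := fix Q j := if j is j'.+1 then bump_step (m.+3 - j') (Q j') else 1.
pose F j := bump (Q j) (m.+3 - j).
have FE j : (j <= m.+2)%N -> F j = bump (Q j) (m.+2 - j).+1.
  by move=> jm; rewrite /F subSn.
have /choice[M_ M_P] : forall j, exists M, forall x, (j <= m.+2)%N -> `|F j x| <= M.
  move=> j; have [jm|jm] := leqP j m.+2; last by exists 0.
  by have [M _ MP] := bump_bounded (Q j) (m.+2 - j); exists M => x _; rewrite FE.
pose M := 1 + \sum_(j < m.+3) `|M_ j|.
(* On [[1/4, 3/4]] one has [x (1 - x) >= 3/16]. The derivative carries the factor [1 - 2 x], which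
   changes sign at 1/2 and is at least 1/4 up to 3/8. *)
pose kappa : R := (1 / 4) * (3 / 16) ^+ m.+3.
have base x : 1 / 4 <= x <= 3 / 4 -> 3 / 16 <= x * (1 - x) by move=> /andP[? ?]; nra.
have ex k x : 1 / 4 <= x <= 3 / 4 -> (3 / 16) ^+ k <= Num.max (x * (1 - x)) 0 ^+ k.
  move=> /base bx; have bm : 3 / 16 <= Num.max (x * (1 - x)) 0 by rewrite le_max bx.
  by rewrite lerXn2r// nnegrE; lra.
have p0 k : 0 < (3 / 16 : R) ^+ k by rewrite exprn_gt0//; lra.
exists F, M, kappa; split.
- split; last by rewrite mulr_gt0//; lra.
  by rewrite ltr_wpDr//; apply: sumr_ge0.
- move=> j x jm; rewrite /F.
  have jE : (m.+3 - j = (m.+1 - j).+2)%N by rewrite subSn ?(ltnW jm)// subSn.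
  have -> : (m.+3 - j.+1 = (m.+1 - j).+1)%N by rewrite subSS subSn.
  have -> : Q j.+1 = bump_step (m.+1 - j).+2 (Q j) by rewrite /= jE.
  rewrite jE.
  exact: is_derive_bump.
- move=> j x jm; apply: le_trans (M_P j x jm) _; apply: le_trans (ler_norm _) _.
  rewrite /M (bigD1 (Ordinal (jm : (j < m.+3)%N)))//=.
  by rewrite addrCA lerDl addr_ge0//; apply: sumr_ge0.
- by move=> j x jm x01; rewrite FE// bump_out.
- have F0E x : F 0%N x = Num.max (x * (1 - x)) 0 ^+ m.+3.
    rewrite -[F 0%N x]/((1 : {poly R}).[x] * Num.max (x * (1 - x)) 0 ^+ m.+3).
    by rewrite hornerC mul1r.
  have F1E x : F 1%N x = m.+3%:R * (1 - 2 * x) * Num.max (x * (1 - x)) 0 ^+ m.+2.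
    rewrite -[F 1%N x]/((bump_step m.+3 1).[x] * Num.max (x * (1 - x)) 0 ^+ m.+2).
    congr (_ * _); rewrite /bump_step -polyC1 derivC mul0r add0r !hornerE.
    exact: mulr1.
  split=> x.
  + by rewrite F0E exprn_ge0// le_max lexx orbT.
  + move=> /ex h; rewrite F0E; apply: le_trans (h _).
    by rewrite /kappa; have := p0 m.+3; lra.
  + move=> /andP[x0 x1]; rewrite F1E /kappa exprS.
    have h : (3 / 16) ^+ m.+2 <= Num.max (x * (1 - x)) 0 ^+ m.+2.
      by apply: ex; apply/andP; split; lra.
    have := p0 m.+2; move: h; set a := (3 / 16) ^+ _; set b := _ ^+ m.+2 => ab a0.
    apply: (@le_trans _ _ (1 / 4 * b)); first by nra.
    apply: ler_wpM2r; first by lra.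
    have m3 : (1 : R) <= m.+3%:R by rewrite ler1n.
    by nra.
Qed.

End bump.

Section calculus.
Variable R : realType.
Local Notation mu := (@lebesgue_measure R).

Lemma is_derive_continuous (f f' : R -> R) :
  (forall x : R, is_derive x 1 f (f' x)) -> continuous f.
Proof.
move=> df x; have dfx := df x.
exact/differentiable_continuous/derivable1_diffP/ex_derive.
Qed.

Lemma is_derive_affine (f f' : R -> R) (s c A x : R) :
  (forall x : R, is_derive x 1 f (f' x)) ->
  is_derive x 1 (fun x => A * f (s * (x - c))) (A * s * f' (s * (x - c))).
Proof.
move=> df.
have d1 : is_derive x 1 (fun x => s * (x - c)) s.
  have -> : (fun y : R => s * (y - c)) = horner (s%:P * ('X - c%:P)).
    by apply/funext => y; rewrite !hornerE.
  apply: is_derive_eq (is_derive_poly _ _) _.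
  by rewrite !poly.derivE !hornerE; ring.
have d2 := @is_derive1_comp _ f (fun x => s * (x - c)) x _ _ (df _) d1.
have d3 := @is_deriveZ _ _ _ _ A _ _ _ d2.
apply: is_derive_eq d3 _.
by rewrite /GRing.scale/=; ring.
Qed.

Lemma derivative_lipschitz (f f' : R -> R) (L x t : R) :
  (forall x : R, is_derive x 1 f (f' x)) -> (forall x, `|f' x| <= L) ->
  `|f (x + t) - f x| <= L * `|t|.
Proof.
move=> df f'L; have cf := is_derive_continuous df.
have gen a b : a <= b -> `|f b - f a| <= L * (b - a).
  move=> ab; have [c _ ->] := MVT_segment ab (fun x _ => df x) (continuous_subspaceT cf).
  by rewrite normrM (ger0_norm (_ : 0 <= b - a)) ?subr_ge0// ler_wpM2r// subr_ge0.
have [t0|t0] := leP 0 t.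
  have := gen x (x + t); rewrite lerDl (_ : x + t - x = t); last by ring.
  by rewrite (ger0_norm t0); apply.
have := gen (x + t) x; rewrite distrC gerDl (_ : x - (x + t) = - t); last by ring.
by rewrite (ltr0_norm t0); apply; exact: ltW.
Qed.

(** Interpolation: the sup bound [2 B] suffices when [s |t| >= 1]; otherwise the Lipschitz bound
    does, because [theta <= 1] gives [s |t| <= (s |t|)^theta]. *)
Lemma derivative_hoelder (f f' : R -> R) (B s theta x t : R) :
  (forall x : R, is_derive x 1 f (f' x)) ->
  (forall x, `|f x| <= B) -> (forall x, `|f' x| <= B * s) ->
  0 <= s -> 0 < theta <= 1 ->
  `|f (x + t) - f x| <= 2 * B * (s * `|t|) `^ theta.
Proof.
move=> df fB f'B s0 /andP[th0 th1].
have B0 : 0 <= B := le_trans (normr_ge0 _) (fB 0).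
have st0 : 0 <= s * `|t| by rewrite mulr_ge0.
have [st1|st1] := leP 1 (s * `|t|).
  apply: (@le_trans _ _ (2 * B)).
    by apply: le_trans (ler_normB _ _) _; have := fB (x + t); have := fB x; lra.
  rewrite ler_peMr//; first lra.
  by rewrite -[leLHS](powRr0 (s * `|t|)) ler_powR// ltW.
apply: le_trans (derivative_lipschitz _ _ df f'B) _; rewrite -!mulrA.
have : s * `|t| <= (s * `|t|) `^ theta.
  have [->|st] := eqVneq (s * `|t|) 0; first exact: powR_ge0.
  by apply: ger1_powR => //; rewrite lt0r st st0/= ltW.
by move=> h; rewrite mulrCA; have := ler_wpM2l B0 h; have := mulr_ge0 B0 st0; lra.
Qed.

Lemma integral_exact_eq0 (p G : R -> R) (a b : R) : a < b ->
  continuous p -> (forall x : R, is_derive x 1 G (p x)) -> G a = 0 -> G b = 0 ->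
  (\int[mu]_(x in `[a, b]) (p x)%:E = 0)%E.
Proof.
move=> ab cp dG Ga Gb; have cG := is_derive_continuous dG.
rewrite (continuous_FTC2 ab (continuous_subspaceT cp) (F := G)).
- by rewrite Ga Gb subee.
- split; first by move=> x _; have := dG x => h; exact: ex_derive.
  + exact/cvg_at_right_filter/cG.
  + exact/cvg_at_left_filter/cG.
- by move=> x _; rewrite derive1E; have h := dG x; exact: derive_val.
Qed.

(** Ensures that switching bumps, which are derivatives of compactly supported functions, leaves the
    total mass unchanged for every choice of bits. *)
Lemma integralD_exact (u p G : R -> R) (a b : R) : a < b ->
  continuous u -> continuous p -> (forall x : R, is_derive x 1 G (p x)) ->
  G a = 0 -> G b = 0 ->
  (\int[mu]_(x in `[a, b]) (u x + p x)%:E = \int[mu]_(x in `[a, b]) (u x)%:E)%E.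
Proof.
move=> ab cu cp dG Ga Gb.
have int f : continuous f -> mu.-integrable `[a, b] (EFin \o f).
  by move=> cf; apply: continuous_compact_integrable => //;
    [exact: segment_compact | exact: continuous_subspaceT].
under eq_integral do rewrite EFinD.
rewrite integralD//; [|exact: int..].
by rewrite (integral_exact_eq0 ab cp dG Ga Gb) adde0.
Qed.

End calculus.

(** * Bumps on disjoint cells and the resulting densities *)

Section cell_sums.
Variables (R : realType) (J : nat).
Implicit Types (f : R -> R) (c : 'I_J -> R) (x y : R).

Definition cellsum f c y : R := \sum_(j < J) c j * f (y - j%:R).

Lemma cell_unique y : (0 < J)%N ->
  exists j0 : 'I_J, forall j : 'I_J, j != j0 -> ~~ (0 < y - j%:R < 1).
Proof.
move=> J0; have [[j0 j0y]|h] := pselect (exists j : 'I_J, 0 < y - j%:R < 1).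
  exists j0 => j; apply: contra => jy; apply/eqP/val_inj/eqP; rewrite /= eqn_leq.
  move: jy j0y => /andP[? ?] /andP[? ?].
  by apply/andP; split; rewrite -ltnS -(ltr_nat R) -natr1; lra.
exists (Ordinal J0) => j _; apply/negP => jy; apply: h; by exists j.
Qed.

(** At most one cell is active at each point, so bounds for one bump pass to the sum with no factor
    [J]. At a point in no open cell every term vanishes and any index serves. *)
Lemma cellsum_collapse f c y : (0 < J)%N ->
  (forall x, ~~ (0 < x < 1) -> f x = 0) ->
  exists2 j0 : 'I_J, cellsum f c y = c j0 * f (y - j0%:R) &
    forall j : 'I_J, j != j0 -> f (y - j%:R) = 0.
Proof.
move=> J0 f0; have [j0 j0P] := cell_unique y J0.
exists j0 => [|j /j0P]; last exact: f0.
rewrite /cellsum (bigD1 j0)//= big1 ?addr0// => j /j0P jy.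
by rewrite f0// mulr0.
Qed.

Lemma cellsum_bound f c M y : (0 < J)%N ->
  (forall x, ~~ (0 < x < 1) -> f x = 0) -> (forall x, `|f x| <= M) ->
  (forall j, `|c j| <= 1) -> `|cellsum f c y| <= M.
Proof.
move=> J0 f0 fM c1; have [j0 -> _] := cellsum_collapse c y J0 f0.
by rewrite normrM (le_trans _ (fM (y - j0%:R)))// ler_piMl.
Qed.

Lemma cellsum_sqr f c y : (0 < J)%N ->
  (forall x, ~~ (0 < x < 1) -> f x = 0) ->
  cellsum f c y ^+ 2 = \sum_(j < J) c j ^+ 2 * f (y - j%:R) ^+ 2.
Proof.
move=> J0 f0; have [j0 -> fj] := cellsum_collapse c y J0 f0.
rewrite (bigD1 j0)//= big1 ?addr0 ?exprMn// => j /fj ->.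
by rewrite expr0n mulr0.
Qed.

Lemma cellsum_out f c y : (forall x, ~~ (0 < x < 1) -> f x = 0) ->
  ~~ (0 < y < J%:R) -> cellsum f c y = 0.
Proof.
move=> f0 yJ; rewrite /cellsum big1// => j _; rewrite f0 ?mulr0//.
apply: contra yJ => /andP[y0 y1]; have := ltn_ord j; rewrite -(ler_nat R) -natr1.
by have : 0 <= j%:R :> R by []; move=> *; apply/andP; split; lra.
Qed.

Lemma is_derive_cellsum f f' c x :
  (forall x : R, is_derive x 1 f (f' x)) ->
  is_derive x 1 (cellsum f c) (cellsum f' c x).
Proof.
move=> df.
have h (j : 'I_J) : is_derive x 1 (fun y => c j * f (y - j%:R)) (c j * f' (x - j%:R)).
  have -> : (fun y => c j * f (y - j%:R)) = (fun y => c j * f (1 * (y - j%:R))).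
    by apply/funext => y; rewrite mul1r.
  by have := is_derive_affine 1 j%:R (c j) x df; rewrite mulr1 mul1r.
have -> : cellsum f c = \sum_(j < J) (fun y => c j * f (y - j%:R)).
  by apply/funext => y; rewrite fct_sumE.
exact: is_derive_sum.
Qed.

Lemma cellsumB f c c' y :
  cellsum f c y - cellsum f c' y = cellsum f (fun j => c j - c' j) y.
Proof.
by rewrite /cellsum -sumrB; apply: eq_bigr => j _; rewrite mulrBl.
Qed.

End cell_sums.

(* [q f] is a density on [[0, delta]] encoded by the [J] bits of [f]; flipping a
   bit moves it by a bump of height of order [J ^ - beta] on a cell of length of
   order [1 / J], which the Hoelder condition of exponent [beta] just allows. *)
Definition perturbation_family (R : realType) (beta delta C kappa : R) (J : nat)
    (q : {ffun 'I_J -> bool} -> R -> R) : Prop :=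
  let m := strict_floor beta in
  let a := J%:R `^ (- beta) in
  [/\ forall f, [/\ continuous (q f), forall x, 0 <= q f x <= C,
         forall x, ~~ (0 < x < delta) -> q f x = 0 &
         (\int[@lebesgue_measure R]_x (q f x)%:E = 1)%E],
      forall f, [/\ forall j x, (j < m)%N -> derivable (derive1n j (q f)) x 1,
         forall x, ~~ (0 < x < delta) -> derive1n m (q f) x = 0,
         continuous (derive1n m (q f)) &
         forall x t, `|derive1n m (q f) (x + t) - derive1n m (q f) x|
           <= C * `|t| `^ (beta - m%:R)],
      forall f f', ((kappa * (a ^+ 2 / J%:R) * hamming R f f')%:E <=
        \int[@lebesgue_measure R]_x ((q f x - q f' x) ^+ 2)%:E)%E &
      forall f i, exists A : set R, [/\ measurable A,
        (@lebesgue_measure R A <= (C / J%:R)%:E)%E,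
        forall x, (q f x - q (flip i f) x) ^+ 2 <= C * a ^+ 2 * \1_A x &
        forall x f', A x -> kappa <= q f' x]].

Section density_family.
Variables (R : realType) (beta delta : R).
Hypotheses (beta0 : 0 < beta) (delta0 : 0 < delta).
Local Notation mu := (@lebesgue_measure R).
Local Notation m := (strict_floor beta).
Local Notation theta := (beta - m%:R).

Lemma theta_itv : 0 < theta <= 1.
Proof.
have /andP[h1 h2] := strict_floor_itv beta0.
by apply/andP; split; move: h2; rewrite -natr1; lra.
Qed.

Variables (F : nat -> R -> R) (M kappa : R).
Hypotheses (M0 : 0 < M) (kappa0 : 0 < kappa)
  (dF : forall j (x : R), (j < m.+2)%N -> is_derive x 1 (F j) (F j.+1 x))
  (FM : forall j x, (j <= m.+2)%N -> `|F j x| <= M)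
  (Fout : forall j x, (j <= m.+2)%N -> ~~ (0 < x < 1) -> F j x = 0)
  (F0_ge0 : forall x, 0 <= F 0%N x)
  (F0_lb : forall x, 1 / 4 <= x <= 3 / 4 -> kappa <= F 0%N x)
  (F1_lb : forall x, 1 / 4 <= x <= 3 / 8 -> kappa <= F 1%N x).

Let mass := fine (\int[mu]_(x in `[0%R, delta]) (F 0%N (delta^-1 * (x - 0)))%:E)%E.

Let cF0 : continuous (fun x : R => F 0%N (delta^-1 * (x - 0))).
Proof.
apply: (@is_derive_continuous _ _ (fun x => delta^-1 * F 1%N (delta^-1 * (x - 0)))) => x.
rewrite (_ : (fun x => _) = fun x => 1 * F 0%N (delta^-1 * (x - 0))).
  rewrite (_ : delta^-1 * _ = 1 * delta^-1 * F 1%N (delta^-1 * (x - 0))) ?mul1r//.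
  by have := is_derive_affine delta^-1 0 1 x (fun x => dF x (isT : (0 < m.+2)%N)); rewrite !mul1r.
by apply/funext => y; rewrite mul1r.
Qed.

Let massE : mass%:E = (\int[mu]_(x in `[0%R, delta]) (F 0%N (delta^-1 * (x - 0)))%:E)%E /\
  0 < mass.
Proof.
set I := (\int[mu]_(x in _) _)%E.
have mF0 : measurable_fun `[0%R, delta] (fun x : R => (F 0%N (delta^-1 * (x - 0)))%:E).
  apply/measurable_EFinP; apply: measurable_funTS.
  exact: continuous_measurable_fun.
have Iub : (I <= (M * delta)%:E)%E.
  apply: (@le_trans _ _ (\int[mu]_(x in `[0%R, delta]) M%:E)%E).
    apply: ge0_le_integral => //.
    - by move=> x _; rewrite lee_fin.
    - by move=> x _; rewrite lee_fin (le_trans (ler_norm _))// FM.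
  rewrite integral_cst//= lebesgue_measure_itv/= lte_fin delta0 sube0.
  by rewrite EFinM.
have Ilb : ((kappa * (delta / 2))%:E <= I)%E.
  apply: (@le_trans _ _ (\int[mu]_(x in `[(delta / 4)%R, (3 * delta / 4)%R]) kappa%:E)%E).
    rewrite integral_cst//= lebesgue_measure_itv/= lte_fin.
    rewrite ifT; last by move: delta0; lra.
    by rewrite -EFinD -EFinM lee_fin; move: delta0 kappa0; nra.
  have sub : `[(delta / 4)%R, (3 * delta / 4)%R]%classic `<=` `[0%R, delta]%classic.
    by move=> x /=; rewrite !in_itv/= => /andP[? ?]; move: delta0; move=> ?;
      apply/andP; split; lra.
  apply: (@le_trans _ _ (\int[mu]_(x in `[(delta / 4)%R, (3 * delta / 4)%R])
      (F 0%N (delta^-1 * (x - 0)))%:E)%E).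
    apply: ge0_le_integral => //.
    - by move=> x _; rewrite lee_fin ltW.
    - exact: measurable_funS mF0.
    - move=> x /=; rewrite in_itv/= lee_fin subr0 => /andP[x1 x2]; apply: F0_lb.
      by rewrite [delta^-1 * _]mulrC ler_pdivlMr// ler_pdivrMr//; apply/andP; split; lra.
  by apply: ge0_subset_integral => // x _; rewrite lee_fin.
have Ifin : I \is a fin_num.
  rewrite ge0_fin_numE; first exact: le_lt_trans Iub (ltry _).
  by apply: integral_ge0 => x _; rewrite lee_fin.
have ME : mass%:E = I by rewrite /mass fineK.
split=> //; rewrite -lte_fin ME; apply: lt_le_trans Ilb.
by rewrite lte_fin !mulr_gt0.
Qed.

Let mass0 : 0 < mass. Proof. by case: massE. Qed.

Let u k x := mass^-1 * delta^-1 ^+ k * F k (delta^-1 * (x - 0)).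

Let is_derive_u k (x : R) : (k < m.+2)%N -> is_derive x 1 (u k) (u k.+1 x).
Proof.
move=> km; rewrite /u exprSr mulrA.
by apply: is_derive_affine => y; exact: dF.
Qed.

Let u0 := kappa / mass.

Let u0_gt0 : 0 < u0. Proof. by rewrite divr_gt0. Qed.

(** Keeps the perturbation below [gamma * M = u0 / 2], half of the lower bound [u0] of the
    unperturbed density on the middle half of [[0, delta]]. *)
Let gamma := u0 / (2 * M).

Let gamma0 : 0 < gamma. Proof. by rewrite divr_gt0// mulr_gt0. Qed.

Let hoelder_const := 2 * (mass^-1 * delta^-1 ^+ m * M) * delta^-1 `^ theta +
  2 * (gamma * M) * (2 / delta) `^ beta.

Let bound := M / mass + gamma * M.

Let bound_ge0 : 0 <= bound.
Proof. by apply: addr_ge0; apply: ltW; [exact: divr_gt0|exact: mulr_gt0]. Qed.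

Let hoelder_const_ge0 : 0 <= hoelder_const.
Proof.
have d0 : 0 < delta^-1 by rewrite invr_gt0.
have m0 : 0 < mass^-1 by rewrite invr_gt0.
have c0 : 0 < mass^-1 * delta^-1 ^+ m * M.
  by apply: mulr_gt0 => //; apply: mulr_gt0 => //; exact: exprn_gt0.
have c1 : 0 < gamma * M by exact: mulr_gt0.
by apply: addr_ge0; (apply: mulr_ge0; last exact: powR_ge0);
  apply: mulr_ge0 => //; exact: ltW.
Qed.

Section fixed_number_of_cells.
Variables (J : nat) (J0 : (0 < J)%N).
Local Notation cube := {ffun 'I_J -> bool}.
(** The [J] cells have length [1 / s = delta / (2 J)] and fill exactly the middle half of
    [[0, delta]], where the base density is at least [u0]. *)
Local Notation s := (2 * J%:R / delta).
Local Notation a := (J%:R `^ (- beta)).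

Let J1 : 1 <= J%:R :> R. Proof. by rewrite ler1n. Qed.
Let s_gt0 : 0 < s. Proof. by rewrite divr_gt0// mulr_gt0// ltr0n. Qed.
Let sJ : s^-1 * J%:R = delta / 2.
Proof.
have ? : delta != 0 by rewrite gt_eqF.
have ? : J%:R != 0 :> R by rewrite pnatr_eq0 -lt0n.
by field; apply/andP.
Qed.
Let a_gt0 : 0 < a. Proof. by rewrite powR_gt0// ltr0n. Qed.
Let a_le1 : a <= 1.
Proof. by rewrite -[leRHS](powRr0 J%:R) ler_powR// oppr_le0 ltW. Qed.

Let w (f : cube) (j : 'I_J) : R := (f j)%:R.

Let w_le1 f j : `|w f j| <= 1.
Proof. by rewrite /w; case: (f j); rewrite ?normr1 ?normr0. Qed.

(** The index is shifted because the perturbation is built on [F 1]: [F 0] stays available as its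
    primitive, and the derivative of order [m.+1] of [p] uses [F m.+2]. *)
Let p f k x := gamma * a * s ^+ k * cellsum (F k.+1) (w f) (s * (x - delta / 4)).

Let is_derive_p f k (x : R) : (k < m.+1)%N -> is_derive x 1 (p f k) (p f k.+1 x).
Proof.
move=> km; rewrite /p exprSr [X in is_derive _ _ _ X](_ : _ = gamma * a * s ^+ k * s *
  cellsum (F k.+2) (w f) (s * (x - delta / 4))); last by rewrite !mulrA.
by apply: is_derive_affine => y; apply: is_derive_cellsum => z; exact: dF.
Qed.

Let q f k x := u k x + p f k x.

Let is_derive_q f k (x : R) : (k < m.+1)%N -> is_derive x 1 (q f k) (q f k.+1 x).
Proof.
move=> km; have h1 := is_derive_u x (ltnW km : (k < m.+2)%N); have h2 := is_derive_p f x km.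
exact: is_deriveD.
Qed.

Let uout k x : (k <= m.+2)%N -> ~~ (0 < x < delta) -> u k x = 0.
Proof.
move=> km x0; rewrite /u Fout ?mulr0//; apply: contra x0.
by rewrite subr0 mulrC pmulr_lgt0 ?invr_gt0// ltr_pdivrMr// mul1r.
Qed.

Let pout f k x : (k <= m.+1)%N -> ~~ (delta / 4 < x < 3 * delta / 4) -> p f k x = 0.
Proof.
move=> km x0; rewrite /p cellsum_out ?mulr0//; first by move=> y; exact: Fout.
apply: contra x0 => /andP[]; rewrite pmulr_rgt0// => h1.
rewrite -ltr_pdivlMl// sJ => h2; by apply/andP; split; lra.
Qed.

Let u_bound k x : (k <= m.+2)%N -> `|u k x| <= mass^-1 * delta^-1 ^+ k * M.
Proof.
have md := ltW mass0; have dd := ltW delta0.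
have c0 : 0 <= mass^-1 * delta^-1 ^+ k by apply: mulr_ge0; rewrite ?exprn_ge0 ?invr_ge0.
by move=> km; rewrite /u normrM ger0_norm// ler_wpM2l// FM.
Qed.

Let p_bound f k x : (k <= m.+1)%N -> `|p f k x| <= gamma * a * s ^+ k * M.
Proof.
have g0 := ltW gamma0; have aa := ltW a_gt0; have ss := ltW s_gt0.
have c0 : 0 <= gamma * a * s ^+ k.
  by apply: mulr_ge0; [exact: mulr_ge0|exact: exprn_ge0].
move=> km; rewrite /p normrM ger0_norm// ler_wpM2l// cellsum_bound// => y.
  exact: Fout.
exact: FM.
Qed.

Let p0_bound f x : `|p f 0 x| <= gamma * M.
Proof.
apply: le_trans (p_bound f x _) _ => //; rewrite expr0 mulr1.
by apply: ler_wpM2r; [exact: ltW|rewrite ler_piMr// ltW].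
Qed.

Let q_middle f x : delta / 4 < x < 3 * delta / 4 -> u0 / 2 <= q f 0 x.
Proof.
move=> /andP[x1 x2]; have := p0_bound f x; rewrite ler_norml => /andP[pl _].
have gM : gamma * M = u0 / 2.
  by rewrite /gamma; field; rewrite gt_eqF.
have : u0 <= u 0 x.
  rewrite /u expr0 mulr1 /u0 mulrC ler_wpM2l// ?invr_ge0 ?(ltW mass0)//.
  apply: F0_lb; rewrite subr0 [delta^-1 * _]mulrC ler_pdivlMr// ler_pdivrMr//.
  by apply/andP; split; lra.
by rewrite /q; move: pl; rewrite gM; lra.
Qed.

Let u_ge0 x : 0 <= u 0 x.
Proof. by rewrite /u expr0 mulr1 mulr_ge0// invr_ge0 ltW. Qed.

Let q_ge0 f x : 0 <= q f 0 x.
Proof.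
have [/q_middle h|x0] := boolP (delta / 4 < x < 3 * delta / 4).
  by apply: le_trans (h f); rewrite divr_ge0 ?ltW.
by rewrite /q pout// addr0.
Qed.

Let q_le f x : q f 0 x <= bound.
Proof.
apply: lerD; apply: le_trans (ler_norm _) _; last exact: p0_bound.
by apply: le_trans (u_bound x _) _ => //; rewrite expr0 mulr1 mulrC.
Qed.

Let q_out f k x : (k <= m.+1)%N -> ~~ (0 < x < delta) -> q f k x = 0.
Proof.
move=> km x0; rewrite /q uout ?pout ?addr0//; last exact: leqW.
apply: contra x0 => /andP[x1 x2]; have d0 := delta0.
by apply/andP; split; lra.
Qed.

Let integral_q f : (\int[mu]_x (q f 0 x)%:E = 1)%E.
Proof.
have cq := is_derive_continuous (fun x => @is_derive_u 0%N x isT).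
have cp := is_derive_continuous (fun x => @is_derive_p f 0%N x isT).
transitivity (\int[mu]_(x in `[0%R, delta]) (u 0 x + p f 0 x)%:E)%E.
  rewrite [RHS]integral_mkcond; apply: eq_integral => x _; rewrite patchE.
  case: ifPn => //; rewrite notin_setE/= in_itv/= => /negP x0.
  by congr EFin; apply: q_out => //; apply: contra x0 => /andP[/ltW -> /ltW ->].
(* The primitive of the perturbation, vanishing at both ends, so only the mass of the base density
   remains. *)
pose G x := gamma * a * s^-1 * cellsum (F 0%N) (w f) (s * (x - delta / 4)).
have G0 x : ~~ (delta / 4 < x < 3 * delta / 4) -> G x = 0.
  move=> x0; rewrite /G cellsum_out ?mulr0//; first by move=> y; exact: (@Fout 0%N).
  apply: contra x0 => /andP[]; rewrite pmulr_rgt0// => h1.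
  by rewrite -ltr_pdivlMl// sJ => h2; apply/andP; split; lra.
have d0 := delta0.
have dG (x : R) : is_derive x 1 G (p f 0 x).
  rewrite (_ : p f 0 x = gamma * a * s^-1 * s *
    cellsum (F 1%N) (w f) (s * (x - delta / 4))).
    by apply: is_derive_affine => y; apply: is_derive_cellsum => z; exact: (@dF 0%N).
  by rewrite /p expr0 mulr1 mulfVK// gt_eqF.
have Ga : G 0 = 0 by apply: G0; rewrite negb_and -!leNgt; apply/orP; left; lra.
have Gb : G delta = 0 by apply: G0; rewrite negb_and -!leNgt; apply/orP; right; lra.
rewrite (integralD_exact d0 cq cp dG Ga Gb).
transitivity (\int[mu]_(x in `[0%R, delta]) ((mass^-1)%:E *
    (F 0%N (delta^-1 * (x - 0)))%:E))%E.
  by apply: eq_integral => x _; rewrite /u expr0 mulr1 EFinM.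
rewrite ge0_integralZl//.
- by rewrite -massE.1 -EFinM mulVf// gt_eqF.
- by apply/measurable_EFinP; apply: measurable_funTS; exact: continuous_measurable_fun.
- by move=> x _; rewrite lee_fin.
- by rewrite lee_fin invr_ge0 ltW.
Qed.

(** The reason for the height [J^-beta]: the derivative of order [m] costs [s^m], its Hoelder
    seminorm another [s^theta], and since [m + theta = beta] all powers of [J] cancel. *)
Let a_scale : a * s ^+ m * s `^ theta = (2 / delta) `^ beta.
Proof.
have ss := ltW s_gt0.
rewrite -powR_mulrn// -mulrA -powRD; last by rewrite (gt_eqF s_gt0) implybT.
rewrite addrC subrK (_ : s = J%:R * (2 / delta)); last by rewrite [RHS]mulrCA mulrA.
rewrite powRM//; last by rewrite divr_ge0 ?(ltW delta0).
by rewrite mulrA powRN mulVf ?mul1r// gt_eqF// powR_gt0// ltr0n.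
Qed.

Let q_hoelder f x t : `|q f m (x + t) - q f m x| <= hoelder_const * `|t| `^ theta.
Proof.
have tt := theta_itv; have ss := ltW s_gt0; have dd : 0 <= delta^-1 by rewrite invr_ge0 ltW.
have hu := @derivative_hoelder R (u m) (u m.+1) (mass^-1 * delta^-1 ^+ m * M) delta^-1
  theta x t (fun y => is_derive_u y (leqnSn m.+1)) _ _ dd tt.
have hp := @derivative_hoelder R (p f m) (p f m.+1) (gamma * a * s ^+ m * M) s
  theta x t (fun y => is_derive_p f y (leqnn m.+1)) _ _ ss tt.
rewrite /q opprD addrACA; apply: le_trans (ler_normD _ _) _.
rewrite /hoelder_const mulrDl; apply: lerD.
  apply: le_trans (hu _ _) _ => [y|y|].
  - exact: u_bound (leqW (leqnSn m)).
  - have := @u_bound m.+1 y (leqnSn m.+1); rewrite exprSr; set c := delta^-1 ^+ m.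
    by rewrite (_ : mass^-1 * (c * delta^-1) * M = mass^-1 * c * M * delta^-1)//; ring.
  - by rewrite powRM// mulrA.
apply: le_trans (hp _ _) _ => [y|y|].
- exact: p_bound (leqnSn m).
- have := p_bound f y (leqnn m.+1); rewrite exprSr; set c := s ^+ m.
  by rewrite (_ : gamma * a * (c * s) * M = gamma * a * c * M * s)//; ring.
- rewrite powRM// -a_scale; set c := s ^+ m; set e := s `^ _; set g := `|t| `^ _.
  by rewrite (_ : 2 * (gamma * a * c * M) * (e * g) = 2 * (gamma * M) * (a * c * e) * g)//; ring.
Qed.

Let q_diff f f' x : (q f 0 x - q f' 0 x) ^+ 2 =
  (gamma * a) ^+ 2 *
  \sum_j (f j != f' j)%:R * F 1%N (s * (x - delta / 4) - j%:R) ^+ 2.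
Proof.
rewrite /q opprD addrACA subrr add0r /p expr0 !mulr1 -mulrBr exprMn cellsumB.
rewrite cellsum_sqr//; last by move=> y; exact: (@Fout 1%N).
congr (_ * _); apply: eq_bigr => j _; congr (_ * _).
by rewrite /w; case: (f j) (f' j) => -[]; rewrite ?subrr ?subr0 ?sub0r ?sqrrN ?expr0n ?expr1n.
Qed.

Let coord_gt c x : (delta / 4 + c / s < x) = (c < s * (x - delta / 4)).
Proof. by rewrite -ltrBrDl ltr_pdivrMr// mulrC. Qed.

Let coord_lt c x : (x < delta / 4 + c / s) = (s * (x - delta / 4) < c).
Proof. by rewrite -ltrBlDl ltr_pdivlMr// mulrC. Qed.

Let q_flip f i : exists A : set R, [/\ measurable A,
  (mu A <= (delta / J%:R)%:E)%E,
  forall x, (q f 0 x - q (flip i f) 0 x) ^+ 2 <= (gamma * M) ^+ 2 * a ^+ 2 * \1_A x &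
  forall x f', A x -> u0 / 2 <= q f' 0 x].
Proof.
have d0 := delta0.
have Js : J%:R / s = delta / 2 by rewrite mulrC sJ.
have iJ : (i%:R + 1) / s <= delta / 2.
  by rewrite -Js ler_pM2r ?invr_gt0// natr1 ler_nat.
have i0 : 0 <= i%:R / s by rewrite divr_ge0// ltW.
have lenE : (i%:R + 1) / s = i%:R / s + delta / (2 * J%:R).
  by rewrite mulrDl mul1r invf_div.
have len0 : 0 < delta / (2 * J%:R) by rewrite divr_gt0// mulr_gt0// ltr0n.
exists `]delta / 4 + i%:R / s, delta / 4 + (i%:R + 1) / s[%classic; split.
- exact: measurable_itv.
- rewrite lebesgue_measure_itv/= lte_fin ltrD2l lenE ltrDl len0 -EFinD lee_fin.
  rewrite opprD addrACA subrr add0r addrAC subrr add0r.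
  by rewrite ler_pM2l// lef_pV2 ?posrE ?mulr_gt0 ?ltr0n// ler_peMl// ler1n.
- move=> x; rewrite q_diff (bigD1 i)//= big1 ?addr0; last first.
    by move=> j ji; rewrite ffunE (negbTE ji) eqxx mul0r.
  rewrite ffunE eqxx (_ : f i != true (+) f i); last by case: (f i).
  set y := F 1%N _; rewrite mul1r; set ind := \1__ x.
  rewrite (_ : (gamma * M) ^+ 2 * a ^+ 2 * ind = (gamma * a) ^+ 2 * (M ^+ 2 * ind)); last by ring.
  rewrite ler_wpM2l ?sqr_ge0// /ind /y.
  rewrite indicE; have [|xA] := boolP (x \in _) => /=.
    move=> _; rewrite mulr1 -real_normK ?num_real// lerXn2r ?nnegrE//.
      exact: ltW.
    exact: FM.
  rewrite mulr0 Fout ?expr0n//; apply: contra xA => /andP[x1 x2].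
  apply/mem_set; rewrite /= in_itv/= coord_gt coord_lt -ltrBlDl x2 andbT.
  by rewrite -subr_gt0.
- move=> x f'; rewrite /= in_itv/= => /andP[x1 x2]; apply: q_middle.
  by apply/andP; split; lra.
Qed.

Let q_separated f f' :
  (((gamma * kappa) ^+ 2 * delta / 16 * (a ^+ 2 / J%:R) * hamming R f f')%:E <=
   \int[mu]_x ((q f 0 x - q f' 0 x) ^+ 2)%:E)%E.
Proof.
have d0 := delta0.
have dn : delta != 0 by rewrite gt_eqF.
have Jn : J%:R != 0 :> R by rewrite pnatr_eq0 -lt0n.
(* The part of cell [j] where [F 1] is at least [kappa]; its length is
   [1 / (8 s) = delta / (16 J)]. *)
pose I (j : 'I_J) := `[delta / 4 + (j%:R + 1 / 4) / s, delta / 4 + (j%:R + 3 / 8) / s]%classic.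
have mI j : measurable_fun [set: R] (\1_(I j) : R -> R).
  by apply: measurable_indic; exact: measurable_itv.
have muI j : mu (I j) = (delta / (16 * J%:R))%:E.
  rewrite /I lebesgue_measure_itv/= lte_fin ltrD2l ltr_pM2r ?invr_gt0// ltrD2l.
  rewrite ifT; last lra.
  rewrite -EFinD opprD addrACA subrr add0r -mulrBl opprD addrACA subrr add0r.
  by congr EFin; field; rewrite ?dn ?Jn.
have intI j : (\int[mu]_x (\1_(I j) x)%:E = (delta / (16 * J%:R))%:E)%E.
  by rewrite integral_indic; [rewrite setIT; exact: muI|exact: measurableT|exact: measurable_itv].
pose c := (gamma * a * kappa) ^+ 2.
have c0 : 0 <= c by exact: sqr_ge0.
apply: (@le_trans _ _ (\int[mu]_x (\sum_j (c * (f j != f' j)%:R * \1_(I j) x)%:E))%E).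
  rewrite ge0_integral_sum//=; last 2 first.
  - move=> j; apply/measurable_EFinP; apply: measurable_funM; last exact: mI.
    exact: measurable_cst.
  - by move=> j x _; rewrite lee_fin; apply: mulr_ge0 => //; exact: mulr_ge0.
  rewrite (eq_bigr (fun j => (c * (f j != f' j)%:R * (delta / (16 * J%:R)))%:E)).
    rewrite sumEFin lee_fin -mulr_suml -mulr_sumr /hamming -/(hamming _ _ _) /c.
    by rewrite le_eqVlt; apply/orP; left; apply/eqP; field; rewrite ?dn ?Jn.
  move=> j _; under eq_integral do rewrite EFinM.
  rewrite ge0_integralZl//.
  - by rewrite intI -EFinM.
  - by apply/measurable_EFinP; exact: mI.
  - by rewrite lee_fin; exact: mulr_ge0.
apply: ge0_le_integral => //.
- by move=> x _; apply: sume_ge0 => j _; rewrite lee_fin;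
  apply: mulr_ge0 => //; exact: mulr_ge0.
- apply: emeasurable_sum => j; apply/measurable_EFinP; apply: measurable_funM; last exact: mI.
  exact: measurable_cst.
- apply/measurable_EFinP; apply: measurable_funX; apply: measurable_funB;
    apply: continuous_measurable_fun; apply: is_derive_continuous => x;
    exact: (@is_derive_q _ 0%N).
move=> x _; rewrite sumEFin lee_fin q_diff mulr_sumr; apply: ler_sum => j _.
set y := F 1%N _; set ind := \1__ x.
rewrite (_ : c * _ * ind = (gamma * a) ^+ 2 * ((f j != f' j)%:R * (kappa ^+ 2 * ind))); last first.
  by rewrite /c; ring.
rewrite ler_wpM2l ?sqr_ge0// ler_wpM2l// /y /ind.
rewrite indicE; have [/set_mem|xA] := boolP (x \in I j); last by rewrite mulr0 sqr_ge0.
rewrite /I /= in_itv/= !leNgt coord_gt coord_lt -!leNgt => /andP[x2 x1].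
have ky : kappa <= F 1%N (s * (x - delta / 4) - j%:R).
  by apply: F1_lb; apply/andP; split; lra.
by rewrite mulr1 lerXn2r ?nnegrE// ?(ltW kappa0)// (le_trans (ltW kappa0) ky).
Qed.

Lemma perturbation_family_cells : exists q,
  @perturbation_family R beta delta (bound + hoelder_const + (gamma * M) ^+ 2 + delta)
    (Num.min (u0 / 2) ((gamma * kappa) ^+ 2 * delta / 16)) J q.
Proof.
have [bound0 hoelder0] := (bound_ge0, hoelder_const_ge0).
have gM0 := sqr_ge0 (gamma * M); have d0 := delta0.
exists (fun f => q f 0); split.
- move=> f; split.
  + by apply: is_derive_continuous => x; exact: (@is_derive_q f 0%N).
  + by move=> x; rewrite q_ge0/=; apply: le_trans (q_le f x) _; lra.
  + by move=> x; exact: q_out.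
  + exact: integral_q.
- move=> f; have [qE dq] := derive1n_tower (fun j x (jm : (j < m.+1)%N) => @is_derive_q f j x jm).
  split.
  + by move=> j x jm; apply: dq; exact: ltnW.
  + by move=> x; rewrite qE//; exact: q_out.
  + by rewrite qE//; apply: is_derive_continuous => x; exact: (@is_derive_q f m).
  + move=> x t; rewrite qE//; apply: le_trans (q_hoelder f x t) _.
    by rewrite ler_wpM2r ?powR_ge0//; lra.
- move=> f f'; apply: le_trans (q_separated f f'); rewrite lee_fin.
  rewrite ler_wpM2r//; first by apply: sumr_ge0.
  by rewrite ler_wpM2r ?ge_min ?lexx ?orbT// divr_ge0// sqr_ge0.
- move=> f i; have [A [mA muA qA qmid]] := q_flip f i; exists A; split => //.
  + by apply: le_trans muA _; rewrite lee_fin ler_wpM2r//; lra.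
  + move=> x; apply: le_trans (qA x) _; rewrite ler_wpM2r// ler_wpM2r ?sqr_ge0//; lra.
  + by move=> x f' /(qmid x f') h; rewrite ge_min h.
Qed.

End fixed_number_of_cells.

Lemma perturbation_families_of_profile : exists C k : R, [/\ 0 < C, 0 < k &
  forall J, (0 < J)%N -> exists q, @perturbation_family R beta delta C k J q].
Proof.
exists (bound + hoelder_const + (gamma * M) ^+ 2 + delta),
  (Num.min (u0 / 2) ((gamma * kappa) ^+ 2 * delta / 16)); split.
- by apply: ltr_wpDl => //; do ?[apply: addr_ge0 => //]; exact: sqr_ge0.
- by rewrite lt_min !divr_gt0// mulr_gt0// exprn_gt0// mulr_gt0.
- exact: perturbation_family_cells.
Qed.

End density_family.

(** The order of the quantifiers is the point: the constants come before [J], so [J] may later grow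
    with the sample size. *)
Lemma perturbation_families (R : realType) (beta delta : R) :
  0 < beta -> 0 < delta -> exists C k : R, [/\ 0 < C, 0 < k &
  forall J, (0 < J)%N -> exists q, @perturbation_family R beta delta C k J q].
Proof.
move=> beta0 delta0.
have [F [M [kappa [[M0 k0] dF FM Fout [F0 F0l F1l]]]]] := bump_profiles R (strict_floor beta).
exact: (@perturbation_families_of_profile R beta delta beta0 delta0 F M kappa).
Qed.

(** * The parameter space as quadratic form constraints *)

Section mixture_of_densities.
Variables (R : realType) (K : nat).
Local Notation mu := (@lebesgue_measure R).

Lemma density_le_gbar (g : 'I_K -> R -> R) (c : R) k x :
  (forall k, is_density (g k)) -> (forall x, gbar g x <= c) -> g k x <= K%:R * c.
Proof.
move=> dg gc; have K0 : (0 < K)%N by exact: leq_ltn_trans (ltn_ord k).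
have := gc x; rewrite /gbar ler_pdivrMl ?ltr0n//; apply: le_trans.
by rewrite (bigD1 k)//= lerDl; apply: sumr_ge0 => l _; have [_ + _] := dg l; apply.
Qed.

Lemma Sigma_gT (g : 'I_K -> R -> R) : (Sigma_g g)^T = Sigma_g g.
Proof.
apply/matrixP => k l; rewrite !mxE; congr (_ * _).
by apply: eq_Rintegral => x _; rewrite mulrC.
Qed.

Lemma density_mul_integrable (g : 'I_K -> R -> R) (c : R) k l :
  (forall k, is_density (g k)) -> (forall x, gbar g x <= c) ->
  mu.-integrable [set: R] (fun x => (g k x * g l x)%:E).
Proof.
move=> dg gc; have [mk k0 _] := dg k; have [ml l0 l1] := dg l.
apply: (@le_integrable _ _ _ mu _ measurableT _ (fun x => ((K%:R * c)%:E * (g l x)%:E)%E)).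
- by apply/measurable_EFinP; apply: measurable_funM.
- move=> x _; have Kc := density_le_gbar k x dg gc.
  have Kc0 := le_trans (k0 x) Kc.
  rewrite -EFinM !gee0_abs ?lee_fin; [by rewrite ler_wpM2r|exact: mulr_ge0..].
- apply: integrableZl => //; apply/integrableP; split; first exact/measurable_EFinP.
  under eq_integral => x _ do rewrite gee0_abs ?lee_fin ?l0//.
  by rewrite l1 ltry.
Qed.

(** [Sigma_g] is a Gram matrix. The bound on [gbar] bounds each density, hence makes the products
    integrable, so the real-valued integrals in [Sigma_g] are not the default value 0 of an infinite
    integral. *)
Lemma Sigma_quadratic (g : 'I_K -> R -> R) (c : R) (v : 'rV[R]_K) : (0 < K)%N ->
  (forall k, is_density (g k)) -> (forall x, gbar g x <= c) ->
  (\int[mu]_x ((\sum_k v 0 k * g k x) ^+ 2)%:E =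
   (K%:R * quadratic (Sigma_g g) v)%:E)%E.
Proof.
move=> K0 dg gc.
have E x : ((\sum_k v 0 k * g k x) ^+ 2)%:E =
    (\sum_k \sum_l (v 0 k * v 0 l)%:E * (g k x * g l x)%:E)%E.
  rewrite expr2 mulr_suml -sumEFin; apply: eq_bigr => k _.
  rewrite mulr_sumr -sumEFin; apply: eq_bigr => l _.
  by rewrite -EFinM mulrACA.
under eq_integral do rewrite E.
have int k l : mu.-integrable [set: R] (fun x => ((v 0 k * v 0 l)%:E * (g k x * g l x)%:E)%E).
  by apply: integrableZl => //; exact: density_mul_integrable dg gc.
rewrite integral_sum//; last first.
  by move=> k; apply: integrable_sum => // l _; exact: int.
rewrite /quadratic mulr_sumr -sumEFin; apply: eq_bigr => k _.
rewrite integral_sum// mulr_sumr -sumEFin; apply: eq_bigr => l _.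
rewrite integralZl//; last exact: density_mul_integrable dg gc.
rewrite mxE mulrCA (mulrA K%:R) divff ?pnatr_eq0 -?lt0n// mul1r [RHS]EFinM; congr (_ * _)%E.
rewrite /Rintegral fineK//.
exact: (integrable_fin_num measurableT (density_mul_integrable k l dg gc)).
Qed.

End mixture_of_densities.

Section smooth_functions.
Variable R : realType.

Lemma is_derive_derive1n (f : R -> R) (m : nat) :
  (forall j x, (j < m)%N -> derivable (derive1n j f) x 1) ->
  forall j (x : R), (j < m)%N -> is_derive x 1 (derive1n j f) (derive1n j.+1 f x).
Proof.
move=> df j x jm; apply: DeriveDef; first exact: df.
by rewrite derive1nS derive1E.
Qed.

(** The class gives no continuity of the top derivative; it is measurable as a pointwise limit of
    difference quotients with steps [1 / (i + 1)]. *)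
Lemma derivative_measurable (f f' : R -> R) :
  (forall x : R, is_derive x 1 f (f' x)) -> measurable_fun [set: R] f'.
Proof.
move=> df; have cf := is_derive_continuous df.
have mf : measurable_fun [set: R] f by exact: continuous_measurable_fun.
pose F (i : nat) x := i.+1%:R * (f (x + i.+1%:R^-1) - f x).
apply: (@measurable_fun_cvg _ _ _ _ F).
  move=> i; apply: measurable_funM => //; apply: measurable_funB => //.
  apply: measurableT_comp => //.
  by apply: measurable_funD.
move=> x _.
have [dfx fx] := df x.
have h : (fun h => h^-1 *: (f (h *: (1 : R) + x) - f x)) @ 0^' --> f' x.
  by rewrite -fx; exact: dfx.
have inv0 : (fun i : nat => i.+1%:R^-1 : R) @ \oo --> 0^'.
  move=> P hP; apply: (@filterS _ \oo _ (fun i => harmonic i != 0 :> R -> P (harmonic i))).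
    by move=> i /=; apply; rewrite /harmonic/= invr_eq0 pnatr_eq0.
  exact: (@cvg_harmonic R _ hP).
rewrite (_ : (fun i => F i x) = (fun h => h^-1 *: (f (h *: (1 : R) + x) - f x)) \o
    (fun i : nat => i.+1%:R^-1 : R)); first by apply: cvg_comp h; exact: inv0.
by apply/funext => i; rewrite /F /= /GRing.scale/= invrK mulr1 (addrC x).
Qed.

Lemma derive1n_measurable (f : R -> R) (m j : nat) :
  measurable_fun [set: R] f ->
  (forall j x, (j < m)%N -> derivable (derive1n j f) x 1) ->
  (j <= m)%N -> measurable_fun [set: R] (derive1n j f).
Proof.
move=> mf df; case: j => [|j] jm; first by rewrite derive1n0.
by apply: (@derivative_measurable (derive1n j f)) => x; exact: is_derive_derive1n jm.
Qed.

End smooth_functions.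

Section model_class.
Variables (R : realType) (K : nat) (beta : R).
Local Notation mu := (@lebesgue_measure R).
Local Notation m := (strict_floor beta).
Local Notation theta := (beta - m%:R).

Definition squared_increment (f : R -> R) (t : R) : \bar R :=
  (\int[mu]_x ((derive1n m f (x + t) - derive1n m f x) ^+ 2)%:E)%E.

(* The constraints of [Theta] that bear on [g], with one constant per
   constraint ([A] bounds the square of the Nikolski constant) and with the
   eigenvalue conditions written as quadratic form inequalities. *)
Definition density_model (A lo hi c3 : R) (g : 'I_K -> R -> R) : Prop :=
  [/\ forall k, is_density (g k),
      forall k, (forall j x, (j < m)%N -> derivable (derive1n j (g k)) x 1) /\
        forall t, (squared_increment (g k) t <= (A * (`|t| `^ theta) ^+ 2)%:E)%E,
      forall k, (c3%:E <= mu (anchor_set g k))%E,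
      forall v : 'rV[R]_K,
        ((lo * K%:R * sqnorm v)%:E <= \int[mu]_x ((\sum_k v 0 k * g k x) ^+ 2)%:E)%E /\
        (\int[mu]_x ((\sum_k v 0 k * g k x) ^+ 2)%:E <= (hi * K%:R * sqnorm v)%:E)%E &
      forall x, gbar g x <= hi].

Lemma nikolskiP (L0 : R) (f : R -> R) : 0 <= L0 -> nikolski beta L0 f <->
  (forall j x, (j < m)%N -> derivable (derive1n j f) x 1) /\
  forall t, (squared_increment f t <= (L0 ^+ 2 * (`|t| `^ theta) ^+ 2)%:E)%E.
Proof.
move=> L00; split=> -[df h]; split => // t; have := h t; rewrite -?exprMn.
  by move/Lnorm2_leP; apply; rewrite mulr_ge0 ?powR_ge0.
by move=> ?; apply/Lnorm2_leP => //; rewrite mulr_ge0 ?powR_ge0.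
Qed.

Variable n : nat.

Definition Pi_model (c2 : R) (Pi : 'M[R]_(n, K)) : Prop :=
  simplex_rows Pi /\
  [/\ c2 < lambda_min (Sigma_Pi Pi), lambda_max (Sigma_Pi Pi) <= c2^-1 &
      forall k, c2 * K%:R^-1 * n%:R <= eta_Pi Pi k 0 <= c2^-1 * K%:R^-1 * n%:R].

(** The constraints decouple, so [g] can be moved with [Pi] held fixed; as integral inequalities
    they are easy to follow through dilation and mixing. *)
Lemma ThetaP (L0 c1 c2 c3 : R) g (Pi : 'M[R]_(n, K)) : (0 < K)%N -> 0 <= L0 ->
  Theta K n beta L0 c1 c2 c3 (g, Pi) <->
  Pi_model c2 Pi /\ density_model (L0 ^+ 2) c1 c1^-1 c3 g.
Proof.
move=> K0 L00.
have sig v : (forall k, is_density (g k)) -> (forall x, gbar g x <= c1^-1) ->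
    forall c, ((c * K%:R * sqnorm v)%:E <= \int[mu]_x ((\sum_k v 0 k * g k x) ^+ 2)%:E)%E =
      (c * sqnorm v <= quadratic (Sigma_g g) v) /\
    (\int[mu]_x ((\sum_k v 0 k * g k x) ^+ 2)%:E <= (c * K%:R * sqnorm v)%:E)%E =
      (quadratic (Sigma_g g) v <= c * sqnorm v).
  move=> dg gc c; rewrite (Sigma_quadratic v K0 dg gc) !lee_fin.
  by rewrite mulrAC -mulrC !ler_pM2l ?ltr0n.
split=> [[[dg sPi] nik anc [l1 l2 gc] [p1 p2 p3]]|[[sPi [p1 p2 p3]] [dg nik anc gv gc]]].
  split; first by [].
  split=> //.
  - by move=> k; apply/nikolskiP.
  - move=> v; have [-> _] := sig v dg gc c1; have [_ ->] := sig v dg gc c1^-1.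
    move/(lambda_min_geP K0 (Sigma_gT g)): l1 => l1.
    by move/(lambda_max_leP K0 (Sigma_gT g)): l2 => l2.
split=> //.
- by move=> k; apply/nikolskiP.
- split=> //.
    apply/(lambda_min_geP K0 (Sigma_gT g)) => v.
    by have [<- _] := sig v dg gc c1; have [] := gv v.
  apply/(lambda_max_leP K0 (Sigma_gT g)) => v.
  by have [_ <-] := sig v dg gc c1^-1; have [] := gv v.
Qed.

End model_class.

Lemma anchor_set_measurable (R : realType) (K : nat) (g : 'I_K -> R -> R) k :
  (forall k, is_density (g k)) -> measurable (anchor_set g k).
Proof.
move=> dg; have mg l A : measurable A -> measurable (g l @^-1` A).
  by move=> mA; have [mgl _ _] := dg l; rewrite -[X in measurable X]setTI; exact: mgl.
rewrite (_ : anchor_set g k = (g k @^-1` `]0, +oo[%classic) `&`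
    \bigcap_(l in [set l | l != k]) g l @^-1` [set 0]).
  apply: measurableI; first exact: mg.
  by apply: fin_bigcap_measurable => [|l _]; [exact: finite_finset|exact: mg].
apply/seteqP; split => x /= [h1 h2]; split => //=.
- by rewrite in_itv/= andbT.
- by move: h1; rewrite in_itv/= andbT.
Qed.

(** * Dilating and mixing densities inside the class *)

Section dilation.
Variables (R : realType) (K : nat) (beta : R).
Local Notation mu := (@lebesgue_measure R).
Local Notation m := (strict_floor beta).
Local Notation theta := (beta - m%:R).

Definition dilate (a : R) (f : R -> R) (x : R) : R := a * f (a * x).

Lemma derive1n_dilate (a : R) (f : R -> R) :
  (forall j x, (j < m)%N -> derivable (derive1n j f) x 1) ->
  (forall j, (j <= m)%N ->
     derive1n j (dilate a f) = fun x => a ^+ j.+1 * derive1n j f (a * x)) /\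
  (forall j x, (j < m)%N -> derivable (derive1n j (dilate a f)) x 1).
Proof.
move=> df; pose F j x := a ^+ j.+1 * derive1n j f (a * x).
have -> : dilate a f = F 0%N.
  by apply/funext => x; rewrite /F expr1 derive1n0.
apply: derive1n_tower => j x jm.
have := is_derive_affine a 0 (a ^+ j.+1) x (fun y => is_derive_derive1n df y jm).
rewrite -exprSr subr0 (_ : (fun x => _) = F j)//.
by apply/funext => y; rewrite /F subr0.
Qed.

Lemma dilate_density (a : R) (f : R -> R) : 0 < a -> is_density f -> is_density (dilate a f).
Proof.
move=> a0 [mf f0 f1]; split.
- apply: measurable_funM => //.
  by apply: (measurableT_comp mf); exact: mulrl_measurable.
- by move=> x; rewrite mulr_ge0// ltW.
- rewrite -f1 [RHS](ge0_integral_scale a0)//.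
  by apply: eq_integral => x _; rewrite /dilate mulrC.
Qed.

(** Scaling produces [a^(2 m + 1)] and a further [a^(2 theta)]. As [a <= 1], one factor [a] is kept
    and the others are bounded by 1. *)
Lemma dilate_squared_increment (a A : R) (f : R -> R) : 0 < a <= 1 -> 0 < beta ->
  measurable_fun [set: R] f ->
  (forall j x, (j < m)%N -> derivable (derive1n j f) x 1) -> 0 <= A ->
  (forall t, (squared_increment beta f t <= (A * (`|t| `^ theta) ^+ 2)%:E)%E) ->
  forall t, (squared_increment beta (dilate a f) t <= (a * A * (`|t| `^ theta) ^+ 2)%:E)%E.
Proof.
move=> /andP[a0 a1] beta0 mf df A0 fA t; have [dE _] := derive1n_dilate a df.
have /andP[th0 _] := theta_itv beta0.
have mD : measurable_fun [set: R] (derive1n m f) by exact: (@derive1n_measurable R f m).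
pose H y := (derive1n m f (y + a * t) - derive1n m f y) ^+ 2.
have mH : measurable_fun [set: R] H.
  apply: measurable_funX; apply: measurable_funB => //.
  by apply: (measurableT_comp mD); exact: measurable_funD.
have H0 y : 0 <= H y by exact: sqr_ge0.
have mHa : measurable_fun [set: R] (fun x => H (a * x) * a).
  apply: measurable_funM => //.
  by apply: (measurableT_comp mH); exact: mulrl_measurable.
have am0 : 0 <= a ^+ (m.*2).+1 by rewrite exprn_ge0// ltW.
have -> : squared_increment beta (dilate a f) t =
    ((a ^+ (m.*2).+1)%:E * \int[mu]_x (H x)%:E)%E.
  rewrite (ge0_integral_scale a0 mH H0) -ge0_integralZl//.
  - apply: eq_integral => x _; rewrite dE// -EFinM; congr EFin.
    by rewrite /H mulrDr -mulrBr exprMn -exprM muln2 doubleS exprSr; ring.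
  - exact/measurable_EFinP.
  - by move=> x _; rewrite lee_fin mulr_ge0// ltW.
apply: (@le_trans _ _ ((a ^+ (m.*2).+1)%:E * (A * (`|a * t| `^ theta) ^+ 2)%:E)%E).
  by apply: lee_wpmul2l; [rewrite lee_fin|exact: fA].
rewrite -EFinM lee_fin exprS -!mulrA ler_wpM2l ?(ltW a0)// mulrCA ler_wpM2l//.
rewrite -[leRHS]mul1r; apply: ler_pM; rewrite ?exprn_ge0 ?powR_ge0 ?(ltW a0)//.
  by rewrite exprn_ile1// ltW.
rewrite lerXn2r ?nnegrE ?powR_ge0// ge0_ler_powR ?nnegrE ?(ltW th0)//.
by rewrite normrM (ger0_norm (ltW a0)) ler_piMl.
Qed.

Lemma dilate_anchor (a c3 : R) (g : 'I_K -> R -> R) k : 0 < a ->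
  (forall k, is_density (g k)) ->
  (c3%:E <= mu (anchor_set g k))%E ->
  ((c3 / a)%:E <= mu (anchor_set (fun k => dilate a (g k)) k))%E.
Proof.
move=> a0 dg; rewrite (lebesgue_measure_scale a0).
  have -> : *%R a @^-1` anchor_set g k = anchor_set (fun k => dilate a (g k)) k.
    apply/seteqP; split => x [/= h1 h2]; split.
    - by rewrite /dilate mulr_gt0.
    - by move=> l lk; rewrite /dilate h2// mulr0.
    - by move: h1; rewrite /dilate pmulr_rgt0.
    - by move=> l /h2 /eqP; rewrite /dilate mulf_eq0 gt_eqF//= => /eqP.
  set M := mu _; have : (0 <= M)%E by exact: measure_ge0.
  case: M => [r| |]// r0; last by rewrite leey.
  by rewrite -EFinM !lee_fin ler_pdivrMr// mulrC.
exact: anchor_set_measurable.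
Qed.

End dilation.

Lemma sqr_sum_le (R : realFieldType) (K : nat) (x : 'I_K -> R) :
  (\sum_k x k) ^+ 2 <= K%:R * \sum_k x k ^+ 2.
Proof.
have E1 : (\sum_k x k) ^+ 2 = \sum_k \sum_l x k * x l.
  by rewrite expr2 mulr_suml; apply: eq_bigr => k _; rewrite mulr_sumr.
have E2 : 2 * (K%:R * \sum_k x k ^+ 2) = \sum_k \sum_l (x k ^+ 2 + x l ^+ 2).
  under [RHS]eq_bigr do rewrite big_split/= sumr_const card_ord -[_ *+ K]mulr_natl.
  rewrite big_split/= -mulr_sumr sumr_const card_ord -[_ *+ K]mulr_natl; ring.
have : 2 * \sum_k \sum_l x k * x l <= \sum_k \sum_l (x k ^+ 2 + x l ^+ 2).
  rewrite mulr_sumr; apply: ler_sum => k _; rewrite mulr_sumr; apply: ler_sum => l _.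
  by have := sqr_ge0 (x k - x l); nra.
by rewrite -E1 -E2; lra.
Qed.

Section convex_combination.
Variables (R : realType) (eps : R) (f g : R -> R).
Local Notation mu := (@lebesgue_measure R).
Hypotheses (eps01 : 0 <= eps <= 1 / 3) (mf : measurable_fun [set: R] f)
  (mg : measurable_fun [set: R] g).

Let mf2 : measurable_fun [set: R] (fun x => f x ^+ 2). Proof. exact: measurable_funX. Qed.
Let mg2 : measurable_fun [set: R] (fun x => g x ^+ 2). Proof. exact: measurable_funX. Qed.
Let mfg2 : measurable_fun [set: R] (fun x => ((1 - eps) * f x + eps * g x) ^+ 2).
Proof.
by apply: measurable_funX; apply: measurable_funD; apply: measurable_funM.
Qed.

Lemma integral_sqr_convex :
  (\int[mu]_x (((1 - eps) * f x + eps * g x) ^+ 2)%:E <=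
   (1 - eps)%:E * \int[mu]_x (f x ^+ 2)%:E + eps%:E * \int[mu]_x (g x ^+ 2)%:E)%E.
Proof.
have /andP[e0 e1] := eps01; have e2 : 0 <= 1 - eps by lra.
rewrite -!ge0_integralZ_EFin//; do ?[by move=> x; exact: sqr_ge0].
have mZ c (h : R -> R) : measurable_fun [set: R] h -> measurable_fun [set: R] (fun x => c * h x).
  by move=> mh; apply: measurable_funM.
rewrite -ge0_integralD_EFin//; do ?[exact: mZ];
  do ?[by move=> x; rewrite mulr_ge0 ?sqr_ge0].
apply: ge0_le_integral_EFin => //.
- by apply: measurable_funD; exact: mZ.
- by move=> x; exact: sqr_ge0.
- move=> x; have := mulr_ge0 (mulr_ge0 e0 e2) (sqr_ge0 (f x - g x)).
  by nra.
Qed.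

Lemma integral_sqr_perturb :
  ((1 - 3 * eps)%:E * \int[mu]_x (f x ^+ 2)%:E <=
   \int[mu]_x (((1 - eps) * f x + eps * g x) ^+ 2)%:E +
   eps%:E * \int[mu]_x (g x ^+ 2)%:E)%E.
Proof.
have /andP[e0 e1] := eps01; have e2 : 0 <= 1 - 3 * eps by lra.
rewrite -!ge0_integralZ_EFin//; do ?[by move=> x; exact: sqr_ge0].
have mZ c (h : R -> R) : measurable_fun [set: R] h -> measurable_fun [set: R] (fun x => c * h x).
  by move=> mh; apply: measurable_funM.
rewrite -ge0_integralD_EFin//; do ?[exact: mZ];
  do ?[by move=> x; exact: sqr_ge0|by move=> x; apply: mulr_ge0 => //; exact: sqr_ge0].
apply: ge0_le_integral_EFin => //.
- exact: mZ.
- by apply: measurable_funD => //; exact: mZ.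
- by move=> x; rewrite mulr_ge0 ?sqr_ge0.
- move=> x; have := mulr_ge0 e0 (sqr_ge0 (f x + g x)).
  have := mulr_ge0 (sqr_ge0 eps) (sqr_ge0 (f x - g x)).
  by nra.
Qed.

End convex_combination.

Section perturbed_model.
Variables (R : realType) (K : nat) (beta : R).
Hypothesis beta0 : 0 < beta.
Local Notation mu := (@lebesgue_measure R).
Local Notation m := (strict_floor beta).
Local Notation theta := (beta - m%:R).

(** Inner products in L2 are multiplied by [a], anchor measures by [1 / a]. Only [lo] deteriorates;
    the smoothness and anchor constants gain room. *)
Lemma dilate_model (a A lo hi c3 : R) (g : 'I_K -> R -> R) :
  0 < a <= 1 -> 0 <= A -> 0 <= hi -> density_model beta A lo hi c3 g ->
  density_model beta (a * A) (a * lo) hi (c3 / a) (fun k => dilate a (g k)).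
Proof.
move=> /[dup] a01 /andP[a0 a1] A0 hi0 [dg nik anc quad gb]; split.
- by move=> k; exact: dilate_density.
- move=> k; have [df hf] := nik k; have [_ df'] := derive1n_dilate a df.
  split => // t; apply: dilate_squared_increment => //.
  by have [] := dg k.
- by move=> k; exact: dilate_anchor.
- move=> v; have [q1 q2] := quad v.
  have mg : measurable_fun [set: R] (fun x => (\sum_k v 0 k * g k x) ^+ 2).
    apply: measurable_funX; apply: measurable_sum => k; apply: measurable_funM => //.
    by have [] := dg k.
  have -> : (\int[mu]_x ((\sum_k v 0 k * dilate a (g k) x) ^+ 2)%:E =
      a%:E * \int[mu]_x ((\sum_k v 0 k * g k x) ^+ 2)%:E)%E.
    rewrite (ge0_integral_scale a0 mg); last by move=> x; exact: sqr_ge0.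
    rewrite -ge0_integralZl//.
    - apply: eq_integral => x _; rewrite -EFinM; congr EFin.
      rewrite (_ : \sum_k v 0 k * dilate a (g k) x = a * \sum_k v 0 k * g k (a * x)).
        by ring.
      by rewrite mulr_sumr; apply: eq_bigr => k _; rewrite /dilate mulrCA.
    - apply/measurable_EFinP; apply: measurable_funM => //.
      by apply: (measurableT_comp mg); exact: mulrl_measurable.
    - by move=> x _; rewrite lee_fin mulr_ge0 ?sqr_ge0// ltW.
    - by rewrite lee_fin ltW.
  split.
    rewrite -!mulrA EFinM mulrA; apply: lee_wpmul2l => //.
    by rewrite lee_fin ltW.
  apply: (@le_trans _ _ (a%:E * (hi * K%:R * sqnorm v)%:E)%E).
    by apply: lee_wpmul2l => //; rewrite lee_fin ltW.
  by rewrite -EFinM lee_fin ler_piMl// !mulr_ge0// sqnorm_ge0.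
- move=> x; apply: le_trans (gb (a * x)).
  rewrite /gbar ler_wpM2l ?invr_ge0//; apply: ler_sum => k _.
  by rewrite /dilate ler_piMl//; have [_ + _] := dg k; apply.
Qed.

Variables (delta C eps : R) (b q : 'I_K -> R -> R).
Hypotheses (delta0 : 0 < delta) (C0 : 0 <= C) (eps01 : 0 <= eps <= 1 / 3).
Hypothesis q_density : forall k, [/\ continuous (q k), forall x, 0 <= q k x <= C,
  forall x, ~~ (0 < x < delta) -> q k x = 0 & (\int[mu]_x (q k x)%:E = 1)%E].
Hypothesis q_smooth : forall k, [/\
  forall j x, (j < m)%N -> derivable (derive1n j (q k)) x 1,
  forall x, ~~ (0 < x < delta) -> derive1n m (q k) x = 0,
  continuous (derive1n m (q k)) &
  forall x t, `|derive1n m (q k) (x + t) - derive1n m (q k) x| <= C * `|t| `^ theta].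

Definition perturbed (k : 'I_K) (x : R) : R := (1 - eps) * b k x + eps * q k x.

Let I := `[0%R, delta]%classic.

Let muI : mu I = delta%:E.
Proof. by rewrite lebesgue_measure_itv/= lte_fin delta0 sube0. Qed.

Let outI x : ~ I x -> ~~ (0 < x < delta).
Proof. by rewrite /I /= in_itv/= => /negP; apply: contra => /andP[/ltW -> /ltW ->]. Qed.

Let mq k : measurable_fun [set: R] (q k).
Proof. by have [c _ _ _] := q_density k; exact: continuous_measurable_fun. Qed.

Let q0 k x : 0 <= q k x. Proof. by have [_ /(_ x)/andP[]] := q_density k. Qed.

Let qC k x : q k x <= C * \1_I x.
Proof.
have [_ /(_ x)/andP[_ h] q_out _] := q_density k; rewrite indicE.
have [xI|xI] := boolP (x \in I); rewrite ?mulr1// mulr0 q_out//.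
by apply: outI => /mem_set; apply/negP.
Qed.

Lemma perturbed_density : (forall k, is_density (b k)) ->
  forall k, is_density (perturbed k).
Proof.
move=> db k; have [mb b0 b1] := db k; have [_ _ _ q1] := q_density k.
have /andP[e0 e1] := eps01; have e2 : 0 <= 1 - eps by lra.
split.
- by apply: measurable_funD; apply: measurable_funM.
- by move=> x; rewrite /perturbed addr_ge0// mulr_ge0.
- have Z (c : R) (f : R -> R) : 0 <= c -> measurable_fun [set: R] f -> (forall x, 0 <= f x) ->
      (\int[mu]_x (f x)%:E = 1)%E -> (\int[mu]_x (c * f x)%:E = c%:E)%E.
    move=> c0 mf f0 f1; under eq_integral do rewrite EFinM.
    rewrite ge0_integralZl ?f1 ?mule1//; first exact/measurable_EFinP.
    by move=> x _; rewrite lee_fin.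
  rewrite /perturbed; under eq_integral do rewrite EFinD.
  rewrite ge0_integralD//=.
  + by rewrite !Z// -EFinD subrK.
  + by move=> x _; rewrite lee_fin mulr_ge0.
  + by apply/measurable_EFinP; exact: measurable_funM.
  + by move=> x _; rewrite lee_fin mulr_ge0.
  + by apply/measurable_EFinP; apply: measurable_funM => //; exact: mq.
Qed.

Lemma derive1n_perturbed k :
  (forall j x, (j < m)%N -> derivable (derive1n j (b k)) x 1) ->
  (forall j x, (j < m)%N -> derivable (derive1n j (perturbed k)) x 1) /\
  derive1n m (perturbed k) =
    fun x => (1 - eps) * derive1n m (b k) x + eps * derive1n m (q k) x.
Proof.
move=> db; have [dq _ _ _] := q_smooth k.
pose F j x := (1 - eps) * derive1n j (b k) x + eps * derive1n j (q k) x.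
have [|FE dF] := @derive1n_tower R F m.
  move=> j x jm; have h1 := is_derive_derive1n db x jm.
  have h2 := is_derive_derive1n dq x jm.
  have h3 := @is_deriveZ _ _ _ _ (1 - eps) _ _ _ h1.
  have h4 := @is_deriveZ _ _ _ _ eps _ _ _ h2.
  exact: is_deriveD h3 h4.
have -> : perturbed k = F 0%N by apply/funext => x; rewrite /F !derive1n0.
by split => //; rewrite FE.
Qed.

(** The increment is at most [C |t|^theta] and vanishes off [[0, delta]] and its translate by [-t],
    of total measure at most [2 delta]. *)
Let squared_increment_q k t :
  (squared_increment beta (q k) t <= ((2 * delta * C ^+ 2) * (`|t| `^ theta) ^+ 2)%:E)%E.
Proof.
have [_ qout cq hq] := q_smooth k.
pose J := `[(- t)%R, (delta - t)%R]%classic.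
pose c := (C * `|t| `^ theta) ^+ 2.
have c0 : 0 <= c by exact: sqr_ge0.
have mD : measurable_fun [set: R] (derive1n m (q k)) by exact: continuous_measurable_fun.
have muJ : mu J = delta%:E.
  rewrite lebesgue_measure_itv/= lte_fin ltrDr delta0 -EFinD.
  by rewrite opprK addrNK.
have mI1 : measurable_fun [set: R] (\1_I : R -> R) by apply: measurable_indic; exact: measurable_itv.
have mJ1 : measurable_fun [set: R] (\1_J : R -> R) by apply: measurable_indic; exact: measurable_itv.
apply: (@le_trans _ _ (\int[mu]_x (c * (\1_I x + \1_J x))%:E)%E).
  apply: ge0_le_integral => //.
  - by move=> x _; rewrite lee_fin sqr_ge0.
  - apply/measurable_EFinP; apply: measurable_funX; apply: measurable_funB => //.
    by apply: (measurableT_comp mD); exact: measurable_funD.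
  - apply/measurable_EFinP; apply: measurable_funM; first exact: measurable_cst.
    exact: measurable_funD.
  - move=> x _; rewrite lee_fin.
    have sq : (derive1n m (q k) (x + t) - derive1n m (q k) x) ^+ 2 <= c.
      have Ct := le_trans (normr_ge0 _) (hq x t).
      by rewrite -real_normK ?num_real// ler_pXn2r ?nnegrE// hq.
    have [xIJ|xIJ] := boolP ((x \in I) || (x \in J)).
      apply: le_trans sq _; rewrite ler_peMr// !indicE.
      by move: xIJ; case: (_ \in _); case: (_ \in _) => //= _; rewrite ?addr0 ?add0r// lerDl.
    move: xIJ; rewrite negb_or => /andP[xI xJ].
    have Dx : derive1n m (q k) x = 0.
      by apply/qout/outI => /mem_set; apply/negP.
    have Dxt : derive1n m (q k) (x + t) = 0.
      apply: qout; apply: contra xJ => /andP[h1 h2]; apply/mem_set.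
      by rewrite /J /= in_itv/=; apply/andP; split; lra.
    by rewrite Dx Dxt subrr expr0n/= mulr_ge0// addr_ge0.
have -> : (\int[mu]_x (c * (\1_I x + \1_J x))%:E = c%:E * (delta%:E + delta%:E))%E.
  rewrite ge0_integralZ_EFin//; last by apply: measurable_funD; [exact: mI1|exact: mJ1].
  congr (_ * _)%E; rewrite ge0_integralD_EFin//.
  have int1 (A : set R) : measurable A -> (\int[mu]_x (\1_A x)%:E = mu A)%E.
    by move=> mA; rewrite integral_indic// setIT.
  by rewrite (int1 _ (measurable_itv _)) (int1 _ (measurable_itv _)); congr (_ + _)%E.
by rewrite -EFinD -EFinM lee_fin /c le_eqVlt; apply/orP; left; apply/eqP; ring.
Qed.

Lemma perturbed_squared_increment A k :
  is_density (b k) ->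
  (forall j x, (j < m)%N -> derivable (derive1n j (b k)) x 1) ->
  (forall t, (squared_increment beta (b k) t <= (A * (`|t| `^ theta) ^+ 2)%:E)%E) ->
  forall t, (squared_increment beta (perturbed k) t <=
    (((1 - eps) * A + eps * (2 * delta * C ^+ 2)) * (`|t| `^ theta) ^+ 2)%:E)%E.
Proof.
move=> [mb _ _] db bA t; have [_ DE] := derive1n_perturbed db.
have [_ _ cq _] := q_smooth k.
have mDb : measurable_fun [set: R] (derive1n m (b k)) by exact: (@derive1n_measurable R (b k) m).
have mDq : measurable_fun [set: R] (derive1n m (q k)) by exact: continuous_measurable_fun.
have mincr (D : R -> R) : measurable_fun [set: R] D ->
    measurable_fun [set: R] (fun x => D (x + t) - D x).
  move=> mD; apply: measurable_funB => //.
  by apply: (measurableT_comp mD); exact: measurable_funD.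
rewrite /squared_increment DE.
have -> : (fun x => (((1 - eps) * derive1n m (b k) (x + t) + eps * derive1n m (q k) (x + t) -
      ((1 - eps) * derive1n m (b k) x + eps * derive1n m (q k) x)) ^+ 2)%:E) =
    (fun x => (((1 - eps) * (derive1n m (b k) (x + t) - derive1n m (b k) x) +
      eps * (derive1n m (q k) (x + t) - derive1n m (q k) x)) ^+ 2)%:E).
  by apply/funext => x; congr EFin; ring.
apply: le_trans (integral_sqr_convex eps01 (mincr _ mDb) (mincr _ mDq)) _.
have /andP[e0 e1] := eps01; have e2 : 0 <= 1 - eps by lra.
have -> : (((1 - eps) * A + eps * (2 * delta * C ^+ 2)) * (`|t| `^ theta) ^+ 2)%:E =
    ((1 - eps)%:E * (A * (`|t| `^ theta) ^+ 2)%:E +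
     eps%:E * (2 * delta * C ^+ 2 * (`|t| `^ theta) ^+ 2)%:E)%E.
  by rewrite -!EFinM -EFinD; congr EFin; ring.
apply: leeD; apply: lee_wpmul2l; rewrite ?lee_fin//; first exact: bA.
exact: squared_increment_q.
Qed.

Let mI1 : measurable_fun [set: R] (\1_I : R -> R).
Proof. by apply: measurable_indic; exact: measurable_itv. Qed.

Let int1I : (\int[mu]_x (\1_I x)%:E = delta%:E)%E.
Proof.
by rewrite integral_indic; [rewrite setIT; exact: muI|exact: measurableT|exact: measurable_itv].
Qed.

(** The supports overlap, so Cauchy-Schwarz costs a factor [K]. It is matched by the [K] in the
    quadratic constraints of [density_model], hence [eps] need not depend on [K]. *)
Lemma integral_sum_q (v : 'rV[R]_K) :
  (\int[mu]_x ((\sum_k v 0 k * q k x) ^+ 2)%:E <= (K%:R * (C ^+ 2 * delta) * sqnorm v)%:E)%E.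
Proof.
have c0 : 0 <= K%:R * C ^+ 2 * sqnorm v by rewrite !mulr_ge0 ?sqr_ge0 ?sqnorm_ge0.
apply: (@le_trans _ _ (\int[mu]_x (K%:R * C ^+ 2 * sqnorm v * \1_I x)%:E)%E).
  apply: ge0_le_integral_EFin => //.
  - apply: measurable_funX; apply: measurable_sum => k; apply: measurable_funM => //.
    exact: mq.
  - exact: measurable_funM.
  - by move=> x; exact: sqr_ge0.
  - move=> x; apply: le_trans (sqr_sum_le _) _.
    have -> : K%:R * C ^+ 2 * sqnorm v * \1_I x =
        K%:R * \sum_k v 0 k ^+ 2 * (C ^+ 2 * \1_I x).
      by rewrite -mulr_suml /sqnorm; ring.
    rewrite ler_wpM2l//; apply: ler_sum => k _.
    have := qC k x; have := q0 k x; rewrite exprMn indicE.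
    have := sqr_ge0 (v 0 k).
    case: (_ \in _) => /= v0 q1 q2; rewrite ?mulr1 ?mulr0 in q2 *.
      by apply: ler_wpM2l => //; rewrite ler_pXn2r ?nnegrE.
    have -> : q k x = 0 by apply/eqP; rewrite eq_le q1 q2.
    by rewrite expr0n mulr0.
rewrite ge0_integralZ_EFin// int1I -EFinM lee_fin le_eqVlt; apply/orP; left; apply/eqP; ring.
Qed.

Lemma perturb_model (A A' lo lo' hi hi' c3 c3' : R) :
  density_model beta A lo hi c3 b ->
  (1 - eps) * A + eps * (2 * delta * C ^+ 2) <= A' ->
  lo' <= (1 - 3 * eps) * lo - eps * (C ^+ 2 * delta) ->
  (1 - eps) * hi + eps * (C ^+ 2 * delta) <= hi' ->
  (1 - eps) * hi + eps * C <= hi' ->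
  c3' + delta <= c3 ->
  density_model beta A' lo' hi' c3' perturbed.
Proof.
have /andP[e0 e1] := eps01; have e2 : 0 <= 1 - eps by lra.
move=> [db nik anc quad gb] hA hlo hhi hgb hc3; split.
- exact: perturbed_density.
- move=> k; have [dbk bA] := nik k; split; first by have [] := derive1n_perturbed dbk.
  move=> t; apply: le_trans (perturbed_squared_increment (db k) dbk bA t) _.
  by rewrite lee_fin ler_wpM2r ?sqr_ge0.
- move=> k; have pd := perturbed_density db.
  (* Every [q l] vanishes off [I], so anchor points outside [I] remain anchor points, and at most
     the measure [delta] of [I] is lost. *)
  have : (mu (anchor_set b k) <= mu (anchor_set perturbed k) + delta%:E)%E.
    have mI : measurable I by exact: measurable_itv.
    have mP := anchor_set_measurable k pd.
    rewrite -muI; apply: le_trans (measureU2 mu mP mI).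
    apply: le_measure; rewrite ?inE; [exact: anchor_set_measurable k db|
        by apply: measurableU; [exact: anchor_set_measurable k pd|exact: measurable_itv]|].
    move=> x [h1 h2]; have [xI|xI] := pselect (I x); [by right|left].
    have qx l : q l x = 0 by have [_ _ + _] := q_density l; apply; exact: outI.
    split; first by rewrite /perturbed qx mulr0 addr0 mulr_gt0//; lra.
    by move=> l lk; rewrite /perturbed qx h2// !mulr0 addr0.
  move=> h; have := le_trans (anc k) h.
  set M := mu (anchor_set perturbed k).
  have : (0 <= M)%E by exact: measure_ge0.
  case: M => [r| |]// r0; last by move=> *; rewrite leey.
  by rewrite -EFinD !lee_fin; lra.
- move=> v; have [q1 q2] := quad v.
  pose f x := \sum_k v 0 k * b k x; pose g x := \sum_k v 0 k * q k x.
  have mf : measurable_fun [set: R] f.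
    by apply: measurable_sum => k; apply: measurable_funM => //; have [] := db k.
  have mg : measurable_fun [set: R] g.
    by apply: measurable_sum => k; apply: measurable_funM => //; exact: mq.
  have -> : (fun x => ((\sum_k v 0 k * perturbed k x) ^+ 2)%:E) =
      (fun x => (((1 - eps) * f x + eps * g x) ^+ 2)%:E).
    apply/funext => x; congr (EFin (_ ^+ 2)); rewrite /f /g !mulr_sumr -big_split/=.
    by apply: eq_bigr => k _; rewrite /perturbed mulrDr ![v 0 k * (_ * _)]mulrCA.
  have h1 := integral_sqr_convex eps01 mf mg; have h2 := integral_sqr_perturb eps01 mf mg.
  have h3 := integral_sum_q v; have s0 := sqnorm_ge0 v.
  have Ks0 : 0 <= K%:R * sqnorm v by rewrite mulr_ge0.
  split.
    have : ((1 - 3 * eps)%:E * (lo * K%:R * sqnorm v)%:E <=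
        \int[mu]_x (((1 - eps) * f x + eps * g x) ^+ 2)%:E +
        eps%:E * (K%:R * (C ^+ 2 * delta) * sqnorm v)%:E)%E.
      apply: le_trans (lee_wpmul2l _ q1) _; first by rewrite lee_fin; lra.
      by apply: le_trans h2 _; apply: leeD => //; apply: lee_wpmul2l.
    set M := (\int[mu]_x _)%E; have : (0 <= M)%E.
      by apply: integral_ge0 => x _; rewrite lee_fin sqr_ge0.
    case: M => [r| |]// r0; last by move=> *; rewrite leey.
    rewrite -!EFinM -EFinD !lee_fin.
    by have := ler_wpM2r Ks0 hlo; lra.
  apply: le_trans h1 _.
  apply: (@le_trans _ _ ((1 - eps)%:E * (hi * K%:R * sqnorm v)%:E +
      eps%:E * (K%:R * (C ^+ 2 * delta) * sqnorm v)%:E)%E).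
    by apply: leeD; apply: lee_wpmul2l; rewrite ?lee_fin.
  rewrite -!EFinM -EFinD lee_fin.
  by have := ler_wpM2r Ks0 hhi; lra.
- move=> x; apply: le_trans hgb; have := gb x; rewrite /gbar /perturbed big_split/= mulrDr.
  move=> gbx; apply: lerD.
    by rewrite -mulr_sumr mulrCA ler_wpM2l.
  rewrite -mulr_sumr mulrCA ler_wpM2l//.
  have qK : \sum_k q k x <= K%:R * C.
    rewrite -[K in K%:R]card_ord mulr_natl -sumr_const; apply: ler_sum => k _.
    by have [_ /(_ x)/andP[]] := q_density k.
  apply: le_trans (ler_wpM2l _ qK) _; first by rewrite invr_ge0.
  have [->|Kn0] := eqVneq (K%:R : R) 0; first by rewrite invr0 mul0r.
  by rewrite mulKf.
Qed.

End perturbed_model.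

(** * Separation and chi-square divergence *)

Section separation.
Variables (R : realType) (K : nat) (lo delta C eps : R).
Local Notation mu := (@lebesgue_measure R).
Hypotheses (delta0 : 0 < delta) (eps01 : 0 <= eps <= 1 / 3).
Hypothesis eps_small : eps * (2 * (C ^+ 2 * delta) + 6 * lo) <= 2 * lo.
Variables (b q1 q2 : 'I_K -> R -> R).
Hypothesis mb : forall k, measurable_fun [set: R] (b k).
Hypothesis mq1 : forall k, measurable_fun [set: R] (q1 k).
Hypothesis mq2 : forall k, measurable_fun [set: R] (q2 k).
Hypothesis lob : forall v : 'rV[R]_K,
  ((lo * K%:R * sqnorm v)%:E <= \int[mu]_x ((\sum_k v 0 k * b k x) ^+ 2)%:E)%E.
Hypothesis q12C : forall k l x, (q1 k x - q2 l x) ^+ 2 <= C ^+ 2 * \1_(`[0, delta]) x.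

Local Notation G1 := (perturbed eps b q1).
Local Notation G2 := (perturbed eps b q2).

Let mI1 : measurable_fun [set: R] (\1_(`[0, delta]) : R -> R).
Proof. by apply: measurable_indic; exact: measurable_itv. Qed.

Let mdiff k l : measurable_fun [set: R] (fun x => (q1 k x - q2 l x) ^+ 2).
Proof. by apply: measurable_funX; exact: measurable_funB. Qed.

Let mG1 k : measurable_fun [set: R] (G1 k).
Proof. by apply: measurable_funD; apply: measurable_funM. Qed.

Let mG2 k : measurable_fun [set: R] (G2 k).
Proof. by apply: measurable_funD; apply: measurable_funM. Qed.

Let mG12 k l : measurable_fun [set: R] (fun x => (G1 k x - G2 l x) ^+ 2).
Proof. by apply: measurable_funX; exact: measurable_funB. Qed.

Let int_diff k l : (\int[mu]_x ((q1 k x - q2 l x) ^+ 2)%:E <= (C ^+ 2 * delta)%:E)%E.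
Proof.
apply: (@le_trans _ _ (\int[mu]_x (C ^+ 2 * \1_(`[0, delta]) x)%:E)%E).
  apply: ge0_le_integral_EFin => //; [exact: mdiff|exact: measurable_funM|].
  by move=> x; exact: sqr_ge0.
rewrite ge0_integralZ_EFin//; last exact: sqr_ge0.
rewrite integral_indic; [|exact: measurableT|exact: measurable_itv].
have muI : mu `[0, delta]%classic = delta%:E.
  by rewrite lebesgue_measure_itv/= lte_fin delta0 sube0.
by rewrite setIT [X in (_ * X <= _)%E](_ : _ = delta%:E); [rewrite EFinM|exact: muI].
Qed.

Let int_sum (F : 'I_K -> R -> R) : (forall k, measurable_fun [set: R] (F k)) ->
  (forall k x, 0 <= F k x) ->
  (\int[mu]_x (\sum_k F k x)%:E = \sum_k \int[mu]_x (F k x)%:E)%E.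
Proof.
move=> mF F0; under eq_integral do rewrite -sumEFin.
rewrite ge0_integral_sum//; first by move=> k; apply/measurable_EFinP; exact: mF.
by move=> k x _; rewrite lee_fin.
Qed.

(* Two different components of [b] are at squared distance at least
   [2 * lo * K], so a nontrivial relabelling costs more than the whole
   perturbation. *)
Lemma perturbed_perm_separated (s : 'S_K) :
  ((eps ^+ 2)%:E * \int[mu]_x (\sum_k (q1 k x - q2 k x) ^+ 2)%:E <=
   \int[mu]_x (\sum_k (G1 (s k) x - G2 k x) ^+ 2)%:E)%E.
Proof.
have /andP[e0 e1] := eps01.
have [k sk|s1] := pickP (fun k => s k != k); last first.
  rewrite -ge0_integralZ_EFin ?sqr_ge0//.
  - apply: ge0_le_integral_EFin => //.
    + by apply: measurable_funM => //; apply: measurable_sum => k; exact: mdiff.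
    + by apply: measurable_sum => k; exact: mG12.
    + by move=> x; rewrite mulr_ge0 ?sqr_ge0 ?sumr_ge0// => k _; exact: sqr_ge0.
    + move=> x; rewrite mulr_sumr; apply: ler_sum => k _.
      have /negbFE/eqP -> := s1 k.
      by rewrite /perturbed le_eqVlt; apply/orP; left; apply/eqP; ring.
  - by apply: measurable_sum => k; exact: mdiff.
  - by move=> x; apply: sumr_ge0 => k _; exact: sqr_ge0.
apply: (@le_trans _ _ ((eps ^+ 2) * (K%:R * (C ^+ 2 * delta)))%:E).
  rewrite [leRHS]EFinM; apply: lee_wpmul2l; first by rewrite lee_fin sqr_ge0.
  rewrite int_sum; [|by move=> l; exact: mdiff|by move=> l x; exact: sqr_ge0].
  apply: le_trans (lee_sum _ (fun l _ => int_diff l l)) _.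
  by rewrite sumEFin lee_fin sumr_const card_ord -[_ *+ K]mulr_natl.
have mf : measurable_fun [set: R] (fun x => b (s k) x - b k x) by exact: measurable_funB.
have mg : measurable_fun [set: R] (fun x => q1 (s k) x - q2 k x) by exact: measurable_funB.
have h := integral_sqr_perturb eps01 mf mg.
have K1 : 1 <= K%:R :> R by rewrite ler1n; exact: leq_ltn_trans (ltn_ord k).
have ks : (k == s k) = false by rewrite eq_sym (negbTE sk).
have hb : ((2 * lo * K%:R)%:E <= \int[mu]_x ((b (s k) x - b k x) ^+ 2)%:E)%E.
  have := lob (delta_mx 0 (s k) - delta_mx 0 k).
  rewrite (_ : sqnorm _ = 2).
    rewrite (_ : lo * K%:R * 2 = 2 * lo * K%:R); last by ring.
    move=> h'; apply: le_trans h' _; rewrite le_eqVlt; apply/orP; left; apply/eqP.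
    apply: eq_integral => x _; congr (EFin (_ ^+ 2)).
    rewrite (bigD1 (s k))//= (bigD1 k)/=; last by rewrite eq_sym.
    rewrite big1 ?addr0 => [|l /andP[ls lk]].
      by rewrite !mxE !eqxx ks (negbTE sk)/=; ring.
    by rewrite !mxE/= (negbTE ls) (negbTE lk) subrr mul0r.
  rewrite /sqnorm (bigD1 (s k))//= (bigD1 k)/=; last by rewrite eq_sym.
  rewrite big1 ?addr0 => [|l /andP[ls lk]].
    by rewrite !mxE !eqxx ks (negbTE sk)/=; ring.
  by rewrite !mxE/= (negbTE ls) (negbTE lk) subrr expr0n.
have hX : ((1 - 3 * eps)%:E * (2 * lo * K%:R)%:E <=
    \int[mu]_x ((G1 (s k) x - G2 k x) ^+ 2)%:E + eps%:E * (C ^+ 2 * delta)%:E)%E.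
  apply: le_trans (lee_wpmul2l _ hb) _; first by rewrite lee_fin; lra.
  apply: le_trans h _; apply: leeD; last by apply: lee_wpmul2l => //; exact: int_diff.
  rewrite le_eqVlt; apply/orP; left; apply/eqP; apply: eq_integral => x _.
  by congr (EFin (_ ^+ 2)); rewrite /perturbed; ring.
apply: (@le_trans _ _ (\int[mu]_x ((G1 (s k) x - G2 k x) ^+ 2)%:E)%E).
  move: hX; set M := (\int[mu]_x _)%E; have : (0 <= M)%E.
    by apply: integral_ge0 => x _; rewrite lee_fin sqr_ge0.
  case: M => [r| |]// r0; last by move=> *; rewrite leey.
  rewrite -!EFinM -EFinD !lee_fin => hr.
  (* Multiplied by [K], [eps_small] reads [2 eps Cd K <= (1 - 3 eps) 2 lo K], with [Cd] for
     [C^2 delta]. One half absorbs the error term of [hr] because [K >= 1], the other dominates the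
     target because [eps <= 1]. *)
  have Cd : 0 <= C ^+ 2 * delta by rewrite mulr_ge0 ?sqr_ge0// ltW.
  have h1 : eps * (C ^+ 2 * delta) <= eps * (C ^+ 2 * delta) * K%:R.
    by rewrite ler_peMr// mulr_ge0.
  have h2 : eps ^+ 2 * (K%:R * (C ^+ 2 * delta)) <= eps * (C ^+ 2 * delta) * K%:R.
    rewrite -mulrA [_ * K%:R]mulrC; apply: ler_wpM2r; first by rewrite mulr_ge0.
    by rewrite expr2 ler_piMl//; lra.
  have h3 := ler_wpM2r (ler0n R K) eps_small; lra.
apply: ge0_le_integral_EFin.
- exact: mG12.
- by apply: measurable_sum => l; exact: mG12.
- by move=> x; exact: sqr_ge0.
- move=> x; rewrite [leRHS](bigD1 k)//= lerDl; apply: sumr_ge0 => l _; exact: sqr_ge0.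
Qed.

(** If [s1] and [s2] are optimal relabellings for [G1] and [G2], then [t = s2 s1^-1] matches
    components of [G1] and [G2] approximated by the same component of [h]. The factor 1/2 comes from
    [(u - v)^2 <= 2 (h - u)^2 + 2 (h - v)^2]. *)
Lemma loss_perturbed_separated (h : 'I_K -> R -> R) :
  (forall k, measurable_fun [set: R] (h k)) ->
  ((eps ^+ 2 / 2)%:E * \int[mu]_x (\sum_k (q1 k x - q2 k x) ^+ 2)%:E <=
   loss h G1 + loss h G2)%E.
Proof.
move=> mh.
have [s1 _ s1E] := @eq_bigmin _ _ _ +oo%E (1%g : 'S_K) xpredT
  (fun s : 'S_K => \int[mu]_x (\sum_(k < K) (h (s k) x - G1 k x) ^+ 2)%:E)%E isT
  (fun s _ => leey _).
have [s2 _ s2E] := @eq_bigmin _ _ _ +oo%E (1%g : 'S_K) xpredT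
  (fun s : 'S_K => \int[mu]_x (\sum_(k < K) (h (s k) x - G2 k x) ^+ 2)%:E)%E isT
  (fun s _ => leey _).
rewrite /loss s1E s2E.
have msum (G : 'I_K -> R -> R) (s : 'S_K) : (forall k, measurable_fun [set: R] (G k)) ->
    measurable_fun [set: R] (fun x => \sum_(k < K) (h (s k) x - G k x) ^+ 2).
  move=> mG; apply: measurable_sum => k; apply: measurable_funX.
  exact: measurable_funB.
have sum0 (G : 'I_K -> R -> R) (s : 'S_K) x : 0 <= \sum_(k < K) (h (s k) x - G k x) ^+ 2.
  by apply: sumr_ge0 => k _; exact: sqr_ge0.
rewrite -ge0_integralD_EFin; [|exact: msum|exact: msum|by []|by []].
pose t := (s2 * s1^-1)%g.
have half : (eps ^+ 2 / 2 = 2^-1 * eps ^+ 2 :> R) by rewrite mulrC.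
rewrite half EFinM -muleA.
apply: le_trans (lee_wpmul2l _ (perturbed_perm_separated t)) _; first by rewrite lee_fin invr_ge0.
have mt : measurable_fun [set: R] (fun x => \sum_k (G1 (t k) x - G2 k x) ^+ 2).
  by apply: measurable_sum => k; exact: mG12.
rewrite -ge0_integralZ_EFin ?invr_ge0//; last first.
  by move=> x; apply: sumr_ge0 => k _; exact: sqr_ge0.
apply: ge0_le_integral_EFin => //.
- exact: measurable_funM.
- by apply: measurable_funD; exact: msum.
- by move=> x; rewrite mulr_ge0 ?invr_ge0// sumr_ge0// => k _; exact: sqr_ge0.
- move=> x; have -> : \sum_(k < K) (h (s1 k) x - G1 k x) ^+ 2 =
      \sum_(k < K) (h (s1 (t k)) x - G1 (t k) x) ^+ 2.
    by rewrite [LHS](reindex_inj (@perm_inj _ t)).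
  rewrite mulr_sumr -big_split/=.
  apply: ler_sum => k _; have -> : s1 (t k) = s2 k by rewrite /t permM permKV.
  have := sqr_ge0 (2 * h (s2 k) x - G1 (t k) x - G2 k x).
  by move: (h _ x) (G1 _ x) (G2 _ x) => u v w; nra.
Qed.

End separation.

(** An exponential-free bound of the product by [1 / (1 - S)], with [S] the sum. A total chi-square
    budget of 1/5 thus gives the second moment 5/4 of the likelihood ratio test. *)
Lemma prod_1D_le (R : realFieldType) (I : Type) (r : seq I) (x : I -> R) :
  (forall i, 0 <= x i) ->
  (\prod_(i <- r) (1 + x i)) * (1 - \sum_(i <- r) x i) <= 1.
Proof.
move=> x0; elim: r => [|i r IH]; first by rewrite !big_nil subr0 mulr1.
rewrite !big_cons; set P := \prod_(j <- r) _ in IH *; set S := \sum_(j <- r) _ in IH *.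
have P0 : 0 <= P by apply: prodr_ge0 => j _; rewrite addr_ge0.
have S0 : 0 <= S by apply: sumr_ge0.
have xi := x0 i; apply: le_trans IH.
rewrite -subr_ge0 (_ : _ - _ = P * (x i * S + x i ^+ 2)); last by ring.
by rewrite mulr_ge0// addr_ge0 ?mulr_ge0// exprn_ge0.
Qed.

Section mixture_chi2.
Variables (R : realType) (p q : R -> R) (B : R) (A : set R).
Local Notation mu := (@lebesgue_measure R).
Hypotheses (mp : measurable_fun [set: R] p) (mq : measurable_fun [set: R] q).
Hypotheses (p0 : forall x, 0 <= p x) (q0 : forall x, 0 <= q x).
Hypotheses (p1 : (\int[mu]_x (p x)%:E = 1)%E) (q1 : (\int[mu]_x (q x)%:E = 1)%E).
Hypotheses (mA : measurable A) (B0 : 0 <= B).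
Hypothesis pqB : forall x, (p x - q x) ^+ 2 <= B * \1_A x * q x.

(* Where [q] vanishes so does [p - q], and the ratio is then [1]. *)
Definition likelihood_ratio x : R := 1 + (p x - q x) / q x.

Let pq_eq x : q x = 0 -> p x = 0.
Proof.
move=> qx; have := pqB x; rewrite qx mulr0 subr0 => h; apply/eqP.
by rewrite -sqrf_eq0 eq_le h sqr_ge0.
Qed.

Lemma likelihood_ratioM x : likelihood_ratio x * q x = p x.
Proof.
rewrite /likelihood_ratio; have [qx|qx] := eqVneq (q x) 0.
  by rewrite qx mulr0 pq_eq.
by rewrite mulrDl mul1r divfK// addrC subrK.
Qed.

Lemma likelihood_ratio_ge0 x : 0 <= likelihood_ratio x.
Proof.
rewrite /likelihood_ratio; have [qx|qx] := eqVneq (q x) 0.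
  by rewrite qx invr0 mulr0 addr0.
by rewrite mulrBl divff// addrC subrK divr_ge0.
Qed.

Lemma measurable_likelihood_ratio : measurable_fun [set: R] likelihood_ratio.
Proof.
rewrite /likelihood_ratio; apply: measurable_funD => //; apply: measurable_funM.
  exact: measurable_funB.
rewrite (_ : (fun x => _) = (fun x => q x `^ (-1))); last first.
  by apply/funext => x; rewrite powR_inv1.
exact: (measurableT_comp (@measurable_powR R (-1)) mq).
Qed.

(** Where [q > 0], the ratio [r] satisfies [r^2 q + q = 2 p + (p - q)^2 / q], and the last term is
    at most [B] on [A] and 0 elsewhere. Adding [q] on the left keeps all integrands nonnegative. *)
Lemma chi2_bound m : (mu A <= m%:E)%E -> exists e : R,
  (\int[mu]_x (likelihood_ratio x ^+ 2 * q x)%:E = e%:E)%E /\ 0 <= e <= 1 + B * m.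
Proof.
move=> muA; have mr := measurable_likelihood_ratio.
pose f x := likelihood_ratio x ^+ 2 * q x.
have mf : measurable_fun [set: R] f by apply: measurable_funM => //; exact: measurable_funX.
have f0 x : 0 <= f x by rewrite mulr_ge0 ?sqr_ge0.
have mA1 : measurable_fun [set: R] (\1_A : R -> R) by exact: measurable_indic.
have mB : measurable_fun [set: R] (fun x => B * \1_A x) by exact: measurable_funM.
have m2p : measurable_fun [set: R] (fun x => 2 * p x) by exact: measurable_funM.
have pt x : f x + q x <= 2 * p x + B * \1_A x.
  rewrite /f /likelihood_ratio; have [qx|qx] := eqVneq (q x) 0.
    by rewrite qx (pq_eq qx) !mulr0 !add0r mulr_ge0.
  have qp : 0 < q x by rewrite lt0r qx q0.
  have -> : (1 + (p x - q x) / q x) ^+ 2 * q x + q x = 2 * p x + (p x - q x) ^+ 2 / q x.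
    by field.
  by rewrite lerD2l ler_pdivrMr.
have : (\int[mu]_x (f x + q x)%:E <= \int[mu]_x (2 * p x + B * \1_A x)%:E)%E.
  apply: ge0_le_integral_EFin => //; try exact: measurable_funD.
  by move=> x; rewrite addr_ge0.
rewrite !ge0_integralD_EFin//; try by move=> x; rewrite mulr_ge0.
have intA : (\int[mu]_x (\1_A x)%:E = mu A)%E by rewrite integral_indic ?setIT.
rewrite !ge0_integralZ_EFin// p1 q1 intA => h.
have {h} : (\int[mu]_x (f x)%:E + 1 <= (2 + B * m)%:E)%E.
  apply: le_trans h _; rewrite [leRHS](_ : _ = (2%:E + B%:E * m%:E)%E); last by [].
  apply: leeD; first by rewrite ?mule1.
  by apply: lee_wpmul2l => //; rewrite lee_fin.
have : (0 <= \int[mu]_x (f x)%:E)%E by apply: integral_ge0 => x _; rewrite lee_fin.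
case: (\int[mu]_x (f x)%:E)%E => [e| |]//= e0 h; exists e; split => //.
by move: e0 h; rewrite -EFinD !lee_fin => -> /=; lra.
Qed.

End mixture_chi2.

Section measurable_loss.
Variables (R : realType) (K N : nat).
Local Notation mu := (@lebesgue_measure R).

Lemma measurable_loss (ghat : N.-tuple R -> 'I_K -> R -> R) (g : 'I_K -> R -> R) :
  (forall k, measurable_fun [set: N.-tuple R * R] (fun p => ghat p.1 k p.2)) ->
  (forall k, measurable_fun [set: R] (g k)) ->
  measurable_fun [set: N.-tuple R] (fun t => loss (ghat t) g).
Proof.
move=> mghat mg.
have mF (s : 'S_K) : measurable_fun [set: N.-tuple R]
    (fun t => \int[mu]_x (\sum_(k < K) (ghat t (s k) x - g k x) ^+ 2)%:E)%E.
  pose f (p : N.-tuple R * R) := (\sum_(k < K) (ghat p.1 (s k) p.2 - g k p.2) ^+ 2)%:E.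
  have mf : measurable_fun [set: N.-tuple R * R] f.
    apply/measurable_EFinP; apply: measurable_sum => k; apply: measurable_funX.
    apply: measurable_funB; first exact: mghat.
    exact: (measurableT_comp (mg k) measurable_snd).
  apply: (@measurable_fun_fubini_tonelli_F _ _ _ _ R mu f mf).
  by move=> p; rewrite lee_fin; apply: sumr_ge0 => k _; exact: sqr_ge0.
rewrite /loss; elim: (index_enum _) => [|s r IH].
  by under eq_fun do rewrite big_nil; exact: measurable_cst.
under eq_fun do rewrite big_cons /=.
exact: measurable_mine.
Qed.

End measurable_loss.

(** * The hypercube of parameters *)

Section assouad_family.
Variables (R : realType) (K n : nat) (Ni : 'I_n -> nat).
Variables (beta L0 c1 c2 c3 : R).
Variables (A lo hi c3b delta C kappa eps : R).
Variables (b : 'I_K -> R -> R) (Pi : 'M[R]_(n, K)) (J : nat).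
Variable q : {ffun 'I_J -> bool} -> R -> R.
Local Notation mu := (@lebesgue_measure R).
Local Notation a := (J%:R `^ (- beta)).
Hypotheses (K0 : (0 < K)%N) (J0 : (0 < J)%N) (L00 : 0 <= L0)
  (delta0 : 0 < delta) (C0 : 0 <= C) (kappa0 : 0 < kappa)
  (eps0 : 0 < eps) (eps1 : eps <= 1 / 3).
Hypotheses (b_ok : density_model beta A lo hi c3b b) (Pi_ok : Pi_model c2 Pi)
  (famq : perturbation_family beta delta C kappa q).
Hypotheses (hA : (1 - eps) * A + eps * (2 * delta * C ^+ 2) <= L0 ^+ 2)
  (hlo : c1 <= (1 - 3 * eps) * lo - eps * (C ^+ 2 * delta))
  (hhi : (1 - eps) * hi + eps * (C ^+ 2 * delta) <= c1^-1)
  (hgb : (1 - eps) * hi + eps * C <= c1^-1)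
  (hc3 : c3 + delta <= c3b)
  (hsep : eps * (2 * (C ^+ 2 * delta) + 6 * lo) <= 2 * lo).
Hypothesis hchi : forall k, (\sum_i (Ni i)%:R * Pi i k) *
  (eps * (C * a ^+ 2 / kappa) * (C / J%:R)) <= 1 / 5.

Local Notation cube := {ffun 'I_K * 'I_J -> bool}.

Let eps01 : 0 <= eps <= 1 / 3. Proof. by rewrite (ltW eps0). Qed.

Definition cube_row (f : cube) (k : 'I_K) : {ffun 'I_J -> bool} := [ffun j => f (k, j)].

Definition cube_densities (f : cube) : 'I_K -> R -> R :=
  perturbed eps b (fun k => q (cube_row f k)).

Definition cube_params (f : cube) : params R K n := (cube_densities f, Pi).

Let density_q f : [/\ continuous (q f), forall x, 0 <= q f x <= C,
  forall x, ~~ (0 < x < delta) -> q f x = 0 & (\int[mu]_x (q f x)%:E = 1)%E].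
Proof. by have [h _ _ _] := famq; exact: h. Qed.

Let model_cube f : density_model beta (L0 ^+ 2) c1 c1^-1 c3 (cube_densities f).
Proof.
have [hq1 hq2 _ _] := famq.
by apply: (perturb_model delta0 C0 eps01 (fun k => hq1 (cube_row f k))
  (fun k => hq2 (cube_row f k)) b_ok).
Qed.

Lemma cube_params_Theta f : Theta K n beta L0 c1 c2 c3 (cube_params f).
Proof. by apply/ThetaP. Qed.

Let mq f : measurable_fun [set: R] (q f).
Proof. by have [c _ _ _] := density_q f; exact: continuous_measurable_fun. Qed.

Let mb k : measurable_fun [set: R] (b k).
Proof. by have [h _ _ _ _] := b_ok; have [] := h k. Qed.

Let mG f k : measurable_fun [set: R] (cube_densities f k).
Proof. by apply: measurable_funD; apply: measurable_funM. Qed.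

Lemma hamming_cube f f' :
  hamming R f f' = \sum_k hamming R (cube_row f k) (cube_row f' k).
Proof.
rewrite /hamming pair_big/=; apply: eq_bigr => -[k j] _ /=.
by rewrite !ffunE.
Qed.

Let q_diff_sqr f f' x : (q f x - q f' x) ^+ 2 <= C ^+ 2 * \1_(`[0, delta]) x.
Proof.
have [_ qC qout _] := density_q f; have [_ qC' qout' _] := density_q f'.
rewrite indicE; have [xI|xI] := boolP (x \in _) => /=.
  rewrite mulr1; have /andP[h1 h2] := qC x; have /andP[h3 h4] := qC' x.
  by rewrite -real_normK ?num_real// ler_pXn2r ?nnegrE// ler_norml; apply/andP; split; lra.
have x0 : ~~ (0 < x < delta).
  apply: contra xI => /andP[/ltW h1 /ltW h2]; apply/mem_set => /=.
  by rewrite in_itv/= h1 h2.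
by rewrite qout// qout'// subrr expr0n mulr0.
Qed.

Let separated (h : 'I_K -> R -> R) f f' : (forall k, measurable_fun [set: R] (h k)) ->
  ((eps ^+ 2 / 2 * (kappa * (a ^+ 2 / J%:R)) * hamming R f f')%:E <=
   loss h (cube_densities f) + loss h (cube_densities f'))%E.
Proof.
move=> mh; have [_ _ _ lob _] := b_ok; have [_ _ sepq _] := famq.
have := @loss_perturbed_separated R K lo delta C eps delta0 eps01 hsep b
  (fun k => q (cube_row f k)) (fun k => q (cube_row f' k)) mb (fun k => mq _) (fun k => mq _)
  (fun v => (lob v).1) (fun k l x => q_diff_sqr _ _ x) h mh.
apply: le_trans; rewrite -mulrA EFinM; apply: lee_wpmul2l.
  by rewrite lee_fin divr_ge0 ?sqr_ge0.
under eq_integral do rewrite -sumEFin.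
rewrite ge0_integral_sum//; last 2 first.
- by move=> k; apply/measurable_EFinP; apply: measurable_funX; exact: measurable_funB (mq _) (mq _).
- by move=> k x _; rewrite lee_fin sqr_ge0.
rewrite hamming_cube mulr_sumr -sumEFin; apply: lee_sum => k _.
exact: sepq.
Qed.

Let G0 f k x : 0 <= cube_densities f k x.
Proof. by have [h _ _ _ _] := model_cube f; have [_ + _] := h k; apply. Qed.

Let Pi0 i k : 0 <= Pi i k. Proof. by have [[h _] _] := Pi_ok; exact: h. Qed.
Let Pi1 i : \sum_k Pi i k = 1. Proof. by have [[_ h] _] := Pi_ok; exact: h. Qed.

Let mmix f i : measurable_fun [set: R] (mixture (cube_params f) i).
Proof.
apply: measurable_sum => k; apply: measurable_funM; first exact: measurable_cst.
exact: mG.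
Qed.

Let mix0 f i x : 0 <= mixture (cube_params f) i x.
Proof. by apply: sumr_ge0 => k _; rewrite mulr_ge0//; exact: G0. Qed.

Let mix1 f i : (\int[mu]_x (mixture (cube_params f) i x)%:E = 1)%E.
Proof.
under eq_integral do rewrite -sumEFin.
rewrite ge0_integral_sum//=; last 2 first.
- by move=> k; apply/measurable_EFinP; apply: measurable_funM => //; exact: mG.
- by move=> k x _; rewrite lee_fin mulr_ge0//; exact: G0.
rewrite -(Pi1 i) -sumEFin; apply: eq_bigr => k _.
have [h _ _ _ _] := model_cube f; have [_ _ hk] := h k.
by rewrite ge0_integralZ_EFin ?hk ?mule1//; do ?[exact: mG|exact: G0].
Qed.

Lemma cube_row_flip f k j l :
  cube_row (flip (k, j) f) l = if l == k then flip j (cube_row f k) else cube_row f l.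
Proof.
apply/ffunP => j'; rewrite !ffunE xpair_eqE; case: eqP => [->|_]/=; rewrite !ffunE//.
Qed.

(* The two mixtures of sample [i] differ by [Pi i k * eps] times a single
   bump, on whose support all the components are at least [eps * kappa]. *)
Let mixture_flip f k j i : exists S : set R, [/\ measurable S, (mu S <= (C / J%:R)%:E)%E &
  forall x, (mixture (cube_params (flip (k, j) f)) i x - mixture (cube_params f) i x) ^+ 2 <=
    Pi i k * (eps * (C * a ^+ 2 / kappa)) * \1_S x * mixture (cube_params f) i x].
Proof.
have [_ _ _ flipq] := famq; have [S [mS muS qS kS]] := flipq (cube_row f k) j.
exists S; split => // x.
have -> : mixture (cube_params (flip (k, j) f)) i x - mixture (cube_params f) i x =
    Pi i k * eps * (q (flip j (cube_row f k)) x - q (cube_row f k) x).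
  rewrite /mixture -sumrB (bigD1 k)//= big1 ?addr0 => [|l lk].
    by rewrite /cube_densities /perturbed cube_row_flip eqxx; ring.
  by rewrite /cube_densities /perturbed cube_row_flip (negbTE lk) subrr.
have pik1 : Pi i k <= 1.
  by rewrite -(Pi1 i) (bigD1 k)//= lerDl; apply: sumr_ge0.
have a20 : 0 <= a ^+ 2 by exact: sqr_ge0.
have := qS x; rewrite -sqrrN opprB indicE.
have [/set_mem xS|xS] := boolP (x \in S) => /=; last first.
  rewrite mulr0 => h; rewrite !mulr0 mul0r exprMn.
  by rewrite (_ : (q _ x - q _ x) ^+ 2 = 0) ?mulr0//; apply/eqP; rewrite eq_le h sqr_ge0.
rewrite !mulr1 => h.
have mixlb : eps * kappa <= mixture (cube_params f) i x.
  rewrite -[leLHS]mul1r -(Pi1 i) mulr_suml; apply: ler_sum => l _.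
  apply: ler_wpM2l => //; rewrite /= /cube_densities /perturbed.
  have bl : 0 <= b l x by have [hb _ _ _ _] := b_ok; have [_ + _] := hb l; apply.
  have h1 : 0 <= (1 - eps) * b l x by rewrite mulr_ge0//; move: eps1; lra.
  have h2 := ler_wpM2l (ltW eps0) (kS x (cube_row f l) xS).
  by apply: le_trans h2 _; rewrite lerDr.
set w := Pi i k in pik1 *; set y := (q _ x - q _ x) in h *.
have w0 : 0 <= w by exact: Pi0.
(* The squared difference carries [w^2]. One factor [w <= 1] is given up so that the divergence is
   linear in [Pi i k] and its sum over the samples is controlled by [eta_Pi]. *)
apply: (@le_trans _ _ (w * (eps * (C * a ^+ 2 / kappa)) * (eps * kappa))).
  rewrite [leRHS](_ : _ = w * eps ^+ 2 * (C * a ^+ 2)); last first.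
    by field; rewrite gt_eqF.
  rewrite exprMn; apply: (@le_trans _ _ ((w * eps) ^+ 2 * (C * a ^+ 2))).
    by rewrite ler_wpM2l ?sqr_ge0.
  rewrite ler_wpM2r ?mulr_ge0// exprMn ler_wpM2r ?sqr_ge0//.
  by rewrite expr2 ler_piMl.
apply: ler_wpM2l => //; rewrite mulr_ge0// mulr_ge0 ?(ltW eps0)//.
by rewrite divr_ge0 ?mulr_ge0// ltW.
Qed.

Context d (Om : measurableType d) (P : params R K n -> probability Om R)
  (X : obs Ni -> Om -> R).
Hypothesis model : forall th, Theta K n beta L0 c1 c2 c3 th -> sampling_model (P th) X th.

Let sum_obs (F : 'I_n -> R) :
  \sum_(o : obs Ni) F (tag o) = \sum_i (Ni i)%:R * F i.
Proof.
rewrite -(@sig_big_dep _ _ _ _ _ xpredT (fun i _ => true) (fun i _ => F i))/=.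
by apply: eq_bigr => i _; rewrite sumr_const card_ord mulr_natl.
Qed.

Lemma cube_indistinguishable f k j (B : set (#|{: obs Ni}|.-tuple R)) : measurable B ->
  (P (cube_params (flip (k, j) f)) (data_of X @^-1` B) <=
   P (cube_params f) (data_of X @^-1` B) + (1 / 2)%:E)%E.
Proof.
move=> mB.
have [mX indQ Qq] := model (cube_params_Theta f).
have [_ indP Pp] := model (cube_params_Theta (flip (k, j) f)).
pose p i := mixture (cube_params (flip (k, j) f)) i.
pose p' i := mixture (cube_params f) i.
pose Bi i := Pi i k * (eps * (C * a ^+ 2 / kappa)).
have Bi0 i : 0 <= Bi i.
  have a20 := sqr_ge0 a.
  apply: mulr_ge0 => //; apply: mulr_ge0; first exact: ltW.
  by apply: divr_ge0; [exact: mulr_ge0|exact: ltW].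
have m0 : 0 <= C / J%:R by rewrite divr_ge0.
have /choice[e eP] : forall i, exists e,
    (\int[mu]_x (likelihood_ratio (p i) (p' i) x ^+ 2 * p' i x)%:E = e%:E)%E /\
    0 <= e <= 1 + Bi i * (C / J%:R).
  move=> i; have [S [mS muS pS]] := mixture_flip f k j i.
  apply: (@chi2_bound R (p i) (p' i) (Bi i) S) => //; [exact: mmix|exact: mmix|
    exact: mix0|exact: mix0|exact: mix1|exact: mix1].
apply: (@likelihood_ratio_test d Om R (obs Ni) (P (cube_params (flip (k, j) f)))
  (P (cube_params f)) X (fun o => p (tag o)) (fun o => p' (tag o))
  (fun o => likelihood_ratio (p (tag o)) (p' (tag o))) (fun o => e (tag o))) => //.
- by move=> o; exact: mmix.
- by move=> o; exact: mix0.
- by move=> o; apply: measurable_likelihood_ratio; [exact: mmix|exact: mmix|exact: mix0].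
- by move=> o x; apply: likelihood_ratio_ge0; [exact: mix0|exact: mix0].
- move=> o x; have [S [mS muS pS]] := mixture_flip f k j (tag o).
  exact: (@likelihood_ratioM R (p (tag o)) (p' (tag o)) _ S pS x).
- by move=> o; have [] := eP (tag o).
- pose x (o : obs Ni) := Bi (tag o) * (C / J%:R).
  have x0 o : 0 <= x o by rewrite mulr_ge0.
  apply: (@le_trans _ _ (\prod_o (1 + x o))).
    by apply: ler_prod => o _; have [_ h] := eP (tag o).
  have S5 : \sum_o x o <= 1 / 5.
    apply: le_trans (hchi k); rewrite (sum_obs (fun i => Bi i * (C / J%:R))).
    rewrite mulr_suml; apply: ler_sum => i _.
    by rewrite /Bi !mulrA.
  have := prod_1D_le (index_enum _) x0; set Q := \prod_(i <- _) _ => h.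
  have Q0 : 0 <= Q by apply: prodr_ge0 => o _; rewrite addr_ge0.
  nra.
Qed.

(** [assouad] with [K J] bits, each worth [eps^2 / 2 * kappa * a^2 / J]: the factor [J] cancels and
    1/8 times 1/2 gives 1/16. *)
Lemma risk_lower_bound (ghat : #|{: obs Ni}|.-tuple R -> 'I_K -> R -> R) :
  estimator ghat ->
  exists2 th, Theta K n beta L0 c1 c2 c3 th &
    ((eps ^+ 2 * kappa / 16 * K%:R * a ^+ 2)%:E <= risk (P th) X ghat th.1)%E.
Proof.
move=> mghat.
have [mX _ _] := model (cube_params_Theta [ffun=> false]).
have mY : measurable_fun [set: Om] (data_of X).
  apply/measurable_fun_tnthP => i; rewrite (_ : _ \o _ = X (enum_val i))//.
  by apply/funext => w /=; rewrite tnth_mktuple.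
have [||||||f hf] := @assouad _ _ Om _ R ('I_K * 'I_J)%type (fun f => P (cube_params f))
  (data_of X) (fun f t => loss (ghat t) (cube_densities f))
  (eps ^+ 2 / 2 * (kappa * (a ^+ 2 / J%:R))).
- exact: mY.
- by move=> f; apply: measurable_loss => // k; exact: mG.
- move=> f t.
  have [s _ sE] := @eq_bigmin _ _ _ +oo%E (1%g : 'S_K) xpredT
    (fun s : 'S_K => \int[mu]_x (\sum_(k < K) (ghat t (s k) x - cube_densities f k x) ^+ 2)%:E)%E
    isT (fun s _ => leey _).
  rewrite /loss sE; apply: integral_ge0 => x _; rewrite lee_fin.
  by apply: sumr_ge0 => k _; exact: sqr_ge0.
- rewrite mulr_ge0 ?divr_ge0 ?sqr_ge0// mulr_ge0 ?(ltW kappa0)// divr_ge0 ?sqr_ge0//.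
- move=> t f f'; apply: separated => k.
  exact: (measurableT_comp (mghat k) (measurable_pair1 t)).
- by move=> f [k j] B mB; exact: cube_indistinguishable.
exists (cube_params f); first exact: cube_params_Theta.
apply: le_trans hf; rewrite lee_fin card_prod !card_ord natrM le_eqVlt.
by apply/orP; left; apply/eqP; field; rewrite pnatr_eq0 -lt0n J0.
Qed.

End assouad_family.

(** * Choice of the constants and conclusion *)

Lemma exists_small (R : realFieldType) (s : seq (R * R)) :
  all (fun p => 0 < p.2) s ->
  exists2 e : R, 0 < e & all (fun p => e * p.1 <= p.2) s.
Proof.
elim: s => [|[D A] s IH] /=; first by exists 1.
case/andP=> A0 s0; have [e e0 he] := IH s0.
have D1 : 0 < 1 + `|D| by rewrite ltr_pwDl.
pose e' := Num.min e (A / (1 + `|D|)).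
have e'0 : 0 < e' by rewrite lt_min e0 divr_gt0.
exists e' => //; apply/andP; split.
  apply: (@le_trans _ _ (e' * (1 + `|D|))).
    by apply: ler_wpM2l; [exact: ltW|rewrite (le_trans (ler_norm _))// lerDr].
  by rewrite -ler_pdivlMr// ge_min lexx orbT.
apply/allP => p ps; have [p0|p0] := leP p.1 0.
  apply: (@le_trans _ _ 0); first by rewrite pmulr_rle0.
  exact/ltW/(allP s0).
by apply: le_trans (allP he p ps); rewrite ler_pM2r// ge_min lexx.
Qed.

(** If [K > n], some nonzero vector is killed by [Pi], and the form of [Sigma_Pi] vanishes there.
    This bounds [N n / K] from below in the main proof. *)
Lemma lambda_min_Sigma_Pi_gt0 (R : realType) (n K : nat) (Pi : 'M[R]_(n, K)) :
  (0 < K)%N -> 0 < lambda_min (Sigma_Pi Pi) -> (K <= n)%N.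
Proof.
move=> K0 l0; rewrite leqNgt; apply/negP => nK.
have [v vP v0] : exists2 v : 'rV[R]_K, v *m Pi^T = 0 & v != 0.
  have : kermx Pi^T != 0.
    rewrite -mxrank_eq0 mxrank_ker subn_eq0 -ltnNge.
    exact: leq_ltn_trans (rank_leq_col _) nK.
  move=> /rowV0Pn[v vk v0]; exists v => //; exact/sub_kermxP.
have SigT : (Sigma_Pi Pi)^T = Sigma_Pi Pi.
  by rewrite /Sigma_Pi linearZ/= trmx_mul trmxK.
have := (lambda_min_geP K0 SigT _).1 (lexx _) v.
rewrite quadraticE /Sigma_Pi -scalemxAr mulmxA vP mul0mx scaler0 mul0mx mxE.
rewrite pmulr_rle0// => h; move/negP: v0; apply; apply/eqP/sqnorm_eq0.
by apply/eqP; rewrite eq_le h sqnorm_ge0.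
Qed.

(** [J] is [y = T^(1 / (2 beta + 1))] rounded up, so that [T J^(-2 beta - 1) <= 1]. Since [T >= t],
    rounding multiplies [y] by at most [1 + 1 / y0], which accounts for [c]. *)
Lemma balanced_resolution (R : realType) (beta t : R) : 0 < beta -> 0 < t ->
  exists2 c : R, 0 < c & forall T, t <= T -> exists J, [/\ (0 < J)%N,
    T * ((J%:R `^ (- beta)) ^+ 2 / J%:R) <= 1 &
    c * T^-1 `^ (2 * beta / (2 * beta + 1)) <= (J%:R `^ (- beta)) ^+ 2].
Proof.
move=> b0 t0; pose r := (2 * beta + 1)^-1; pose y0 := t `^ r.
have b1 : 0 < 2 * beta + 1 by lra.
have r0 : 0 < r by rewrite invr_gt0.
have y00 : 0 < y0 by exact: powR_gt0.
have M0 : 0 < 1 + y0^-1 by rewrite ltr_pwDl// invr_ge0 ltW.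
exists ((1 + y0^-1) `^ (- (2 * beta))); first exact: powR_gt0.
move=> T tT; have T0 : 0 < T by exact: lt_le_trans tT.
pose y := T `^ r; have y1 : 0 < y by exact: powR_gt0.
have yy0 : y0 <= y.
  by apply: ge0_ler_powR; [exact: ltW|exact: ltW|exact: ltW|].
have yT : y `^ (2 * beta + 1) = T by rewrite -powRrM mulVf ?gt_eqF// powRr1// ltW.
pose J := (Num.truncn y).+1.
have /andP[Jlo Jhi] : y <= J%:R <= y * (1 + y0^-1).
  have /andP[h1 h2] := truncn_itv (ltW y1).
  rewrite (ltW h2)/= -natr1 mulrDr mulr1 lerD//.
  by rewrite ler_pdivlMr// mul1r.
have J0 : 0 < J%:R :> R by rewrite ltr0n.
have a2 : (J%:R `^ (- beta)) ^+ 2 = J%:R `^ (- (2 * beta)).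
  by rewrite -powR_mulrn ?powR_ge0// -powRrM mulNr (mulrC beta).
exists J; split => //.
  rewrite a2 -powR_inv1 ?ler0n// -powRD ?(gt_eqF J0) ?implybT// -opprD powRN.
  rewrite ler_pdivrMr ?powR_gt0// mul1r -yT.
  by apply: ge0_ler_powR => //; [exact: ltW|exact: ltW|exact: ltW].
have -> : T^-1 `^ (2 * beta / (2 * beta + 1)) = y `^ (- (2 * beta)).
  by rewrite -(powR_inv1 (ltW T0)) -!powRrM mulN1r mulrN (mulrC r).
rewrite a2 -powRM ?(ltW M0) ?(ltW y1)// mulrC !powRN.
rewrite lef_pV2 ?posrE ?powR_gt0// ?mulr_gt0//.
have M2 : 0 <= y * (1 + y0^-1) by rewrite mulr_ge0// ltW.
by apply: ge0_ler_powR; [rewrite mulr_ge0// ltW|exact: ltW|exact: M2|exact: Jhi].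
Qed.

Theorem theorem6 (R : realType)
    (beta L0 c1 c2 c3 : R)
    (hbeta : 0 < beta) (hL0 : 0 < L0)
    (hc1 : 0 < c1 < 1) (hc2 : 0 < c2 < 1) (hc3 : 0 < c3)
    (n K : nat -> nat) (N : nat -> R) (Ni : forall s : nat, 'I_(n s) -> nat)
    (hn : forall s, (0 < n s)%N) (hK : forall s, (0 < K s)%N)
    (hN : forall s, 0 < N s)
    (hNn : (fun s => N s * (n s)%:R) @ \oo --> +oo)
    (hNi : exists a b : R, [/\ 0 < a, 0 < b &
       forall (s : nat) (i : 'I_(n s)), a * N s <= (Ni s i)%:R <= b * N s])
    (c1' : R) (hc1' : c1 < c1')
    (hTheta : forall s : nat, Theta (K s) (n s) beta L0 c1' c2 c3 !=set0) :
  exists2 C0' : R, 0 < C0' &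
    forall (s : nat) (d : measure_display) (Om : measurableType d)
      (P : params R (K s) (n s) -> probability Om R)
      (X : obs (Ni s) -> Om -> R),
    (forall th, Theta (K s) (n s) beta L0 c1 c2 c3 th ->
       sampling_model (P th) X th) ->
    ((C0' * (K s)%:R *
       ((K s)%:R / (N s * (n s)%:R)) `^ (2 * beta / (2 * beta + 1)))%:E
     <= minimax_risk P X (Theta (K s) (n s) beta L0 c1 c2 c3))%E.
Proof.
have [a [b [a0 b0 hab]]] := hNi.
have [/andP[c10 _] /andP[c20 _]] := (hc1, hc2).
have c1'0 : 0 < c1' by exact: lt_trans hc1'.
(* Dilating by [rho < 1] the densities of the smaller class gives slack in the
   smoothness constraint and enlarges each anchor set by measure [delta]. *)
pose rho := (c1 + c1') / (2 * c1').
have rho0 : 0 < rho by rewrite divr_gt0 ?addr_gt0// mulr_gt0.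
have rho1 : rho < 1 by rewrite ltr_pdivrMr ?mulr_gt0// mul1r; lra.
pose delta := c3 / rho - c3.
have delta0 : 0 < delta by rewrite subr_gt0 ltr_pdivlMr// gtr_pMr.
have [C [kappa [C0 kappa0 hq]]] := perturbation_families hbeta delta0.
have c1V : c1'^-1 < c1^-1 by rewrite ltf_pV2.
have C2d : 0 < C ^+ 2 * delta by rewrite mulr_gt0// exprn_gt0.
(* [rho] was chosen so that the dilated eigenvalue bound is the midpoint of [c1] and [c1']; the
   upper half of the gap pays for the dilation, the lower half for the mixing. *)
have [lo loE lo1] : exists2 lo, rho * c1' = lo & c1 < lo.
  exists ((c1 + c1') / 2); last by lra.
  by rewrite /rho; field; rewrite gt_eqF.
have lo0 : 0 < lo by exact: lt_trans lo1.
clearbody rho.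
(* In order: convexity weight, smoothness, smallest eigenvalue, largest eigenvalue, bound on [gbar],
   separation under relabelling, chi-square budget. None of them involves [s]. *)
have [|eps eps0 /=] := @exists_small R [:: (1, 1 / 3);
  (2 * delta * C ^+ 2, (1 - rho) * L0 ^+ 2); (3 * lo + C ^+ 2 * delta, lo - c1);
  (C ^+ 2 * delta, c1^-1 - c1'^-1); (C, c1^-1 - c1'^-1);
  (2 * (C ^+ 2 * delta) + 6 * lo, 2 * lo); (b / c2 * (C / kappa * C), 1 / 5)].
  by rewrite /= !subr_gt0 lo1 c1V !divr_gt0// ?mulr_gt0 ?subr_gt0 ?exprn_gt0//.
case/and5P=> e1 e2 e3 e4 /and4P[e5 e6 e7 _].
have [cJ cJ0 resolution] := balanced_resolution hbeta (divr_gt0 ltr01 b0).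
exists (eps ^+ 2 * kappa / 16 * cJ).
  by rewrite !(mulr_gt0, divr_gt0)// exprn_gt0.
move=> s d Om P X model.
have [[g Pi] /(ThetaP _ _ _ _ _ _ (hK s) (ltW hL0))[Pi_ok g_ok]] := hTheta s.
have rho01 : 0 < rho <= 1 by rewrite rho0 ltW.
have c1V0 : 0 <= c1'^-1 by rewrite invr_ge0 ltW.
have b_ok := dilate_model hbeta rho01 (sqr_ge0 L0) c1V0 g_ok.
rewrite loE in b_ok.
pose T := N s * (n s)%:R / (K s)%:R.
have Kp : 0 < (K s)%:R :> R by rewrite ltr0n.
have np : 0 < (n s)%:R :> R by rewrite ltr0n.
(* [T] is the sample size per component. [N_i] is a positive integer because [a N > 0], so
   [b N >= 1], and [n / K >= 1]. *)
have T1 : 1 / b <= T.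
  have Kn : (K s <= n s)%N.
    apply: (@lambda_min_Sigma_Pi_gt0 R _ _ Pi (hK s)).
    by have [_ [+ _ _]] := Pi_ok; exact: lt_trans.
  have := hab s (Ordinal (hn s)); case/andP=> h1 h2.
  have Ni1 : 1 <= (Ni s (Ordinal (hn s)))%:R :> R.
    by rewrite ler1n -(ltr0n R); apply: lt_le_trans h1; exact: mulr_gt0.
  rewrite /T ler_pdivlMr// ler_pM ?divr_ge0 ?(ltW b0)// ?ler_nat//.
  by rewrite ler_pdivrMr// mulrC (le_trans Ni1).
have [J [J0 TJ cJT]] := resolution T T1.
have [q famq] := hq J J0.
have -> : (K s)%:R / (N s * (n s)%:R) = T^-1 by rewrite /T invf_div.
apply: le_ereal_inf_tmp => _ [ghat mghat <-].
have hchi k : (\sum_i (Ni s i)%:R * Pi i k) *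
    (eps * (C * (J%:R `^ (- beta)) ^+ 2 / kappa) * (C / J%:R)) <= 1 / 5.
  have etaE : eta_Pi Pi k 0 = \sum_i Pi i k.
    by rewrite /eta_Pi mxE; apply: eq_bigr => i _; rewrite !mxE mulr1.
  have [[Pi0 _] [_ _ /(_ k)/andP[_]]] := Pi_ok; rewrite etaE => hPi.
  have S1 : \sum_i (Ni s i)%:R * Pi i k <= b * T / c2.
    rewrite [leRHS](_ : _ = b * N s * (c2^-1 * (K s)%:R^-1 * (n s)%:R)); last first.
      by rewrite /T; ring.
    apply: (@le_trans _ _ (b * N s * \sum_i Pi i k)).
      rewrite mulr_sumr; apply: ler_sum => i _; apply: ler_wpM2r => //.
      by have /andP[] := hab s i.
    by apply: ler_wpM2l => //; apply: mulr_ge0; exact: ltW.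
  have D0 : 0 <= eps * (b / c2 * (C / kappa * C)).
    by rewrite ltW// mulr_gt0// mulr_gt0 ?divr_gt0// mulr_gt0// divr_gt0.
  apply: le_trans e7; apply: (@le_trans _ _ (eps * (b / c2 * (C / kappa * C)) *
      (T * ((J%:R `^ (- beta)) ^+ 2 / J%:R)))); last by rewrite ler_piMr.
  rewrite [leRHS](_ : _ = b * T / c2 *
      (eps * (C * (J%:R `^ (- beta)) ^+ 2 / kappa) * (C / J%:R))); last first.
    by field; rewrite ?gt_eqF// ltr0n J0.
  apply: ler_wpM2r => //; apply: mulr_ge0; last by rewrite divr_ge0// ltW.
  apply: mulr_ge0; first exact: ltW.
  apply: divr_ge0; last exact: ltW.
  by apply: mulr_ge0; [exact: ltW|exact: sqr_ge0].
have [|||||||th thT hth] := @risk_lower_bound R (K s) (n s) (Ni s) beta L0 c1 c2 c3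
  (rho * L0 ^+ 2) lo c1'^-1 (c3 / rho) delta C kappa eps _ Pi J q (hK s) J0 (ltW hL0)
  delta0 (ltW C0) kappa0 eps0 _ b_ok Pi_ok famq _ _ _ _ _ _ hchi d Om P X model ghat mghat.
- by move: e1; rewrite mulr1.
- have : 0 <= eps * (rho * L0 ^+ 2).
    by rewrite ltW// mulr_gt0// mulr_gt0// exprn_gt0.
  lra.
- lra.
- have : 0 <= eps * c1'^-1 by rewrite mulr_ge0// ltW.
  lra.
- have : 0 <= eps * c1'^-1 by rewrite mulr_ge0// ltW.
  lra.
- by rewrite /delta addrC subrK.
- exact: e6.
apply: (@le_trans _ _ (risk (P th) X ghat th.1)); last first.
  by apply: ereal_sup_ubound; exists th.
apply: le_trans hth; rewrite lee_fin.
rewrite -[leLHS]mulrA -[leLHS]mulrA (mulrCA cJ) [leLHS]mulrA.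
apply: ler_wpM2l => //; do 2 apply: mulr_ge0 => //.
by apply: mulr_ge0; [exact: sqr_ge0|exact: ltW].
Qed.
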